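(* For $(j,k)=(0,1)$, $(0,3)$ or $(1,3)$, \[ L_{U}(a,\lambda) =-U'(a,0) U_{0}^{(j,k)}(-a,2\lambda)-\tfrac{1}{2}U(a,0) U_{1}^{(j,k)}(-a,2\lambda). \]
   Context: $U(a,z)$ is the standard parabolic cylinder function, the solution of $y''-(\tfrac14 z^2+a)y=0$ with $U(a,z)\sim z^{-a-1/2}e^{-z^2/4}$ as $z\to\infty$, $|\arg z|\le\tfrac34\pi-\delta$. $L_{U}(a,\lambda)=\int_{0}^{\infty} e^{-\lambda t} U(a,t)dt$ (entire in $\lambda$). For $R=0,1$: $U_{R}^{(1,3)}(a,z)=\frac{i\Gamma(\tfrac{1}{2}-a)}{\sqrt{2\pi}}[U(-a,iz)\int_{i\infty}^z t^{R}U(-a,-it)dt-U(-a,-iz) \int_{-i\infty}^z t^{R}U(-a,it)dt]$; $U_{R}^{(0,1)}(a,z)=e^{(\frac{1}{2}a-\frac{1}{4})\pi i}[U(-a,-iz) \int_{\infty}^z t^{R}U(a,t)dt-U(a,z) \int_{i\infty}^z t^{R}U(-a,-it)dt]$; and $U_{R}^{(0,3)}(a,z)$ is given by the formula for $U_{R}^{(0,1)}$ with $i$ replaced by $-i$. These solve $y''-(\tfrac14 z^2+a)y=z^R$. *)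

(* Defs.v *)
From Stdlib Require Import Reals Factorial.
From Coquelicot Require Import Coquelicot.
Open Scope C_scope.

Definition cexp (z : C) : C :=
  (exp (Re z) * cos (Im z), exp (Re z) * sin (Im z))%R.

Definition carg (z : C) : R :=
  let x := Re z in let y := Im z in
  if Rlt_dec 0 x then atan (y / x)
  else if Rlt_dec x 0 then
    (if Rle_dec 0 y then atan (y / x) + PI else atan (y / x) - PI)%R
  else if Rlt_dec 0 y then (PI / 2)%R
  else if Rlt_dec y 0 then (- (PI / 2))%R
  else 0%R.

Definition cln (z : C) : C := (ln (Cmod z), carg z).

Definition cpow (z w : C) : C := cexp (w * cln z).

(** Euler's Gamma function on C via Gauss' product formula
    Gamma z = lim_n n! n^z / (z (z+1) ... (z+n)). *)
Fixpoint poch_prod (z : C) (n : nat) : C :=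
  match n with
  | O => z
  | S m => poch_prod z m * (z + RtoC (INR (S m)))
  end.

Definition gauss_seq (z : C) (n : nat) : C :=
  RtoC (INR (fact n)) * cexp (z * RtoC (ln (INR n))) / poch_prod z n.

Definition CGamma (z : C) : C :=
  lim (T := C_CompleteNormedModule) (filtermap (gauss_seq z) eventually).

(** The standard parabolic cylinder function U(a,z) is characterised as the
    (unique) function such that, for every a, z |-> U a z is entire
    (complex derivative Up a z), solves y'' = (z^2/4 + a) y, and
    U(a,z) ~ z^(-a-1/2) e^(-z^2/4) as z -> oo in |arg z| <= 3pi/4 - delta. *)
Definition is_PCF_U (U Up : C -> C -> C) : Prop :=
  (forall a z : C,
      is_derive (K := C_AbsRing) (V := C_NormedModule) (U a) z (Up a z) /\
      is_derive (K := C_AbsRing) (V := C_NormedModule) (Up a) z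
                ((z * z / 4 + a) * U a z)) /\
  (forall (a : C) (delta eps : R), (0 < delta)%R -> (0 < eps)%R ->
     exists M : R, forall z : C, (M < Cmod z)%R ->
       (Rabs (carg z) <= 3 * PI / 4 - delta)%R ->
       (Cmod (U a z / (cpow z (- a - / 2) * cexp (- (z * z) / 4)) - 1)
          < eps)%R).

Definition ray_int (g : C -> C) (z d : C) : C :=
  RInt_gen (V := C_R_CompleteNormedModule)
    (fun s : R => g (z + RtoC s * d) * d) (at_point 0%R) (Rbar_locally p_infty).

(** Contour integral  \int_{d oo}^{z} g(t) dt  (along the ray from z
    in direction d, traversed towards z). *)
Definition cint_from_inf (d : C) (g : C -> C) (z : C) : C :=
  - ray_int g z d.

Definition L_U (U : C -> C -> C) (a lam : C) : C :=
  RInt_gen (V := C_R_CompleteNormedModule)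
    (fun t : R => cexp (- lam * RtoC t) * U a (RtoC t))
    (at_point 0%R) (Rbar_locally p_infty).

Inductive jk_pair : Type := JK01 | JK03 | JK13.

Definition U_jk (U : C -> C -> C) (p : jk_pair) (R : nat) (a z : C) : C :=
  match p with
  | JK13 =>
      Ci * CGamma (/ 2 - a) / RtoC (sqrt (2 * PI)) *
      (U (- a) (Ci * z) *
         cint_from_inf Ci (fun t => t ^ R * U (- a) (- Ci * t)) z
       - U (- a) (- Ci * z) *
         cint_from_inf (- Ci) (fun t => t ^ R * U (- a) (Ci * t)) z)
  | JK01 =>
      cexp ((a / 2 - / 4) * RtoC PI * Ci) *
      (U (- a) (- Ci * z) * cint_from_inf 1 (fun t => t ^ R * U a t) z
       - U a z * cint_from_inf Ci (fun t => t ^ R * U (- a) (- Ci * t)) z)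
  | JK03 =>
      cexp ((a / 2 - / 4) * RtoC PI * (- Ci)) *
      (U (- a) (Ci * z) * cint_from_inf 1 (fun t => t ^ R * U a t) z
       - U a z * cint_from_inf (- Ci) (fun t => t ^ R * U (- a) (Ci * t)) z)
  end.

(* Main.v *)
(** As a function of z = 2 lambda, F(z) = L_U(a, z/2) solves
    F'' - (z^2/4 - a) F = - U'(a,0) - (z/2) U(a,0), and F, F' are bounded on every right half-plane.
    Green's identity against a homogeneous solution V that is recessive in a direction d with
    Re d >= 0 therefore expresses F' V - F V' at z by the contour integrals of V and t V from
    d oo to z. Doing this for two recessive solutions and eliminating F' gives F times their
    Wronskian. For (0,1) and (0,3) the Wronskian is read off from the asymptotics of U.
    For (1,3) it is a multiple of w(a) = - 2 U(a,0) U'(a,0), and one needs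
    w(a) Gamma(a + 1/2) = sqrt (2 pi). Since w(a) = (a + 1/2) w(a + 1), Gauss' product reduces
    this to w(a + n + 1) ~ sqrt (2 pi) / (n! n^(a + 1/2)). The integral representation of U and Laplace's
    method give w(c + 1/2) E_c E_{c+1} = pi with E_c = int_0^oo t^c e^(-t^2/2) dt, and E_{n+z} is
    asymptotically n^(z/2) times the n-th Gaussian moment. *)
Require Import Defs.
From Stdlib Require Import Reals Factorial Lra Lia.
From Coquelicot Require Import Coquelicot.
Open Scope C_scope.

(** * Complex-valued functions of a real variable *)

(** All contours in the statement are rays, so one real parameter suffices: derivatives are taken
    componentwise along lines, improper integrals are limits of primitives, and no contour is ever
    deformed. Two facts shape the rest. First, [is_PCF_U] gives the asymptotics of [U] alone, for
    each parameter separately: it says nothing about the size of [Up], about values at 0 or about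
    links between parameters. Decay and asymptotics of [Up] are extracted from the differential
    equation by Taylor expansion, and every relation between parameters (recurrence, integral
    representation) comes from the uniqueness of the recessive solution, its factor being fixed by a
    Wronskian with a growing solution. Second, [CGamma] is Gauss' limit, so closed forms of [U(a,0)]
    and [U'(a,0)] are avoided; for (1,3) only their product enters, and in it the unknown factor of
    the integral representation cancels. The representation is used for [1 < Re c] only, which costs
    nothing since Gauss' product pushes the parameter to the right anyway. *)

Definition cder (f : R -> C) (x : R) (l : C) : Prop :=
  is_derive (fun t => Re (f t)) x (Re l) /\ is_derive (fun t => Im (f t)) x (Im l).

Lemma cder_eq f x l l' : cder f x l -> l = l' -> cder f x l'.
Proof. intros H <-; exact H. Qed.

Lemma cder_ext f g x l : (forall t, f t = g t) -> cder f x l -> cder g x l.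
Proof.
  intros E [H1 H2]; split; [eapply is_derive_ext; [|exact H1] | eapply is_derive_ext; [|exact H2]];
  intros t; simpl; now rewrite E.
Qed.

Lemma cder_const c x : cder (fun _ => c) x 0.
Proof. split; simpl; apply @is_derive_const. Qed.

Lemma cder_RtoC g x l : is_derive g x l -> cder (fun t => RtoC (g t)) x (RtoC l).
Proof. intros H; split; simpl; [exact H | apply @is_derive_const]. Qed.

Lemma cder_id x : cder RtoC x 1.
Proof. apply (cder_RtoC (fun t => t)). apply @is_derive_id. Qed.

Lemma cder_plus f g x l m : cder f x l -> cder g x m -> cder (fun t => f t + g t) x (l + m).
Proof. intros [] []; split; simpl; now apply @is_derive_plus. Qed.

Lemma cder_opp f x l : cder f x l -> cder (fun t => - f t) x (- l).
Proof. intros []; split; simpl; now apply @is_derive_opp. Qed.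

Lemma cder_minus f g x l m : cder f x l -> cder g x m -> cder (fun t => f t - g t) x (l - m).
Proof. intros; apply cder_plus; [|apply cder_opp]; auto. Qed.

Lemma cder_mult f g x l m :
  cder f x l -> cder g x m -> cder (fun t => f t * g t) x (l * g x + f x * m).
Proof.
  intros [H1 H2] [H3 H4]; split; simpl.
  - evar_last.
    + apply @is_derive_minus; (eapply (is_derive_mult (K := R_AbsRing)); [eassumption|eassumption|intros; apply Rmult_comm]).
    + unfold minus, plus, opp, mult; simpl. unfold Re, Im. ring.
  - evar_last.
    + apply @is_derive_plus; (eapply (is_derive_mult (K := R_AbsRing)); [eassumption|eassumption|intros; apply Rmult_comm]).
    + unfold minus, plus, opp, mult; simpl. unfold Re, Im. ring.
Qed.

Lemma cder_comp f g x l m :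
  cder f (g x) l -> is_derive g x m -> cder (fun t => f (g t)) x (RtoC m * l).
Proof.
  intros [H1 H2] H; split.
  - evar_last. apply (is_derive_comp (fun t => Re (f t)) g); eassumption.
    unfold scal; simpl; unfold mult; simpl; unfold Re, Im; ring.
  - evar_last. apply (is_derive_comp (fun t => Im (f t)) g); eassumption.
    unfold scal; simpl; unfold mult; simpl; unfold Re, Im; ring.
Qed.

Lemma cexp_plus a b : cexp (a + b) = cexp a * cexp b.
Proof.
  unfold cexp; destruct a as [a1 a2], b as [b1 b2]; unfold Cmult; simpl.
  rewrite exp_plus, cos_plus, sin_plus; f_equal; ring.
Qed.

Lemma cexp_RtoC r : cexp (RtoC r) = RtoC (exp r).
Proof. unfold cexp, RtoC; simpl. rewrite cos_0, sin_0; f_equal; ring. Qed.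

Lemma cexp_0 : cexp 0 = 1.
Proof. rewrite cexp_RtoC. now rewrite exp_0. Qed.

Lemma Cmod_cexp z : Cmod (cexp z) = exp (Re z).
Proof.
  unfold Cmod, cexp; simpl.
  replace (_ + _)%R with ((exp (Re z)) ^ 2)%R.
  - rewrite sqrt_pow2; [reflexivity | left; apply exp_pos].
  - generalize (sin2_cos2 (Im z)); unfold Rsqr; intros H.
    transitivity (exp (Re z) ^ 2 * (sin (Im z) * sin (Im z) + cos (Im z) * cos (Im z)))%R; [rewrite H|]; ring.
Qed.

Lemma cexp_neq_0 z : cexp z <> 0.
Proof. apply Cmod_gt_0. rewrite Cmod_cexp. apply exp_pos. Qed.

Lemma cexp_opp z : cexp (- z) * cexp z = 1.
Proof. rewrite <- cexp_plus. replace (- z + z) with (RtoC 0) by ring. apply cexp_0. Qed.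

Lemma cder_cexp f x l : cder f x l -> cder (fun t => cexp (f t)) x (l * cexp (f x)).
Proof.
  intros [H1 H2]; split; unfold cexp; simpl.
  - evar_last. eapply (is_derive_mult (K := R_AbsRing)).
    apply (is_derive_comp exp (fun t => Re (f t))); [apply is_derive_exp|exact H1].
    apply (is_derive_comp cos (fun t => Im (f t))); [apply is_derive_cos|exact H2].
    intros; apply Rmult_comm.
    unfold scal, plus; simpl; unfold mult; simpl; unfold Re, Im; ring.
  - evar_last. eapply (is_derive_mult (K := R_AbsRing)).
    apply (is_derive_comp exp (fun t => Re (f t))); [apply is_derive_exp|exact H1].
    apply (is_derive_comp sin (fun t => Im (f t))); [apply is_derive_sin|exact H2].
    intros; apply Rmult_comm.
    unfold scal, plus; simpl; unfold mult; simpl; unfold Re, Im; ring.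
Qed.

Lemma im_le_Cmod z : (Rabs (Im z) <= Cmod z)%R.
Proof. eapply Rle_trans; [|apply Rmax_Cmod]. apply Rmax_r. Qed.

Lemma Cmod_le_Re_Im z : (Cmod z <= Rabs (Re z) + Rabs (Im z))%R.
Proof.
  destruct z as [x y]; simpl.
  assert (E : (x, y) = RtoC x + Ci * RtoC y) by (unfold Cplus, Cmult, Ci, RtoC; simpl; f_equal; ring).
  rewrite E. eapply Rle_trans; [apply Cmod_triangle|].
  rewrite Cmod_mult, Cmod_Ci, !Cmod_R, Rmult_1_l. apply Rle_refl.
Qed.

Lemma Cmod_sub_comm x y : Cmod (x - y) = Cmod (y - x).
Proof. rewrite <- Cmod_opp. f_equal; ring. Qed.

Lemma Cmod_sub_triangle x y : (Cmod (x - y) <= Cmod x + Cmod y)%R.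
Proof. unfold Cminus. rewrite <- (Cmod_opp y). apply Cmod_triangle. Qed.

Lemma Cmod_triangle_inv x y : (Cmod x - Cmod y <= Cmod (x - y))%R.
Proof. generalize (Cmod_triangle (x - y) y). replace (x - y + y) with x by ring. lra. Qed.

(** Lets a derivative be obtained from a single estimate of the complex modulus, as is done for
    restrictions to lines, for powers near 0 and under the Laplace integral. *)
Lemma cder_eps f x l :
  (forall eps : R, (0 < eps)%R -> exists delta : R, (0 < delta)%R /\
     forall h : R, (Rabs h < delta)%R -> (Cmod (f (x + h)%R - f x - RtoC h * l) <= eps * Rabs h)%R) ->
  cder f x l.
Proof.
  intros H.
  (* [Re] and [Im] are treated at once: both are real-linear and dominated by the modulus. Halving
     [eps] below turns the non-strict bound into the strict one required. *)
  assert (K : forall (part : C -> R),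
     (forall z, Rabs (part z) <= Cmod z)%R ->
     (forall a b (h : R) c, part (a - b - RtoC h * c) = (part a - part b - h * part c)%R) ->
     is_derive (fun t => part (f t)) x (part l)).
  { intros part P1 P2. apply is_derive_Reals. intros eps He.
    destruct (H (eps / 2)%R) as [d [Hd Hh]]; [lra|].
    exists (mkposreal d Hd). intros h h0 hd. simpl in hd.
    specialize (Hh h hd).
    generalize (P1 (f (x + h)%R - f x - RtoC h * l)). rewrite P2. intros Q.
    assert (0 < Rabs h)%R by now apply Rabs_pos_lt.
    replace ((part (f (x + h)%R) - part (f x)) / h - part l)%R
      with ((part (f (x + h)%R) - part (f x) - h * part l) / h)%R by now field.
    unfold Rdiv. rewrite Rabs_mult, Rabs_inv.
    apply Rmult_lt_reg_r with (Rabs h); auto.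
    rewrite Rmult_assoc, Rinv_l by lra. nra. }
  split; apply K.
  - apply re_le_Cmod.
  - intros [] [] ? []; simpl; ring.
  - apply im_le_Cmod.
  - intros [] [] ? []; simpl; ring.
Qed.

Lemma cder_line (f : C -> C) (z d l : C) (s : R) :
  is_derive (K := C_AbsRing) (V := C_NormedModule) f (z + RtoC s * d) l ->
  cder (fun t => f (z + RtoC t * d)) s (d * l).
Proof.
  intros [_ H]. apply cder_eps. intros eps He.
  specialize (H (z + RtoC s * d) (fun P HP => HP)).
  assert (Hd : (0 <= Cmod d)%R) by apply Cmod_ge_0.
  (* Dividing by [Cmod d + 1] rather than [Cmod d] keeps the case [d = 0]. *)
  assert (Hd1 : (0 < Cmod d + 1)%R) by lra.
  assert (Hp : (0 < eps / (Cmod d + 1))%R) by now apply Rdiv_lt_0_compat.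
  destruct (H (mkposreal _ Hp)) as [delta Hdel].
  exists (delta / (Cmod d + 1))%R; split; [apply Rdiv_lt_0_compat; [apply cond_pos|auto]|].
  intros h Hh.
  set (w := z + RtoC s * d) in *. set (y := z + RtoC (s + h) * d).
  assert (E : y - w = RtoC h * d) by (unfold y, w; rewrite RtoC_plus; ring).
  assert (Em : Cmod (y - w) = (Rabs h * Cmod d)%R) by (rewrite E, Cmod_mult, Cmod_R; reflexivity).
  assert (B : (Cmod (y - w) < delta)%R).
  { rewrite Em. apply Rmult_lt_compat_r with (r := (Cmod d + 1)%R) in Hh; auto.
    unfold Rdiv in Hh. rewrite Rmult_assoc, Rinv_l, Rmult_1_r in Hh by lra.
    generalize (Rabs_pos h); nra. }
  specialize (Hdel y B).
  change (Cmod (f y - f w - (y - w) * l) <= eps / (Cmod d + 1) * Cmod (y - w))%R in Hdel.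
  replace (f y - f w - RtoC h * (d * l)) with (f y - f w - (y - w) * l) by (rewrite E; ring).
  eapply Rle_trans; [exact Hdel|]. rewrite Em.
  replace (eps * Rabs h)%R with (eps / (Cmod d + 1) * (Rabs h * (Cmod d + 1)))%R by (field; lra).
  apply Rmult_le_compat_l; [lra|]. generalize (Rabs_pos h); nra.
Qed.

Lemma is_derive_nonneg_le (f f' : R -> R) (a b : R) : (a <= b)%R ->
  (forall x, (a <= x <= b)%R -> is_derive f x (f' x)) ->
  (forall x, (a <= x <= b)%R -> (0 <= f' x)%R) -> (f a <= f b)%R.
Proof.
  intros ab H P. destruct (MVT_gen f a b f') as [c [Hc E]].
  - rewrite Rmin_left, Rmax_right by auto. intros; apply H; lra.
  - rewrite Rmin_left, Rmax_right by auto. intros x Hx.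
    apply derivable_continuous_pt. exists (f' x). now apply is_derive_Reals, H.
  - rewrite Rmin_left, Rmax_right in Hc by auto. generalize (P c Hc). nra.
Qed.

Lemma Re_Im_dot_le z w : (Re z * Re w + Im z * Im w <= Cmod z * Cmod w)%R.
Proof.
  rewrite <- (Cmod_conj z), <- Cmod_mult.
  replace (Re z * Re w + Im z * Im w)%R with (Re (Cconj z * w)).
  - eapply Rle_trans; [apply Rle_abs|apply re_le_Cmod].
  - destruct z, w; simpl; ring.
Qed.

(* Project on the direction of [P b - P a] and apply the real mean value theorem. *)
Lemma Cmod_increment_le (P p : R -> C) (G g : R -> R) (a b : R) : (a <= b)%R ->
  (forall x, (a <= x <= b)%R -> cder P x (p x)) ->
  (forall x, (a <= x <= b)%R -> is_derive G x (g x)) ->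
  (forall x, (a <= x <= b)%R -> (Cmod (p x) <= g x)%R) ->
  (Cmod (P b - P a) <= G b - G a)%R.
Proof.
  intros ab HP HG Hpg.
  set (D := P b - P a). set (d := Cmod D).
  assert (Hd : (0 <= d)%R) by apply Cmod_ge_0.
  assert (HGm : (G a <= G b)%R).
  { apply (is_derive_nonneg_le G g); auto. intros x Hx.
    eapply Rle_trans; [apply Cmod_ge_0|now apply Hpg]. }
  assert (K : (d * G a - (Re D * Re (P a) + Im D * Im (P a))
               <= d * G b - (Re D * Re (P b) + Im D * Im (P b)))%R).
  { apply (is_derive_nonneg_le
             (fun x => d * G x - (Re D * Re (P x) + Im D * Im (P x)))%R
             (fun x => d * g x - (Re D * Re (p x) + Im D * Im (p x)))%R); auto.
    - intros x Hx. destruct (HP x Hx) as [H1 H2].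
      apply (is_derive_minus (fun x => d * G x)%R (fun x => Re D * Re (P x) + Im D * Im (P x))%R).
      + apply (is_derive_scal G x d (g x)); now apply HG.
      + apply (is_derive_plus (fun x => Re D * Re (P x))%R (fun x => Im D * Im (P x))%R).
        * apply (is_derive_scal (fun x => Re (P x)) x (Re D) (Re (p x)) H1).
        * apply (is_derive_scal (fun x => Im (P x)) x (Im D) (Im (p x)) H2).
    - intros x Hx. generalize (Re_Im_dot_le D (p x)) (Hpg x Hx). fold d. nra. }
  assert (E : (Re D * (Re (P b) - Re (P a)) + Im D * (Im (P b) - Im (P a)) = d * d)%R).
  { assert (X := Cmod2_alt D). fold d in X. unfold D in *. destruct (P a), (P b); simpl in *.
    unfold Re, Im in *; simpl in *. nra. }
  destruct (Req_dec d 0) as [->|]; [lra|].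
  apply Rmult_le_reg_l with d; nra.
Qed.

Lemma cder_continuous f x l : cder f x l ->
  continuous (fun t => Re (f t)) x /\ continuous (fun t => Im (f t)) x.
Proof.
  intros [H1 H2]; split; apply (ex_derive_continuous (K := R_AbsRing) (V := R_NormedModule)); eexists; eassumption.
Qed.

(** Stands in for continuity of integrands: it is inherited through the product and chain rules
    above. *)
Definition cdiff (f : R -> C) : Prop := forall x, exists l, cder f x l.

Lemma cdiff_primitive f : cdiff f -> exists P, forall x, cder P x (f x).
Proof.
  intros Hf.
  assert (K : forall h : R -> R, (forall x, continuous h x) ->
            forall x, is_derive (fun t => RInt h 0 t) x (h x)).
  { intros h Hh x. apply (is_derive_RInt (V := R_NormedModule) h (fun t => RInt h 0 t) 0 x); auto.
    apply filter_forall. intros y. apply (RInt_correct (V := R_CompleteNormedModule)).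
    apply (ex_RInt_continuous (V := R_CompleteNormedModule)); auto. }
  exists (fun t => (RInt (fun s => Re (f s)) 0 t, RInt (fun s => Im (f s)) 0 t)).
  intros x; split; simpl.
  - apply (K (fun s => Re (f s))). intros y; destruct (Hf y) as [l Hl]; apply (cder_continuous _ _ _ Hl).
  - apply (K (fun s => Im (f s))). intros y; destruct (Hf y) as [l Hl]; apply (cder_continuous _ _ _ Hl).
Qed.

(** * Limits and improper integrals of complex-valued functions *)

Definition flim {T} (F : (T -> Prop) -> Prop) (f : T -> C) (l : C) : Prop :=
  forall eps : R, (0 < eps)%R -> F (fun x => (Cmod (f x - l) < eps)%R).

Notation ctends f l := (flim (Rbar_locally p_infty) f l).

Section Flim.
Context {T : Type} (F : (T -> Prop) -> Prop) {FF : ProperFilter F}.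

Lemma flim_ext_ev f g l : F (fun x => f x = g x) -> flim F f l -> flim F g l.
Proof.
  intros E H eps He. eapply filter_imp; [|apply filter_and; [exact E|exact (H eps He)]].
  intros x [<- ?]; auto.
Qed.

Lemma flim_ext f g l : (forall x, f x = g x) -> flim F f l -> flim F g l.
Proof. intros E; apply flim_ext_ev, filter_forall, E. Qed.

Lemma flim_eq f l l' : flim F f l -> l = l' -> flim F f l'.
Proof. now intros ? <-. Qed.

Lemma flim_const c : flim F (fun _ => c) c.
Proof. intros eps He. apply filter_forall. intros _. replace (c - c) with (RtoC 0) by ring. now rewrite Cmod_0. Qed.

Lemma flim_plus f g l m : flim F f l -> flim F g m -> flim F (fun x => f x + g x) (l + m).
Proof.
  intros H1 H2 eps He.
  eapply filter_imp; [|apply filter_and; [apply (H1 (eps / 2)%R); lra|apply (H2 (eps / 2)%R); lra]].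
  intros x [A B]. replace (f x + g x - (l + m)) with (f x - l + (g x - m)) by ring.
  generalize (Cmod_triangle (f x - l) (g x - m)); lra.
Qed.

Lemma flim_mult f g l m : flim F f l -> flim F g m -> flim F (fun x => f x * g x) (l * m).
Proof.
  intros H1 H2 eps He.
  set (K := (Cmod l + Cmod m + 1)%R).
  assert (Kp : (1 <= K)%R) by (unfold K; generalize (Cmod_ge_0 l) (Cmod_ge_0 m); lra).
  (* The bound [e <= 1] absorbs the quadratic error term, the other one the two linear terms. *)
  set (e := Rmin 1 (eps / (2 * K))).
  assert (Hq : (0 < eps / (2 * K))%R) by (apply Rdiv_lt_0_compat; lra).
  assert (e0 : (0 < e)%R) by (unfold e; apply Rmin_pos; lra).
  assert (e1 : (e <= 1)%R) by apply Rmin_l.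
  assert (e2 : (e * K <= eps / 2)%R).
  { replace (eps / 2)%R with (eps / (2 * K) * K)%R by (field; lra).
    apply Rmult_le_compat_r; [lra|apply Rmin_r]. }
  eapply filter_imp; [|apply filter_and; [apply (H1 e e0)|apply (H2 e e0)]].
  intros x [A B]. replace (f x * g x - l * m) with ((f x - l) * (g x - m) + (l * (g x - m) + (f x - l) * m)) by ring.
  eapply Rle_lt_trans; [apply Cmod_triangle|].
  eapply Rle_lt_trans; [apply Rplus_le_compat_l, Cmod_triangle|].
  rewrite !Cmod_mult.
  generalize (Cmod_ge_0 l) (Cmod_ge_0 m) (Cmod_ge_0 (f x - l)) (Cmod_ge_0 (g x - m)); intros.
  assert (Cmod (f x - l) * Cmod (g x - m) <= e * 1)%R by (apply Rmult_le_compat; lra).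
  assert (Cmod l * Cmod (g x - m) <= Cmod l * e)%R by (apply Rmult_le_compat_l; lra).
  assert (Cmod (f x - l) * Cmod m <= e * Cmod m)%R by (apply Rmult_le_compat_r; lra).
  assert (e * Cmod l + e * Cmod m + e <= eps / 2)%R by (unfold K in e2; lra). lra.
Qed.

Lemma flim_opp f l : flim F f l -> flim F (fun x => - f x) (- l).
Proof.
  intros H eps He. eapply filter_imp; [|exact (H eps He)]. intros x Hx.
  replace (- f x - - l) with (- (f x - l)) by ring. now rewrite Cmod_opp.
Qed.

Lemma flim_minus f g l m : flim F f l -> flim F g m -> flim F (fun x => f x - g x) (l - m).
Proof. intros; apply flim_plus; [|apply flim_opp]; auto. Qed.

Lemma flim_unique f l m : flim F f l -> flim F f m -> l = m.
Proof.
  intros H1 H2. destruct (Rle_lt_or_eq_dec _ _ (Cmod_ge_0 (l - m))) as [E|E]; [|symmetry in E].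
  - exfalso. assert (P : (0 < Cmod (l - m) / 2)%R) by lra.
    destruct (filter_ex _ (filter_and _ _ (H1 _ P) (H2 _ P))) as [x [A B]].
    generalize (Cmod_triangle (l - f x) (f x - m)). replace (l - f x + (f x - m)) with (l - m) by ring.
    rewrite (Cmod_sub_comm l (f x)). lra.
  - apply Cmod_eq_0 in E. replace l with (l - m + m) by ring. rewrite E; ring.
Qed.

Lemma flim_le f l g :
  F (fun x => (Cmod (f x - l) <= g x)%R) -> flim F (fun x => RtoC (g x)) 0 -> flim F f l.
Proof.
  intros H G eps He. eapply filter_imp; [|apply filter_and; [exact H|exact (G eps He)]].
  intros x [A B]. replace (RtoC (g x) - 0) with (RtoC (g x)) in B by ring.
  rewrite Cmod_R in B. generalize (Rle_abs (g x)); lra.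
Qed.

Lemma flim_Cmod_le f l M : flim F f l -> F (fun x => (Cmod (f x) <= M)%R) -> (Cmod l <= M)%R.
Proof.
  intros H B. apply le_epsilon. intros eps He.
  destruct (filter_ex _ (filter_and _ _ (H _ He) B)) as [x [A1 A2]].
  rewrite Cmod_sub_comm in A1. generalize (Cmod_triangle_inv l (f x)). lra.
Qed.

Lemma flim_inv f (l : C) : l <> 0 -> flim F f l -> flim F (fun x => / f x) (/ l).
Proof.
  intros Hl H eps He. pose proof (proj1 (Cmod_gt_0 l) Hl) as Hl'.
  set (L := Cmod l) in *.
  set (e := Rmin (L / 2) (eps * (L * L) / 4)).
  assert (Hq : (0 < eps * (L * L) / 4)%R) by (apply Rdiv_lt_0_compat; [apply Rmult_lt_0_compat; nra|lra]).
  assert (e0 : (0 < e)%R) by (apply Rmin_pos; lra).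
  assert (e1 : (e <= L / 2)%R) by apply Rmin_l.
  assert (e2 : (e <= eps * (L * L) / 4)%R) by apply Rmin_r.
  eapply filter_imp; [|exact (H e e0)].
  intros x Hx. cbv beta in Hx. rewrite Cmod_sub_comm in Hx. generalize (Cmod_triangle_inv l (f x)). fold L. intros A.
  assert (Q : (L / 2 <= Cmod (f x))%R) by lra.
  assert (N : f x <> 0) by (apply Cmod_gt_0; lra).
  replace (/ f x - / l) with ((l - f x) / (f x * l)) by (field; auto).
  rewrite Cmod_div by (now apply Cmult_neq_0). rewrite Cmod_mult. fold L.
  assert (Z : (0 < Cmod (f x) * L)%R) by (apply Rmult_lt_0_compat; lra).
  apply Rmult_lt_reg_r with (Cmod (f x) * L)%R; auto.
  unfold Rdiv. rewrite Rmult_assoc, Rinv_l by lra.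
  assert (eps * (L / 2 * L) <= eps * (Cmod (f x) * L))%R.
  { apply Rmult_le_compat_l; [lra|]. apply Rmult_le_compat_r; lra. }
  nra.
Qed.
End Flim.

Lemma flim_of_is_lim (g : R -> R) (l : R) : is_lim g p_infty l -> ctends (fun x => RtoC (g x)) (RtoC l).
Proof.
  intros H eps He. apply is_lim_spec in H. destruct (H (mkposreal eps He)) as [M HM].
  exists M. intros x Hx. rewrite <- RtoC_minus, Cmod_R. now apply HM.
Qed.

Lemma flim_of_is_lim_seq (g : nat -> R) (l : R) : is_lim_seq g l -> flim eventually (fun x => RtoC (g x)) (RtoC l).
Proof.
  intros H eps He. apply is_lim_seq_spec in H. destruct (H (mkposreal eps He)) as [M HM].
  exists M. intros x Hx. rewrite <- RtoC_minus, Cmod_R. now apply HM.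
Qed.

Lemma flim_of_filterlim {T} (F : (T -> Prop) -> Prop) {FF : Filter F} (f : T -> C) (l : C) :
  filterlim f F (locally (T := C_UniformSpace) l) -> flim F f l.
Proof.
  intros H eps He.
  (* Balls of the product uniform structure on [C] are squares; the square of half-size [eps / 2]
     fits into the disc of radius [eps]. *)
  assert (He2 : (0 < eps / 2)%R) by lra.
  specialize (H (ball (M := C_UniformSpace) l (eps / 2)) (locally_ball (T := C_UniformSpace) l (mkposreal _ He2))).
  unfold filtermap in H. eapply filter_imp; [|exact H].
  intros x [B1 B2]. change (Rabs (Re (f x) - Re l) < eps / 2)%R in B1.
  change (Rabs (Im (f x) - Im l) < eps / 2)%R in B2.
  eapply Rle_lt_trans; [apply Cmod_le_Re_Im|].
  destruct (f x), l; simpl in *. unfold Re, Im in *; simpl in *.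
  unfold Rminus in *. lra.
Qed.

Lemma flim_to_filterlim {T} (F : (T -> Prop) -> Prop) {FF : Filter F} (f : T -> C) (l : C) :
  flim F f l -> filterlim f F (locally (T := C_UniformSpace) l).
Proof.
  intros H P [d HP]. unfold filtermap. eapply filter_imp; [|exact (H d (cond_pos d))].
  intros x Hx. apply HP. now apply C_NormedModule_mixin_compat1.
Qed.

(** The improper integral over the half-line, encoded by a primitive with a limit. Linearity, the
    fundamental theorem and domination become statements about primitives, and [RInt_gen] is met
    only in [is_cint_RInt_gen]. *)
Definition is_cint (f : R -> C) (l : C) : Prop :=
  exists P, (forall x, cder P x (f x)) /\ ctends P (P 0%R + l).

Lemma is_cint_RInt_gen f l : cdiff f -> is_cint f l ->
  RInt_gen (V := C_R_CompleteNormedModule) f (at_point 0%R) (Rbar_locally p_infty) = l.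
Proof.
  intros Hf [P [HP HL]].
  apply (is_RInt_gen_unique (V := C_R_CompleteNormedModule)).
  intros Q HQ.
  assert (L : ctends (fun x => P x - P 0%R) l).
  { eapply flim_eq; [apply (flim_minus _); [exact HL | apply (flim_const _)]|ring]. }
  apply (flim_to_filterlim _) in L. specialize (L Q HQ).
  unfold filtermapi. exists (fun a => a = 0%R) (fun b => Q (P b - P 0%R)); [reflexivity|exact L|].
  intros x y -> Hy. exists (P y - P 0%R); split; auto. simpl.
  apply (is_RInt_fct_extend_pair (U := R_NormedModule) (V := R_NormedModule)).
  - apply (is_RInt_derive (V := R_CompleteNormedModule) (fun t => Re (P t)) (fun t => Re (f t))).
    + intros; apply HP.
    + intros t _; destruct (Hf t) as [k Hk]; apply (cder_continuous _ _ _ Hk).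
  - apply (is_RInt_derive (V := R_CompleteNormedModule) (fun t => Im (P t)) (fun t => Im (f t))).
    + intros; apply HP.
    + intros t _; destruct (Hf t) as [k Hk]; apply (cder_continuous _ _ _ Hk).
Qed.

Lemma is_cint_plus f g l m : is_cint f l -> is_cint g m -> is_cint (fun x => f x + g x) (l + m).
Proof.
  intros [P [HP LP]] [Q [HQ LQ]]. exists (fun x => P x + Q x); split.
  - intros; now apply cder_plus.
  - eapply flim_eq; [apply (flim_plus _); eassumption | ring].
Qed.

Lemma is_cint_scal c f l : is_cint f l -> is_cint (fun x => c * f x) (c * l).
Proof.
  intros [P [HP LP]]. exists (fun x => c * P x); split.
  - intros x. eapply cder_eq; [apply cder_mult; [apply cder_const|apply HP]|cbv beta; ring].
  - eapply flim_eq; [apply (flim_mult _); [apply (flim_const _)|exact LP]|cbv beta; ring].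
Qed.

Lemma is_cint_ext f g l : (forall x, f x = g x) -> is_cint f l -> is_cint g l.
Proof. intros E [P [HP LP]]. exists P; split; auto. intros; rewrite <- E; auto. Qed.

Lemma is_cint_eq f l l' : is_cint f l -> l = l' -> is_cint f l'.
Proof. now intros ? <-. Qed.

Lemma is_cint_minus f g l m : is_cint f l -> is_cint g m -> is_cint (fun x => f x - g x) (l - m).
Proof.
  intros H1 H2. eapply is_cint_eq; [eapply is_cint_ext; [|apply is_cint_plus; [exact H1|apply (is_cint_scal (- (1))), H2]]|].
  intros x. cbv beta. ring. ring.
Qed.

Lemma is_cint_derive P p l : (forall x, cder P x (p x)) -> ctends P l -> is_cint p (l - P 0%R).
Proof. intros H1 H2. exists P; split; auto. eapply flim_eq; [exact H2|cbv beta; ring]. Qed.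

Lemma cder_equal_of_zero_increment (P p Q : R -> C) (a b : R) : (a <= b)%R ->
  (forall x, (a <= x <= b)%R -> cder P x (p x)) ->
  (forall x, (a <= x <= b)%R -> cder Q x (p x)) -> P b - P a = Q b - Q a.
Proof.
  intros ab HP HQ.
  assert (H : (Cmod ((P b - Q b) - (P a - Q a)) <= 0 - 0)%R).
  { apply (Cmod_increment_le (fun x => P x - Q x) (fun x => p x - p x) (fun _ => 0%R) (fun _ => 0%R)); auto.
    - intros; apply cder_minus; auto.
    - intros. apply @is_derive_const.
    - intros. replace (p x - p x) with (RtoC 0) by ring. rewrite Cmod_0. lra. }
  assert (Z : (P b - Q b) - (P a - Q a) = 0).
  { apply Cmod_eq_0. generalize (Cmod_ge_0 ((P b - Q b) - (P a - Q a))). lra. }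
  replace (P b - P a) with ((P b - Q b) - (P a - Q a) + (Q b - Q a)) by ring. rewrite Z; ring.
Qed.

Lemma is_cint_Cmod_le f l (G g : R -> R) (Gl : R) : is_cint f l ->
  (forall x, (0 <= x)%R -> is_derive G x (g x)) ->
  (forall x, (0 <= x)%R -> (Cmod (f x) <= g x)%R) ->
  (forall x, (0 <= x)%R -> (G x <= Gl)%R) -> (Cmod l <= Gl - G 0)%R.
Proof.
  intros [P [HP LP]] HG Hfg HB.
  apply (flim_Cmod_le (Rbar_locally p_infty) (fun x => P x - P 0%R)).
  - eapply flim_eq; [apply (flim_minus _); [exact LP | apply (flim_const _)]|cbv beta; ring].
  - exists 0%R. intros x Hx. eapply Rle_trans.
    + apply (Cmod_increment_le P f G g 0 x); [lra|auto|..]; intros; [apply HG|apply Hfg]; lra.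
    + generalize (HB x). lra.
Qed.

(** For a dominating function without explicit primitive: the real part of its primitive is
    nondecreasing on the half-line, so it stays below its limit, and that limit is the bound
    [is_cint_Cmod_le] asks for. *)
Lemma is_cint_Cmod_le_cint f l (g : R -> R) (gl : R) : is_cint f l ->
  is_cint (fun x => RtoC (g x)) (RtoC gl) ->
  (forall x, (0 <= x)%R -> (Cmod (f x) <= g x)%R) -> (Cmod l <= gl)%R.
Proof.
  intros Hf [Q [HQ LQ]] H.
  assert (D : forall x, is_derive (fun t => Re (Q t)) x (g x)) by (intros x; apply (HQ x)).
  assert (I : forall x y, (0 <= x <= y)%R -> (Re (Q x) <= Re (Q y))%R).
  { intros x y Hxy. apply (is_derive_nonneg_le (fun t => Re (Q t)) g); [lra|auto|].
    intros t Ht. eapply Rle_trans; [apply Cmod_ge_0|apply H]; lra. }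
  assert (B : forall x, (0 <= x)%R -> (Re (Q x) <= Re (Q 0%R) + gl)%R).
  { intros x Hx. apply le_epsilon. intros eps He. destruct (LQ eps He) as [M HM].
    set (y := Rmax x (M + 1)).
    generalize (I x y (conj Hx (Rmax_l _ _))). specialize (HM y).
    assert (M < y)%R by (unfold y; generalize (Rmax_r x (M + 1)); lra).
    specialize (HM H0). generalize (re_le_Cmod (Q y - (Q 0%R + RtoC gl))).
    generalize (Rle_abs (Re (Q y - (Q 0%R + RtoC gl)))).
    destruct (Q y), (Q 0%R); simpl; unfold Re; simpl. lra. }
  generalize (is_cint_Cmod_le f l (fun t => Re (Q t)) g (Re (Q 0%R) + gl) Hf (fun x _ => D x) H B). lra.
Qed.

(** Increments of a primitive of [f] are bounded by those of the convergent [G], so the Cauchy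
    criterion applies. *)
Lemma ex_is_cint_dominated f (G g : R -> R) (Gl : R) : cdiff f ->
  (forall x, (0 <= x)%R -> is_derive G x (g x)) ->
  (forall x, (0 <= x)%R -> (Cmod (f x) <= g x)%R) ->
  is_lim G p_infty Gl -> exists l, is_cint f l.
Proof.
  intros Hf HG Hfg HL. destruct (cdiff_primitive f Hf) as [P HP].
  assert (Hc : exists y : C, filterlim P (Rbar_locally p_infty) (locally (T := C_UniformSpace) y)).
  { apply (filterlim_locally_cauchy (U := C_R_CompleteNormedModule) (F := Rbar_locally p_infty)).
    intros eps. apply is_lim_spec in HL.
    assert (He : (0 < eps / 2)%R) by (generalize (cond_pos eps); lra).
    destruct (HL (mkposreal _ He)) as [M HM]. simpl in HM.
    exists (fun x => (Rmax M 0 < x)%R). split; [exists (Rmax M 0); auto|].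
    assert (K : forall u v, (Rmax M 0 < u)%R -> (u <= v)%R -> (Cmod (P v - P u) < eps)%R).
    { intros u v Hu Huv.
      assert (M < u)%R by (generalize (Rmax_l M 0); lra).
      assert (0 < u)%R by (generalize (Rmax_r M 0); lra).
      eapply Rle_lt_trans.
      - apply (Cmod_increment_le P f G g u v); auto; intros; [apply HG|apply Hfg]; lra.
      - generalize (HM u) (HM v). intros A B.
        specialize (A ltac:(lra)). specialize (B ltac:(lra)).
        apply Rabs_def2 in A. apply Rabs_def2 in B. lra. }
    intros u v Hu Hv. apply C_NormedModule_mixin_compat1.
    change (Cmod (P v - P u) < eps)%R.
    destruct (Rle_dec u v); [now apply K|]. rewrite Cmod_sub_comm. apply K; lra. }
  destruct Hc as [y Hy]. exists (y - P 0%R). apply is_cint_derive; auto.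
  now apply (flim_of_filterlim _).
Qed.

(** * Laplace transforms of superexponentially decaying functions *)

Lemma exp_le_compat x y : (x <= y)%R -> (exp x <= exp y)%R.
Proof. intros [H | ->]; [left; now apply exp_increasing|apply Rle_refl]. Qed.

Lemma Cmod_cexp_le w : (Cmod (cexp w) <= exp (Cmod w))%R.
Proof.
  rewrite Cmod_cexp. apply exp_le_compat. eapply Rle_trans; [apply Rle_abs|apply re_le_Cmod].
Qed.

Lemma cder_cexp_scal w s : cder (fun s => cexp (RtoC s * w)) s (w * cexp (RtoC s * w)).
Proof.
  eapply cder_eq; [apply cder_cexp, cder_mult; [apply cder_id|apply cder_const]|cbv beta; ring].
Qed.

(** Mean value bound on the segment from 0 to [w]; [1 + exp (Re w)] dominates [exp (x Re w)] for [x]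
    in [0,1] whatever the sign of [Re w]. Keeping [Re w] in the exponent matters for [w = c ln u],
    where it yields a power of [u]. *)
Lemma Cmod_cexp_sub_1_le w : (Cmod (cexp w - 1) <= Cmod w * (1 + exp (Re w)))%R.
Proof.
  set (K := (Cmod w * (1 + exp (Re w)))%R).
  replace (cexp w - 1) with (cexp (RtoC 1 * w) - cexp (RtoC 0 * w))
    by (replace (RtoC 0 * w) with (RtoC 0) by ring; rewrite cexp_0; do 2 f_equal; ring).
  replace K with (K * 1 - K * 0)%R by ring.
  apply (Cmod_increment_le (fun s => cexp (RtoC s * w)) (fun s => w * cexp (RtoC s * w))
           (fun s => K * s)%R (fun _ => K)); [lra| | |].
  - intros; apply cder_cexp_scal.
  - intros. auto_derive; auto; ring.
  - intros x Hx. rewrite Cmod_mult, Cmod_cexp. apply Rmult_le_compat_l; [apply Cmod_ge_0|].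
    replace (Re (RtoC x * w)) with (x * Re w)%R by (destruct w; simpl; ring).
    destruct (Rle_dec 0 (Re w)).
    + assert (x * Re w <= Re w)%R by nra. apply exp_le_compat in H. lra.
    + assert (x * Re w <= 0)%R by nra. apply exp_le_compat in H. rewrite exp_0 in H. generalize (exp_pos (Re w)); lra.
Qed.

Lemma Cmod_cexp_taylor_le w : (Cmod (cexp w - 1 - w) <= Cmod w ^ 2 * exp (Cmod w))%R.
Proof.
  set (K := (Cmod w * exp (Cmod w))%R).
  assert (Hc : forall s, (0 <= s <= 1)%R -> (Cmod (cexp (RtoC s * w)) <= exp (Cmod w))%R).
  { intros s Hs. eapply Rle_trans; [apply Cmod_cexp_le|]. apply exp_le_compat.
    rewrite Cmod_mult, Cmod_R, Rabs_pos_eq by lra. generalize (Cmod_ge_0 w); nra. }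
  assert (H1 : forall s, (0 <= s <= 1)%R -> (Cmod (cexp (RtoC s * w) - 1) <= K)%R).
  { intros s Hs.
    assert (HK : (0 <= K)%R) by (apply Rmult_le_pos; [apply Cmod_ge_0|left; apply exp_pos]).
    apply Rle_trans with (K * s - K * 0)%R; [|nra].
    replace (cexp (RtoC s * w) - 1) with (cexp (RtoC s * w) - cexp (RtoC 0 * w))
      by (replace (RtoC 0 * w) with (RtoC 0) by ring; now rewrite cexp_0).
    apply (Cmod_increment_le (fun s => cexp (RtoC s * w)) (fun s => w * cexp (RtoC s * w))
           (fun s => K * s)%R (fun _ => K)); [lra| | |].
    - intros; apply cder_cexp_scal.
    - intros. auto_derive; auto; ring.
    - intros x Hx. rewrite Cmod_mult. apply Rmult_le_compat_l; [apply Cmod_ge_0|]. apply Hc; lra. }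
  replace (cexp w - 1 - w) with ((cexp (RtoC 1 * w) - 1 - RtoC 1 * w) - (cexp (RtoC 0 * w) - 1 - RtoC 0 * w)).
  2:{ replace (RtoC 0 * w) with (RtoC 0) by ring. replace (RtoC 1 * w) with w by ring. rewrite cexp_0. ring. }
  replace (Cmod w ^ 2 * exp (Cmod w))%R with (Cmod w * K * 1 - Cmod w * K * 0)%R by (unfold K; ring).
  apply (Cmod_increment_le (fun s => cexp (RtoC s * w) - 1 - RtoC s * w) (fun s => w * (cexp (RtoC s * w) - 1))
           (fun s => Cmod w * K * s)%R (fun _ => (Cmod w * K)%R)); [lra| | |].
  - intros x _. eapply cder_eq.
    + apply cder_minus; [apply cder_minus; [apply cder_cexp_scal|apply cder_const]|].
      apply cder_mult; [apply cder_id|apply cder_const].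
    + cbv beta; ring.
  - intros. auto_derive; auto; ring.
  - intros x Hx. rewrite Cmod_mult. apply Rmult_le_compat_l; [apply Cmod_ge_0|]. now apply H1.
Qed.

(** The form in which convergence is always supplied: it survives multiplication by [t], by bounded
    functions and by [exp (- mu t)] for every complex [mu], so that Laplace transforms exist in the
    whole plane. *)
Definition superexp_decay (f : R -> C) : Prop :=
  forall k : R, exists K : R, forall t : R, (0 <= t)%R -> (Cmod (f t) <= K * exp (- k * t))%R.

Lemma cdiff_bounded f (a b : R) : cdiff f -> exists M, forall x, (a <= x <= b)%R -> (Cmod (f x) <= M)%R.
Proof.
  intros Hf.
  destruct (bounded_continuity (V := R_NormedModule) (fun x => Re (f x)) a b) as [M1 H1].
  { intros x _. destruct (Hf x) as [l Hl]; apply (cder_continuous _ _ _ Hl). }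
  destruct (bounded_continuity (V := R_NormedModule) (fun x => Im (f x)) a b) as [M2 H2].
  { intros x _. destruct (Hf x) as [l Hl]; apply (cder_continuous _ _ _ Hl). }
  exists (M1 + M2)%R. intros x Hx. eapply Rle_trans; [apply Cmod_le_Re_Im|].
  specialize (H1 x Hx). specialize (H2 x Hx). unfold norm in *; simpl in *. unfold abs in *; simpl in *. lra.
Qed.

Lemma superexp_decay_eventually f : cdiff f ->
  (forall k, exists K S, forall t, (S <= t)%R -> (Cmod (f t) <= K * exp (- k * t))%R) -> superexp_decay f.
Proof.
  intros Hf H k. destruct (H k) as [K [S HS]]. destruct (cdiff_bounded f 0 S Hf) as [M HM].
  exists (Rmax K (M * exp (Rabs k * S)))%R. intros t Ht.
  assert (E := exp_pos (- k * t)).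
  destruct (Rle_dec S t) as [Q|Q].
  - eapply Rle_trans; [now apply HS|]. apply Rmult_le_compat_r; [lra|apply Rmax_l].
  - eapply Rle_trans; [apply HM; lra|].
    apply Rle_trans with (M * exp (Rabs k * S) * exp (- k * t))%R; [|apply Rmult_le_compat_r; [lra|apply Rmax_r]].
    rewrite Rmult_assoc, <- exp_plus.
    assert (0 <= M)%R by (eapply Rle_trans; [apply Cmod_ge_0|apply (HM 0%R); lra]).
    rewrite <- (Rmult_1_r M) at 1. apply Rmult_le_compat_l; auto. rewrite <- exp_0. apply exp_le_compat.
    generalize (Rle_abs k) (Rabs_pos k); nra.
Qed.

Lemma superexp_decay_ext f g : (forall t, f t = g t) -> superexp_decay f -> superexp_decay g.
Proof. intros E H k. destruct (H k) as [K HK]. exists K. intros; rewrite <- E; auto. Qed.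

Lemma superexp_decay_plus f g : superexp_decay f -> superexp_decay g -> superexp_decay (fun t => f t + g t).
Proof.
  intros H1 H2 k. destruct (H1 k) as [K1 HK1], (H2 k) as [K2 HK2]. exists (K1 + K2)%R. intros t Ht.
  eapply Rle_trans; [apply Cmod_triangle|]. specialize (HK1 t Ht). specialize (HK2 t Ht). lra.
Qed.

Lemma superexp_decay_scal c f : superexp_decay f -> superexp_decay (fun t => c * f t).
Proof.
  intros H k. destruct (H k) as [K HK]. exists (Cmod c * K)%R. intros t Ht.
  rewrite Cmod_mult, Rmult_assoc. apply Rmult_le_compat_l; [apply Cmod_ge_0|auto].
Qed.

Lemma le_exp t : (t <= exp t)%R.
Proof. generalize (exp_ineq1_le t); lra. Qed.

Lemma superexp_decay_id_mult f : superexp_decay f -> superexp_decay (fun t => RtoC t * f t).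
Proof.
  intros H k. destruct (H (k + 1)%R) as [K HK]. exists K. intros t Ht.
  rewrite Cmod_mult, Cmod_R, Rabs_pos_eq by auto.
  replace (K * exp (- k * t))%R with (exp t * (K * exp (- (k + 1) * t)))%R.
  - apply Rmult_le_compat; auto using Cmod_ge_0, le_exp.
  - rewrite (Rmult_comm K), <- Rmult_assoc, <- exp_plus, Rmult_comm. do 2 f_equal; ring.
Qed.

Lemma cdiff_id_mult f : cdiff f -> cdiff (fun t => RtoC t * f t).
Proof. intros H x. destruct (H x) as [l Hl]. eexists. apply cder_mult; [apply cder_id|exact Hl]. Qed.

Lemma superexp_decay_cexp_mult mu f : superexp_decay f -> superexp_decay (fun t => cexp (- mu * RtoC t) * f t).
Proof.
  intros H k. destruct (H (k - Re mu)%R) as [K HK]. exists K. intros t Ht.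
  rewrite Cmod_mult, Cmod_cexp.
  replace (Re (- mu * RtoC t)) with (- Re mu * t)%R by (destruct mu; simpl; ring).
  replace (K * exp (- k * t))%R with (exp (- Re mu * t) * (K * exp (- (k - Re mu) * t)))%R.
  - apply Rmult_le_compat_l; auto. left; apply exp_pos.
  - rewrite (Rmult_comm K), <- Rmult_assoc, <- exp_plus, Rmult_comm. do 2 f_equal; ring.
Qed.

Lemma cdiff_cexp_mult mu f : cdiff f -> cdiff (fun t => cexp (- mu * RtoC t) * f t).
Proof.
  intros H x. destruct (H x) as [l Hl]. eexists. apply cder_mult; [|exact Hl].
  apply cder_cexp, cder_mult; [apply cder_const|apply cder_id].
Qed.

Lemma is_derive_exp_scal K k x : (k <> 0)%R -> is_derive (fun t => - K / k * exp (- k * t))%R x (K * exp (- k * x))%R.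
Proof. intros. auto_derive; auto. field; auto. Qed.

Lemma is_lim_exp_neg : is_lim (fun t => exp (- t)) p_infty 0.
Proof.
  apply (is_lim_comp exp Ropp p_infty 0 m_infty).
  - apply is_lim_exp_m.
  - apply (is_lim_opp (fun x => x) p_infty p_infty). apply is_lim_id.
  - exists 0%R; intros; discriminate.
Qed.

Lemma ex_is_cint_superexp_decay f : cdiff f -> superexp_decay f -> exists l, is_cint f l.
Proof.
  intros Hf H. destruct (H 1%R) as [K HK].
  apply (ex_is_cint_dominated f (fun t => - K / 1 * exp (- (1) * t))%R (fun t => K * exp (- (1) * t))%R 0); auto.
  - intros; apply is_derive_exp_scal; lra.
  - evar_last. apply (is_lim_scal_l (fun t => exp (- (1) * t))).
    + apply (is_lim_ext (fun t => exp (- t))); [intros; f_equal; ring|apply is_lim_exp_neg].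
    + simpl. f_equal. ring.
Qed.

Lemma is_cint_Cmod_le_exp f l K : is_cint f l ->
  (forall t, (0 <= t)%R -> (Cmod (f t) <= K * exp (- (1) * t))%R) -> (Cmod l <= K)%R.
Proof.
  intros Hf H.
  assert (0 <= K)%R.
  { specialize (H 0%R (Rle_refl _)). rewrite Rmult_0_r, exp_0 in H. generalize (Cmod_ge_0 (f 0%R)); lra. }
  assert (X := is_cint_Cmod_le f l (fun t => - K / 1 * exp (- (1) * t))%R (fun t => K * exp (- (1) * t))%R 0 Hf
    ltac:(intros; apply is_derive_exp_scal; lra) H).
  cbv beta in X. rewrite Rmult_0_r, exp_0 in X.
  replace K with (0 - - K / 1 * 1)%R by field. apply X.
  intros x _. generalize (exp_pos (- (1) * x)); intros. unfold Rdiv. nra.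
Qed.

Definition laplace (f : R -> C) (mu : C) : C :=
  RInt_gen (V := C_R_CompleteNormedModule) (fun t : R => cexp (- mu * RtoC t) * f t)
    (at_point 0%R) (Rbar_locally p_infty).

Lemma laplace_correct f mu : cdiff f -> superexp_decay f ->
  is_cint (fun t => cexp (- mu * RtoC t) * f t) (laplace f mu).
Proof.
  intros Hf H.
  destruct (ex_is_cint_superexp_decay (fun t => cexp (- mu * RtoC t) * f t)) as [l Hl].
  - now apply cdiff_cexp_mult.
  - now apply superexp_decay_cexp_mult.
  - eapply is_cint_eq; [exact Hl|]. symmetry. unfold laplace.
    refine (is_cint_RInt_gen (fun t => cexp (- mu * RtoC t) * f t) l _ Hl). now apply cdiff_cexp_mult.
Qed.

Lemma is_cint_unique f l m : cdiff f -> is_cint f l -> is_cint f m -> l = m.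
Proof.
  intros Hf H1 H2. rewrite <- (is_cint_RInt_gen f l Hf H1). exact (is_cint_RInt_gen f m Hf H2).
Qed.

(** The kernel costs at most [exp (k t)] on this half-plane; decay of [f] at rate [k + 1] leaves
    [exp (- t)] to integrate. *)
Lemma laplace_bounded f k : cdiff f -> superexp_decay f ->
  exists K, forall mu, (- k <= Re mu)%R -> (Cmod (laplace f mu) <= K)%R.
Proof.
  intros Hf H. destruct (H (k + 1)%R) as [K HK]. exists K. intros mu Hmu.
  eapply is_cint_Cmod_le_exp; [now apply laplace_correct|].
  intros t Ht. cbv beta. rewrite Cmod_mult, Cmod_cexp.
  replace (Re (- mu * RtoC t)) with (- Re mu * t)%R by (destruct mu; simpl; ring).
  replace (K * exp (- (1) * t))%R with (exp (k * t) * (K * exp (- (k + 1) * t)))%R.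
  - apply Rmult_le_compat; auto using Cmod_ge_0. left; apply exp_pos. apply exp_le_compat. nra.
  - rewrite (Rmult_comm K), <- Rmult_assoc, <- exp_plus, Rmult_comm. do 2 f_equal; ring.
Qed.

(** Differentiation under the integral sign: the error of the first-order expansion is itself the
    integral of [f] against the second-order Taylor remainder of the exponential, hence of size
    [h^2]. *)
Lemma cder_laplace f mu d s : cdiff f -> superexp_decay f ->
  cder (fun s => laplace f (mu + RtoC s * d)) s (- d * laplace (fun t => RtoC t * f t) (mu + RtoC s * d)).
Proof.
  intros Hf H. apply cder_eps. intros eps He. set (m := mu + RtoC s * d).
  (* The rate [3 + Cmod d] pays for [t^2 <= exp (2 t)], for [exp (Cmod d t)] in the Taylor remainder
     when [|h| <= 1], and keeps one unit for the final integration. *)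
  destruct (superexp_decay_cexp_mult m f H (3 + Cmod d)%R) as [K HK].
  assert (K0 : (0 <= K)%R).
  { specialize (HK 0%R (Rle_refl _)). rewrite Rmult_0_r, exp_0 in HK.
    eapply Rle_trans; [apply Cmod_ge_0|]. rewrite Rmult_1_r in HK. exact HK. }
  set (B := (K * Cmod d ^ 2 + 1)%R).
  assert (B0 : (0 < B)%R) by (unfold B; generalize (pow2_ge_0 (Cmod d)); nra).
  exists (Rmin 1 (eps / B)). split; [apply Rmin_pos; [lra|now apply Rdiv_lt_0_compat]|].
  intros h Hh.
  assert (h1 : (Rabs h <= 1)%R) by (generalize (Rmin_l 1 (eps / B)); lra).
  assert (h2 : (Rabs h * B <= eps)%R).
  { apply Rmult_le_reg_r with (/ B)%R; [now apply Rinv_0_lt_compat|].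
    rewrite Rmult_assoc, Rinv_r, Rmult_1_r by lra. generalize (Rmin_r 1 (eps / B)). unfold Rdiv in *. lra. }
  apply Rle_trans with (K * Cmod d ^ 2 * (Rabs h * Rabs h))%R.
  2:{ generalize (Rabs_pos h). unfold B in h2. intros.
      assert (K * Cmod d ^ 2 * Rabs h <= eps)%R by nra. nra. }
  apply (is_cint_Cmod_le_exp (fun t => cexp (- m * RtoC t) * f t * (cexp (- (RtoC h * d * RtoC t)) - 1 - (- (RtoC h * d * RtoC t))))).
  - eapply is_cint_eq; [eapply is_cint_ext; [|apply is_cint_minus; [apply is_cint_minus;
      [apply (laplace_correct f (mu + RtoC (s + h) * d)); auto | apply (laplace_correct f m); auto]|
      apply (is_cint_scal (RtoC h * - d)), (laplace_correct (fun t => RtoC t * f t) m)]]|].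
    + intros t. cbv beta.
      replace (- (mu + RtoC (s + h) * d) * RtoC t) with (- m * RtoC t + - (RtoC h * d * RtoC t))
        by (unfold m; rewrite RtoC_plus; ring).
      rewrite cexp_plus. ring.
    + now apply cdiff_id_mult.
    + now apply superexp_decay_id_mult.
    + cbv beta; ring.
  - intros t Ht. rewrite Cmod_mult.
    set (w := - (RtoC h * d * RtoC t)).
    assert (Ew : Cmod w = (Rabs h * Cmod d * t)%R).
    { unfold w. rewrite Cmod_opp, !Cmod_mult, !Cmod_R, (Rabs_pos_eq t); auto. }
    assert (d0 := Cmod_ge_0 d). assert (a0 := Rabs_pos h).
    assert (Hw : (Cmod w <= Cmod d * t)%R).
    { rewrite Ew. apply Rmult_le_compat_r; auto. rewrite <- (Rmult_1_l (Cmod d)) at 2. now apply Rmult_le_compat_r. }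
    apply Rle_trans with ((K * exp (- (3 + Cmod d) * t)) * ((Rabs h * Cmod d) ^ 2 * (exp t * exp t) * exp (Cmod d * t)))%R.
    + apply Rmult_le_compat; auto using Cmod_ge_0.
      eapply Rle_trans; [apply Cmod_cexp_taylor_le|].
      apply Rmult_le_compat; [apply pow2_ge_0|left; apply exp_pos| |now apply exp_le_compat].
      rewrite Ew. replace ((Rabs h * Cmod d * t) ^ 2)%R with ((Rabs h * Cmod d) ^ 2 * (t * t))%R by ring.
      apply Rmult_le_compat_l; [apply pow2_ge_0|]. apply Rmult_le_compat; auto using le_exp.
    + right. transitivity (K * Cmod d ^ 2 * (Rabs h * Rabs h) * (exp (- (3 + Cmod d) * t) * exp t * exp t * exp (Cmod d * t)))%R; [ring|].
      rewrite <- !exp_plus. do 2 f_equal. ring.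
Qed.

Lemma Cmod_taylor1_le (y y1 y2 : R -> C) (x h M : R) : (0 <= h)%R ->
  (forall t, cder y t (y1 t)) -> (forall t, cder y1 t (y2 t)) ->
  (forall t, (x <= t <= x + h)%R -> (Cmod (y2 t) <= M)%R) ->
  (Cmod (y (x + h)%R - y x - RtoC h * y1 x) <= h * h * M)%R.
Proof.
  intros Hh H1 H2 HM.
  assert (M0 : (0 <= M)%R) by (eapply Rle_trans; [apply Cmod_ge_0|apply (HM x); lra]).
  replace (y (x + h)%R - y x - RtoC h * y1 x)
    with ((y (x + h)%R - RtoC (x + h) * y1 x) - (y x - RtoC x * y1 x)) by (rewrite RtoC_plus; ring).
  replace (h * h * M)%R with (h * M * (x + h) - h * M * x)%R by ring.
  apply (Cmod_increment_le (fun t => y t - RtoC t * y1 x) (fun t => y1 t - y1 x)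
           (fun t => h * M * t)%R (fun _ => h * M)%R); [lra| | |].
  - intros t _. eapply cder_eq; [apply cder_minus; [apply H1|apply cder_mult; [apply cder_id|apply cder_const]]|cbv beta; ring].
  - intros. auto_derive; auto; ring.
  - intros t Ht. apply Rle_trans with (M * t - M * x)%R; [|nra].
    apply (Cmod_increment_le y1 y2 (fun t => M * t)%R (fun _ => M)); [lra|auto| |].
    + intros. auto_derive; auto; ring.
    + intros; apply HM; lra.
Qed.

(** A Taylor expansion with unit step expresses [y1 t] through [y (t + 1)], [y t] and a remainder
    controlled by [y2]. Rates [k >= 0] come first, since there [exp (- k u)] is largest at the left
    end of the step. *)
Lemma superexp_decay_derive (y y1 y2 : R -> C) :
  (forall t, cder y t (y1 t)) -> (forall t, cder y1 t (y2 t)) ->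
  superexp_decay y -> superexp_decay y2 -> superexp_decay y1.
Proof.
  intros H1 H2 D0 D2.
  assert (A : forall k, (0 <= k)%R -> exists K, forall t : R, (0 <= t)%R -> (Cmod (y1 t) <= K * exp (- k * t))%R).
  { intros k Hk. destruct (D0 k) as [K0 HK0], (D2 k) as [K2 HK2]. exists (K0 + K0 + K2)%R. intros t Ht.
    assert (P0 : (0 <= K0)%R).
    { specialize (HK0 0%R (Rle_refl _)). rewrite Rmult_0_r, exp_0 in HK0. generalize (Cmod_ge_0 (y 0%R)); lra. }
    assert (P2 : (0 <= K2)%R).
    { specialize (HK2 0%R (Rle_refl _)). rewrite Rmult_0_r, exp_0 in HK2. generalize (Cmod_ge_0 (y2 0%R)); lra. }
    assert (M : forall u, (t <= u)%R -> (exp (- k * u) <= exp (- k * t))%R) by (intros; apply exp_le_compat; nra).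
    generalize (Cmod_taylor1_le y y1 y2 t 1 (K2 * exp (- k * t)) Rle_0_1 H1 H2). intros T.
    assert (T' : (Cmod (y (t + 1)%R - y t - RtoC 1 * y1 t) <= 1 * 1 * (K2 * exp (- k * t)))%R).
    { apply T. intros u Hu. eapply Rle_trans; [apply HK2; lra|]. apply Rmult_le_compat_l; auto. apply M; lra. }
    generalize (HK0 t Ht) (HK0 (t + 1)%R ltac:(lra)) (M (t + 1)%R ltac:(lra)). intros Q1 Q2 Q3.
    replace (y1 t) with (y (t + 1)%R - y t - (y (t + 1)%R - y t - RtoC 1 * y1 t)) by ring.
    generalize (Cmod_sub_triangle (y (t + 1)%R - y t) (y (t + 1)%R - y t - RtoC 1 * y1 t)).
    generalize (Cmod_sub_triangle (y (t + 1)%R) (y t)).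
    assert (K0 * exp (- k * (t + 1)) <= K0 * exp (- k * t))%R by now apply Rmult_le_compat_l.
    lra. }
  intros k. destruct (A (Rmax k 0) (Rmax_r _ _)) as [K HK]. exists K. intros t Ht.
  eapply Rle_trans; [now apply HK|]. apply Rmult_le_compat_l.
  - specialize (HK 0%R (Rle_refl _)). rewrite Rmult_0_r, exp_0 in HK. generalize (Cmod_ge_0 (y1 0%R)); lra.
  - apply exp_le_compat. generalize (Rmax_l k 0). nra.
Qed.

(** * Decay of [U] and [Up] on horizontal half-lines *)

Section PCF.
Variables (U Up : C -> C -> C).
Hypothesis HU : is_PCF_U U Up.

Lemma cder_U_line a z d s : cder (fun s => U a (z + RtoC s * d)) s (d * Up a (z + RtoC s * d)).
Proof. apply cder_line, HU. Qed.

Lemma cder_Up_line a z d s :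
  cder (fun s => Up a (z + RtoC s * d)) s
    (d * (((z + RtoC s * d) * (z + RtoC s * d) / 4 + a) * U a (z + RtoC s * d))).
Proof. apply cder_line, HU. Qed.

Lemma carg_right_half z : (0 < Re z)%R -> (Rabs (carg z) <= PI / 2)%R.
Proof.
  intros H. unfold carg. destruct (Rlt_dec 0 (Re z)); [|contradiction].
  generalize (atan_bound (Im z / Re z)). intros. apply Rabs_le. lra.
Qed.

(** For [w = zeta + s] the modulus of [exp (- w^2 / 4)] falls like [exp (- s^2 / 4)] up to an
    exponential in [s], which beats both the power of [w] and any [exp (k s)]. *)
Lemma superexp_decay_U a zeta : superexp_decay (fun s => U a (zeta + RtoC s)).
Proof.
  apply superexp_decay_eventually.
  { intros s. eexists. apply (cder_ext (fun s => U a (zeta + RtoC s * 1))).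
    intros; do 2 f_equal; ring. apply cder_U_line. }
  intros k.
  (* [delta = PI / 4] leaves the sector [|arg| <= PI / 2], which the half-line eventually enters;
     [eps = 1] gives [|U|] at most twice its leading term. *)
  destruct HU as [_ HA]. destruct (HA a (PI / 4)%R 1%R) as [M HM]; [generalize PI_RGT_0; lra|lra|].
  set (r := Cmod zeta). assert (r0 : (0 <= r)%R) by apply Cmod_ge_0.
  set (p := - a - / 2) in *. set (q := Cmod p). assert (q0 : (0 <= q)%R) by apply Cmod_ge_0.
  (* [A] bounds the terms of the exponent free of [s], where [ln |w| <= |w|] is used for the power;
     [B s] bounds the linear terms together with the desired [k s]; completing the square
     [(s / 2 - B)^2 >= 0] produces [B^2]. *)
  set (A := (q * (r + PI) + r * r / 4)%R). set (B := (q + r + k)%R).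
  exists (2 * exp (A + B * B))%R, (1 + r + Rmax M 0)%R.
  intros s Hs.
  assert (s1 : (1 + r <= s)%R) by (generalize (Rmax_r M 0); lra).
  assert (s2 : (1 + r + M <= s)%R) by (generalize (Rmax_l M 0); lra).
  set (w := zeta + RtoC s).
  assert (Rz : (Rabs (Re zeta) <= r)%R) by apply re_le_Cmod.
  assert (Iz : (Rabs (Im zeta) <= r)%R) by apply im_le_Cmod.
  assert (Rw : Re w = (Re zeta + s)%R) by (unfold w; destruct zeta; reflexivity).
  assert (Iw : Im w = Im zeta) by (unfold w; destruct zeta; simpl; apply Rplus_0_r).
  assert (Z1 := Rabs_def2 (Re zeta) (r + 1) ltac:(lra)).
  assert (Rw0 : (s - r <= Re w)%R) by (rewrite Rw; generalize (Rle_abs (- Re zeta)); rewrite Rabs_Ropp; lra).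
  assert (Cw : (s - r <= Cmod w)%R) by (eapply Rle_trans; [exact Rw0|]; eapply Rle_trans; [apply Rle_abs|apply re_le_Cmod]).
  assert (Cw2 : (Cmod w <= r + s)%R).
  { unfold w. eapply Rle_trans; [apply Cmod_triangle|]. rewrite Cmod_R, Rabs_pos_eq by lra. apply Rle_refl. }
  assert (Aw : (Rabs (carg w) <= PI / 2)%R) by (apply carg_right_half; lra).
  specialize (HM w ltac:(lra) ltac:(generalize PI_RGT_0; lra)).
  set (D := cpow w p * cexp (- (w * w) / 4)) in HM.
  assert (D0 : D <> 0) by (apply Cmult_neq_0; apply cexp_neq_0).
  assert (UD : (Cmod (U a w) <= 2 * Cmod D)%R).
  { replace (U a w) with ((U a w / D - 1 + 1) * D) by (field; auto). rewrite Cmod_mult.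
    apply Rmult_le_compat_r; [apply Cmod_ge_0|].
    eapply Rle_trans; [apply Cmod_triangle|]. rewrite Cmod_1. lra. }
  eapply Rle_trans; [exact UD|]. rewrite Rmult_assoc. apply Rmult_le_compat_l; [lra|].
  unfold D. rewrite Cmod_mult. unfold cpow at 1.
  rewrite Cmod_cexp, Cmod_cexp, <- !exp_plus. apply exp_le_compat.
  assert (E1 : (Re (p * cln w) <= q * (r + s + PI))%R).
  { eapply Rle_trans; [apply Rle_abs|]. eapply Rle_trans; [apply re_le_Cmod|].
    rewrite Cmod_mult. apply Rmult_le_compat_l; auto.
    eapply Rle_trans; [apply Cmod_le_Re_Im|]. unfold cln; simpl.
    assert (L0 : (0 <= ln (Cmod w))%R) by (rewrite <- ln_1; apply ln_le; lra).
    rewrite (Rabs_pos_eq _ L0).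
    assert (L1 : (ln (Cmod w) <= Cmod w)%R).
    { rewrite <- (ln_exp (Cmod w)) at 2. apply ln_le; [lra|apply le_exp]. }
    generalize PI_RGT_0; lra. }
  assert (E2 : Re (- (w * w) / 4) = (- (Re w * Re w - Im w * Im w) / 4)%R).
  { destruct w as [w1 w2]; unfold Cdiv, Cmult, Copp, Cinv, Re, Im; simpl. field. }
  rewrite E2, Iw.
  assert (Im zeta * Im zeta <= r * r)%R.
  { unfold r. generalize (Cmod2_alt zeta). nra. }
  assert ((s - r) * (s - r) <= Re w * Re w)%R by (apply Rmult_le_compat; lra).
  assert (0 <= (s / 2 - B) * (s / 2 - B))%R by apply Rle_0_sqr.
  assert (- (Re w * Re w - Im zeta * Im zeta) / 4 <= - ((s - r) * (s - r) - r * r) / 4)%R by lra.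
  unfold A. unfold B in *. nra.
Qed.

Lemma cder_U_shift a zeta s : cder (fun s => U a (zeta + RtoC s)) s (Up a (zeta + RtoC s)).
Proof.
  apply (cder_ext (fun s => U a (zeta + RtoC s * 1))); [intros; do 2 f_equal; ring|].
  eapply cder_eq; [apply cder_U_line|]. replace (zeta + RtoC s * 1) with (zeta + RtoC s) by ring. ring.
Qed.

Lemma cder_Up_shift a zeta s :
  cder (fun s => Up a (zeta + RtoC s)) s (((zeta + RtoC s) * (zeta + RtoC s) / 4 + a) * U a (zeta + RtoC s)).
Proof.
  apply (cder_ext (fun s => Up a (zeta + RtoC s * 1))); [intros; do 2 f_equal; ring|].
  eapply cder_eq; [apply cder_Up_line|]. replace (zeta + RtoC s * 1) with (zeta + RtoC s) by ring. ring.
Qed.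

(** No hypothesis bounds [Up] directly; by the differential equation the second derivative decays
    with [U], and the derivative in between follows. *)
Lemma superexp_decay_Up a zeta : superexp_decay (fun s => Up a (zeta + RtoC s)).
Proof.
  assert (H := superexp_decay_U a zeta).
  apply (superexp_decay_derive _ _ _ (cder_U_shift a zeta) (cder_Up_shift a zeta) H).
  apply (superexp_decay_ext (fun t => (/ 4 * (RtoC t * (RtoC t * U a (zeta + RtoC t))) + zeta / 2 * (RtoC t * U a (zeta + RtoC t)))
    + (zeta * zeta / 4 + a) * U a (zeta + RtoC t))).
  { intros t. field. }
  repeat apply superexp_decay_plus; apply superexp_decay_scal; repeat apply superexp_decay_id_mult; exact H.
Qed.

End PCF.

(** * Green's identity and Wronskians *)

Lemma superexp_decay_ctends_0 f : superexp_decay f -> ctends f 0.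
Proof.
  intros H. destruct (H 1%R) as [K HK].
  apply (flim_le _ f 0 (fun t => K * exp (- t))%R).
  - exists 0%R. intros t Ht. replace (f t - 0) with (f t) by ring. replace (- t)%R with (- (1) * t)%R by ring. apply HK; lra.
  - eapply flim_eq; [apply (flim_of_is_lim _ (K * 0)); exact (is_lim_scal_l (fun t => exp (- t)) K _ _ is_lim_exp_neg)|].
    f_equal. ring.
Qed.

Lemma superexp_decay_bounded_mult f g K : (forall t, (0 <= t)%R -> (Cmod (f t) <= K)%R) ->
  superexp_decay g -> superexp_decay (fun t => f t * g t).
Proof.
  intros Hf Hg k. destruct (Hg k) as [M HM]. exists (K * M)%R. intros t Ht.
  rewrite Cmod_mult, Rmult_assoc. apply Rmult_le_compat; auto using Cmod_ge_0.
Qed.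

(** A solution of [V'' = q V] described by its restrictions to all lines, so that the rotated
    functions [U(b, c t)] fit the same frame as [U] itself. *)
Definition line_solution (q V V1 : C -> C) : Prop := forall z d s,
  cder (fun s => V (z + RtoC s * d)) s (d * V1 (z + RtoC s * d)) /\
  cder (fun s => V1 (z + RtoC s * d)) s (d * (q (z + RtoC s * d) * V (z + RtoC s * d))).

Lemma constant_of_cder_0 f : (forall s, cder f s 0) -> forall a b, f a = f b.
Proof.
  assert (K : forall f, (forall s, cder f s 0) -> forall a b, (a <= b)%R -> f a = f b).
  { intros g H a b ab. assert (E := cder_equal_of_zero_increment g (fun _ => 0) (fun _ => 0) a b ab
      (fun x _ => H x) (fun x _ => cder_const 0 x)). cbv beta in E.
    replace (g b) with (g b - g a + g a) by ring. rewrite E. ring. }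
  intros H a b. destruct (Rle_dec a b); [|symmetry]; apply K; auto; lra.
Qed.

Lemma wronskian_constant q V V1 W W1 z : line_solution q V V1 -> line_solution q W W1 ->
  V z * W1 z - V1 z * W z = V 0 * W1 0 - V1 0 * W 0.
Proof.
  intros HV HW.
  set (f := fun s => V (0 + RtoC s * z) * W1 (0 + RtoC s * z) - V1 (0 + RtoC s * z) * W (0 + RtoC s * z)).
  assert (E : f 1%R = f 0%R).
  { apply constant_of_cder_0. intros s. destruct (HV 0 z s), (HW 0 z s).
    eapply cder_eq; [apply cder_minus; apply cder_mult; eassumption|]. cbv beta; ring. }
  unfold f in E. replace (0 + RtoC 1 * z) with z in E by ring.
  replace (0 + RtoC 0 * z) with (RtoC 0) in E by ring. exact E.
Qed.

(** The leading term [x^p exp (sg x^2 / 4)]: recessive for [sg = -1], dominant for [sg = 1]. *)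
Definition growth (p : C) (sg x : R) : C := cexp (p * RtoC (ln x) + RtoC (sg * x * x / 4)).

Lemma growth_neq_0 p sg x : growth p sg x <> 0.
Proof. apply cexp_neq_0. Qed.

(** [s / x] is the scale on which the Gaussian factor changes by a bounded ratio: [(x + s/x)^2 / 4 =
    x^2 / 4 + s / 2 + s^2 / (4 x^2)]. To first order the ratio is [1 + sg s / 2], with errors from
    the exponential series and from the power. *)
Lemma growth_step p sg x s : (Rabs sg <= 1)%R -> (1 <= x)%R -> (0 <= s <= 1)%R ->
  let q := (Cmod p + 1)%R in
  exists r, growth p sg (x + s / x) = growth p sg x * r /\ (Cmod r <= exp q)%R /\
    (Cmod (r - 1 - RtoC (sg * s / 2)) <= q ^ 2 * exp q * s ^ 2 + q * s / x)%R.
Proof.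
  intros Hsg Hx Hs q.
  assert (q1 : (1 <= q)%R) by (unfold q; generalize (Cmod_ge_0 p); lra).
  (* The relative increment: [x + s / x = x (1 + h)]. *)
  set (h := (s / (x * x))%R).
  assert (h0 : (0 <= h)%R) by (apply Rmult_le_pos; [lra|left; apply Rinv_0_lt_compat; nra]).
  assert (hx : (h <= s / x)%R).
  { unfold h, Rdiv. apply Rmult_le_compat_l; [lra|]. apply Rinv_le_contravar; nra. }
  assert (hs : (s / x <= s)%R).
  { unfold Rdiv. rewrite <- (Rmult_1_r s) at 2. apply Rmult_le_compat_l; [lra|]. rewrite <- Rinv_1. apply Rinv_le_contravar; lra. }
  assert (L : (0 <= ln (1 + h) <= h)%R).
  { split; [rewrite <- ln_1; apply ln_le; lra|]. rewrite <- (ln_exp h) at 2. apply ln_le; [lra|].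
    apply exp_ineq1_le. }
  set (e := p * RtoC (ln (1 + h)) + RtoC (sg * s * h / 4)).
  set (w := e + RtoC (sg * s / 2)).
  assert (He : (Cmod e <= (Cmod p + 1 / 4) * h)%R).
  { unfold e. eapply Rle_trans; [apply Cmod_triangle|]. rewrite Cmod_mult, !Cmod_R.
    rewrite (Rabs_pos_eq (ln _)) by lra.
    assert (Rabs (sg * s * h / 4) <= 1 / 4 * h)%R.
    { replace (sg * s * h / 4)%R with (sg * (s * h / 4))%R by field. rewrite Rabs_mult, (Rabs_pos_eq (s * h / 4)) by nra.
      rewrite <- (Rmult_1_l (1 / 4 * h)). apply Rmult_le_compat; [apply Rabs_pos|nra|lra|nra]. }
    assert (Cmod p * ln (1 + h) <= Cmod p * h)%R by (apply Rmult_le_compat_l; [apply Cmod_ge_0|lra]).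
    lra. }
  assert (Hw : (Cmod w <= q * s)%R).
  { unfold w. eapply Rle_trans; [apply Cmod_triangle|]. rewrite Cmod_R.
    assert (Rabs (sg * s / 2) <= s / 2)%R.
    { replace (sg * s / 2)%R with (sg * (s / 2))%R by field. rewrite Rabs_mult, (Rabs_pos_eq (s / 2)) by lra. nra. }
    assert ((Cmod p + 1 / 4) * h <= (Cmod p + 1 / 4) * s)%R by (apply Rmult_le_compat_l; [generalize (Cmod_ge_0 p)|]; lra).
    unfold q. lra. }
  assert (Hwq : (Cmod w <= q)%R) by nra.
  exists (cexp w). split; [|split].
  - unfold growth. rewrite <- cexp_plus. f_equal.
    replace (x + s / x)%R with (x * (1 + h))%R by (unfold h; field; lra).
    rewrite ln_mult by lra. unfold w, e. rewrite RtoC_plus.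
    replace (sg * (x * (1 + h)) * (x * (1 + h)) / 4)%R with (sg * x * x / 4 + sg * s * h / 4 + sg * s / 2)%R.
    + rewrite !RtoC_plus. ring.
    + unfold h. field. lra.
  - eapply Rle_trans; [apply Cmod_cexp_le|]. now apply exp_le_compat.
  - replace (cexp w - 1 - RtoC (sg * s / 2)) with (cexp w - 1 - w + e) by (unfold w; ring).
    eapply Rle_trans; [apply Cmod_triangle|]. apply Rplus_le_compat.
    + eapply Rle_trans; [apply Cmod_cexp_taylor_le|].
      replace (q ^ 2 * exp q * s ^ 2)%R with ((q * s) ^ 2 * exp q)%R by ring.
      apply Rmult_le_compat; [apply pow2_ge_0|left; apply exp_pos| |now apply exp_le_compat].
      apply pow_incr. split; [apply Cmod_ge_0|auto].
    + eapply Rle_trans; [exact He|]. replace (q * s / x)%R with (q * (s / x))%R by (field; lra).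
      apply Rmult_le_compat; auto. generalize (Cmod_ge_0 p); lra. unfold q; lra.
Qed.

(* Compare [y] at [x] and at [x + s/x]: a second-order Taylor expansion on this scale
   is uniform in [x], so the asymptotics of [y] can be differentiated. *)
Lemma derivative_asymptotics (a p A : C) (sg : R) (y y1 : R -> C) :
  (Rabs sg <= 1)%R ->
  (forall x, cder y x (y1 x)) ->
  (forall x, cder y1 x ((RtoC x * RtoC x / 4 + a) * y x)) ->
  ctends (fun x => y x / growth p sg x) A ->
  ctends (fun x => y1 x / (RtoC x * growth p sg x)) (A * RtoC (sg / 2)).
Proof.
  intros Hsg H1 H2 HA eps He.
  set (q := (Cmod p + 1)%R).
  assert (q1 : (1 <= q)%R) by (unfold q; generalize (Cmod_ge_0 p); lra).
  set (e := exp q). assert (e0 : (0 < e)%R) by apply exp_pos.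
  set (m := Cmod A). assert (m0 : (0 <= m)%R) by apply Cmod_ge_0.
  set (K2 := ((1 + Cmod a) * ((m + 1) * e))%R).
  assert (K20 : (0 <= K2)%R) by (unfold K2; generalize (Cmod_ge_0 a); intros; apply Rmult_le_pos; [lra|apply Rmult_le_pos; lra]).
  set (K3 := (K2 + m * (q ^ 2 * e) + 1)%R).
  assert (K31 : (1 <= K3)%R).
  { unfold K3. assert (0 <= m * (q ^ 2 * e))%R; [|lra]. apply Rmult_le_pos; auto. apply Rmult_le_pos; [apply pow2_ge_0|lra]. }
  (* After division by [s], the errors are of three kinds: a multiple of [s] (Taylor remainders), a
     multiple of [eta / s] (the given limit) and a multiple of [1 / x]. Hence [s] is fixed first,
     then [eta], then the threshold for [x], each kind receiving [eps / 4]. *)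
  set (s := Rmin 1 (eps / (4 * K3))).
  assert (s0 : (0 < s)%R) by (apply Rmin_pos; [lra|apply Rdiv_lt_0_compat; lra]).
  assert (s1 : (s <= 1)%R) by apply Rmin_l.
  assert (sK : (K3 * s <= eps / 4)%R).
  { replace (eps / 4)%R with (K3 * (eps / (4 * K3)))%R by (field; lra). apply Rmult_le_compat_l; [lra|apply Rmin_r]. }
  set (eta := Rmin 1 (s * eps / (4 * (e + 1)))).
  assert (eta0 : (0 < eta)%R) by (apply Rmin_pos; [lra|apply Rdiv_lt_0_compat; nra]).
  assert (eta1 : (eta <= 1)%R) by apply Rmin_l.
  assert (etaK : ((e + 1) * eta <= s * eps / 4)%R).
  { replace (s * eps / 4)%R with ((e + 1) * (s * eps / (4 * (e + 1))))%R by (field; lra). apply Rmult_le_compat_l; [lra|apply Rmin_r]. }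
  destruct (HA eta eta0) as [M HM].
  exists (Rmax (Rmax M 1) (4 * (m * q) / eps)). intros x Hx.
  assert (x1 : (M < x)%R) by (generalize (Rmax_l (Rmax M 1) (4 * (m * q) / eps)) (Rmax_l M 1); lra).
  assert (x2 : (1 < x)%R) by (generalize (Rmax_l (Rmax M 1) (4 * (m * q) / eps)) (Rmax_r M 1); lra).
  assert (x3 : (m * q / x <= eps / 4)%R).
  { assert (B : (4 * (m * q) / eps < x)%R) by (generalize (Rmax_r (Rmax M 1) (4 * (m * q) / eps)); lra).
    apply Rmult_le_reg_r with x; [lra|]. unfold Rdiv at 1. rewrite Rmult_assoc, Rinv_l by lra.
    apply Rmult_lt_compat_r with (r := (eps / 4)%R) in B; [|lra].
    replace (4 * (m * q) / eps * (eps / 4))%R with (m * q)%R in B by (field; lra). lra. }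
  set (ph := growth p sg x). assert (ph0 : ph <> 0) by apply growth_neq_0.
  assert (Ph : (0 < Cmod ph)%R) by now apply Cmod_gt_0.
  assert (hx : (s / x <= s)%R).
  { unfold Rdiv. rewrite <- (Rmult_1_r s) at 2. apply Rmult_le_compat_l; [lra|]. rewrite <- Rinv_1. apply Rinv_le_contravar; lra. }
  assert (hx0 : (0 < s / x)%R) by (apply Rdiv_lt_0_compat; lra).
  assert (T : (Cmod (y (x + s / x)%R - y x - RtoC (s / x) * y1 x) <= s / x * (s / x) * (K2 * (x * x) * Cmod ph))%R).
  { apply (Cmod_taylor1_le y y1 _ x (s / x) _ (Rlt_le _ _ hx0) H1 H2).
    intros t Ht.
    (* Every [t] in the interval is [x + s' / x] with [s' = x (t - x) <= s], so the growth at [t] is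
       at most [exp q] times the growth at [x]. *)
    destruct (growth_step p sg x (x * (t - x)) Hsg ltac:(lra)) as [r [Er [Br _]]].
    { split; [apply Rmult_le_pos; lra|]. apply Rle_trans with (x * (s / x))%R; [apply Rmult_le_compat_l; lra|].
      replace (x * (s / x))%R with s by (field; lra). lra. }
    replace (x + x * (t - x) / x)%R with t in Er by (field; lra).
    assert (N := growth_neq_0 p sg t).
    assert (Y : (Cmod (y t) <= (m + 1) * (Cmod ph * e))%R).
    { replace (y t) with ((y t / growth p sg t - A + A) * growth p sg t) by (field; auto).
      rewrite Cmod_mult. apply Rmult_le_compat; auto using Cmod_ge_0.
      - eapply Rle_trans; [apply Cmod_triangle|]. fold m. specialize (HM t ltac:(lra)). lra.
      - rewrite Er, Cmod_mult. apply Rmult_le_compat_l; [apply Cmod_ge_0|exact Br]. }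
    rewrite Cmod_mult.
    replace (K2 * (x * x) * Cmod ph)%R with ((x * x * (1 + Cmod a)) * ((m + 1) * (Cmod ph * e)))%R by (unfold K2; ring).
    apply Rmult_le_compat; auto using Cmod_ge_0.
    eapply Rle_trans; [apply Cmod_triangle|].
    replace (RtoC t * RtoC t / 4) with (RtoC (t * t / 4)).
    2:{ rewrite RtoC_div, RtoC_mult by lra. reflexivity. }
    rewrite Cmod_R, Rabs_pos_eq by nra.
    assert (t * t <= (2 * x) * (2 * x))%R by (apply Rmult_le_compat; lra).
    assert (1 * Cmod a <= x * x * Cmod a)%R by (apply Rmult_le_compat_r; [apply Cmod_ge_0|nra]). lra. }
  destruct (growth_step p sg x s Hsg ltac:(lra) ltac:(lra)) as [r [Er [Br Tr]]].
  fold q in Br, Tr. fold e in Br, Tr. fold ph in Er.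
  set (Rm := y (x + s / x)%R - y x - RtoC (s / x) * y1 x) in *.
  set (g0 := y x / ph). set (g1 := y (x + s / x)%R / growth p sg (x + s / x)).
  assert (G0 : (Cmod (g0 - A) < eta)%R) by (apply HM; lra).
  assert (G1 : (Cmod (g1 - A) < eta)%R) by (apply HM; lra).
  assert (xC : RtoC x <> 0) by (intros Q; apply RtoC_inj in Q; lra).
  (* Exact splitting into the errors of the asymptotics at the two ends, the error in the ratio of
     growths and the Taylor remainder of [y]. *)
  assert (E : RtoC s * (y1 x / (RtoC x * ph) - A * RtoC (sg / 2)) =
     (r * (g1 - A) - (g0 - A)) + (A * (r - 1 - RtoC (sg * s / 2)) - Rm / ph)).
  { assert (Y1 : y (x + s / x)%R = g1 * (ph * r)) by (rewrite <- Er; unfold g1; field; apply growth_neq_0).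
    assert (Y0 : y x = g0 * ph) by (unfold g0; field; auto).
    unfold Rm. rewrite Y1, Y0.
    replace (sg * s / 2)%R with (s * (sg / 2))%R by field. rewrite RtoC_mult.
    rewrite (RtoC_div s x) by lra. field. auto. }
  apply Rmult_lt_reg_l with s; auto.
  rewrite <- (Rabs_pos_eq s) at 1 by lra. rewrite <- Cmod_R, <- Cmod_mult, E.
  eapply Rle_lt_trans; [apply Cmod_triangle|].
  eapply Rle_lt_trans; [apply Rplus_le_compat; apply Cmod_sub_triangle|].
  rewrite !Cmod_mult, Cmod_div by auto. fold m.
  assert (R1 : (Cmod Rm / Cmod ph <= K2 * s ^ 2)%R).
  { apply Rmult_le_reg_r with (Cmod ph); auto. unfold Rdiv at 1. rewrite Rmult_assoc, Rinv_l, Rmult_1_r by lra.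
    eapply Rle_trans; [exact T|]. right. field. lra. }
  assert (R2 : (Cmod r * Cmod (g1 - A) <= e * eta)%R) by (apply Rmult_le_compat; auto using Cmod_ge_0; lra).
  assert (R3 : (m * Cmod (r - 1 - RtoC (sg * s / 2)) <= m * (q ^ 2 * e * s ^ 2 + q * s / x))%R) by (apply Rmult_le_compat_l; auto).
  assert (R4 : (m * (q ^ 2 * e * s ^ 2 + q * s / x) = m * (q ^ 2 * e) * s ^ 2 + s * (m * q / x))%R) by (field; lra).
  assert (R5 : (s * (m * q / x) <= s * (eps / 4))%R) by (apply Rmult_le_compat_l; lra).
  assert (R6 : (K2 * s ^ 2 + m * (q ^ 2 * e) * s ^ 2 <= s * (eps / 4))%R).
  { apply Rle_trans with (s * (K3 * s))%R; [|apply Rmult_le_compat_l; lra]. unfold K3. nra. }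
  nra.
Qed.

Lemma growth_mult p s1 s2 x : (0 < x)%R -> (s1 + s2 = 0)%R -> RtoC x * (growth p s1 x * growth (- p - 1) s2 x) = 1.
Proof.
  intros Hx Hs. unfold growth. rewrite <- cexp_plus.
  replace (p * RtoC (ln x) + RtoC (s1 * x * x / 4) + ((- p - 1) * RtoC (ln x) + RtoC (s2 * x * x / 4)))
    with (RtoC (- ln x)).
  - rewrite cexp_RtoC, exp_Ropp, exp_ln by auto. rewrite <- RtoC_mult. f_equal. field. lra.
  - replace (s2 * x * x / 4)%R with (- (s1 * x * x / 4))%R by (replace s2 with (- s1)%R by lra; field).
    rewrite !RtoC_opp. ring.
Qed.

(** The Wronskian is constant, so it equals its limit. The exponents [p] and [- p - 1] add up to -1,
    which the factor [x] gained by differentiation cancels; [u v1] and [- u1 v] then contribute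
    [A B / 2] each. *)
Lemma wronskian_of_asymptotics (a p A B : C) (u u1 v v1 : R -> C) :
  (forall x, cder u x (u1 x)) -> (forall x, cder u1 x ((RtoC x * RtoC x / 4 + a) * u x)) ->
  (forall x, cder v x (v1 x)) -> (forall x, cder v1 x ((RtoC x * RtoC x / 4 + a) * v x)) ->
  ctends (fun x => u x / growth p (-1) x) A -> ctends (fun x => v x / growth (- p - 1) 1 x) B ->
  forall x, u x * v1 x - u1 x * v x = A * B.
Proof.
  intros Hu Hu1 Hv Hv1 LA LB x.
  assert (C0 : forall t, u x * v1 x - u1 x * v x = u t * v1 t - u1 t * v t).
  { intros t. apply (constant_of_cder_0 (fun x => u x * v1 x - u1 x * v x)). intros s.
    eapply cder_eq; [apply cder_minus; apply cder_mult; auto|]. cbv beta; ring. }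
  apply (flim_unique (Rbar_locally p_infty) (fun _ => u x * v1 x - u1 x * v x)); [apply (flim_const _)|].
  apply (flim_ext_ev _ (fun t => u t / growth p (-1) t * (v1 t / (RtoC t * growth (- p - 1) 1 t))
     - u1 t / (RtoC t * growth p (-1) t) * (v t / growth (- p - 1) 1 t))).
  - exists 0%R. intros t Ht. rewrite (C0 t).
    assert (N : RtoC t <> 0) by (intros Q; apply RtoC_inj in Q; lra).
    assert (N1 := growth_neq_0 p (-1) t). assert (N2 := growth_neq_0 (- p - 1) 1 t).
    assert (E := growth_mult p (-1) 1 t Ht ltac:(lra)).
    transitivity ((u t * v1 t - u1 t * v t) / (RtoC t * (growth p (-1) t * growth (- p - 1) 1 t))); [field; auto|].
    rewrite E. field.
  - eapply flim_eq.
    + apply (flim_minus _); apply (flim_mult _); [exact LA| | |exact LB].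
      * apply (derivative_asymptotics a (- p - 1) B 1 v v1); auto. rewrite Rabs_R1; lra.
      * apply (derivative_asymptotics a p A (-1) u u1); auto. rewrite Rabs_left; lra.
    + replace (1 / 2)%R with (/ 2)%R by field. replace (-1 / 2)%R with (- / 2)%R by field.
      rewrite RtoC_opp, RtoC_inv by lra. field.
Qed.

Section PCF.
Variables (U Up : C -> C -> C).
Hypothesis HU : is_PCF_U U Up.

(** For [U(b, c t)] the potential is [c^2 (c^2 t^2 / 4 + b)]: a fourth root of unity [c] preserves
    the quadratic term and multiplies the parameter by [c^2], so quarter turns flip its sign. *)
Lemma line_solution_U a b c : c * c * (c * c) = 1 -> c * c * b = - a ->
  line_solution (fun w => w * w / 4 - a) (fun t => U b (c * t)) (fun t => c * Up b (c * t)).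
Proof.
  intros c4 cb z d s. split.
  - apply (cder_ext (fun s => U b (c * z + RtoC s * (c * d)))); [intros; f_equal; ring|].
    eapply cder_eq; [apply (cder_U_line U Up HU)|].
    replace (c * z + RtoC s * (c * d)) with (c * (z + RtoC s * d)) by ring. ring.
  - apply (cder_ext (fun s => c * Up b (c * z + RtoC s * (c * d)))); [intros; do 2 f_equal; ring|].
    eapply cder_eq; [apply cder_mult; [apply cder_const|apply (cder_Up_line U Up HU)]|]. cbv beta.
    replace (c * z + RtoC s * (c * d)) with (c * (z + RtoC s * d)) by ring.
    set (w := z + RtoC s * d).
    replace (w * w / 4 - a) with ((c * c * (c * c)) * (w * w) / 4 + c * c * b) by (rewrite c4, cb; field).
    field.
Qed.

Let u a := fun t : R => U a (RtoC t).

Lemma cder_U_real a t : cder (u a) t (Up a (RtoC t)).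
Proof.
  apply (cder_ext (fun s => U a (0 + RtoC s))); [intros; unfold u; f_equal; ring|].
  eapply cder_eq; [apply (cder_U_shift U Up HU)|]. f_equal; ring.
Qed.

Lemma cder_Up_real a t : cder (fun t => Up a (RtoC t)) t ((RtoC t * RtoC t / 4 + a) * U a (RtoC t)).
Proof.
  apply (cder_ext (fun s => Up a (0 + RtoC s))); [intros; f_equal; ring|].
  eapply cder_eq; [apply (cder_Up_shift U Up HU)|]. replace (0 + RtoC t) with (RtoC t) by ring. reflexivity.
Qed.

Lemma cdiff_U a : cdiff (u a).
Proof. intros t; eexists; apply cder_U_real. Qed.

Lemma superexp_decay_U_real a : superexp_decay (u a).
Proof.
  apply (superexp_decay_ext (fun s => U a (0 + RtoC s))); [intros; unfold u; f_equal; ring|].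
  now apply (superexp_decay_U U Up).
Qed.

Lemma superexp_decay_Up_real a : superexp_decay (fun t => Up a (RtoC t)).
Proof.
  apply (superexp_decay_ext (fun s => Up a (0 + RtoC s))); [intros; f_equal; ring|].
  now apply (superexp_decay_Up U Up).
Qed.

(** Two integrations by parts in one: [exp (- lam t) (U' + lam U)] has derivative
    [exp (- lam t) (U'' - lam^2 U)], and the equation replaces [U''] by [(t^2 / 4 + a) U]. The
    boundary term at 0 is the right-hand side. *)
Lemma laplace_U_ode a lam :
  / 4 * laplace (fun t => RtoC t * (RtoC t * u a t)) lam + (a - lam * lam) * laplace (u a) lam =
  - Up a 0 - lam * U a 0.
Proof.
  assert (Hd := cdiff_U a). assert (Hs := superexp_decay_U_real a).
  assert (D2 : cdiff (fun t => RtoC t * (RtoC t * u a t))) by now do 2 apply cdiff_id_mult.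
  assert (S2 : superexp_decay (fun t => RtoC t * (RtoC t * u a t))) by now do 2 apply superexp_decay_id_mult.
  set (P := fun t => cexp (- lam * RtoC t) * (Up a (RtoC t) + lam * u a t)).
  set (p := fun t => / 4 * (cexp (- lam * RtoC t) * (RtoC t * (RtoC t * u a t))) + (a - lam * lam) * (cexp (- lam * RtoC t) * u a t)).
  assert (I1 : is_cint p (/ 4 * laplace (fun t => RtoC t * (RtoC t * u a t)) lam + (a - lam * lam) * laplace (u a) lam)).
  { apply is_cint_plus; apply is_cint_scal; now apply laplace_correct. }
  assert (I2 : is_cint p (0 - P 0%R)).
  { apply is_cint_derive.
    - intros t. eapply cder_eq.
      + apply cder_mult; [apply cder_cexp, cder_mult; [apply cder_const|apply cder_id]|].
        apply cder_plus; [apply cder_Up_real|apply cder_mult; [apply cder_const|apply cder_U_real]].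
      + cbv beta. unfold p, u. field.
    - apply superexp_decay_ctends_0, superexp_decay_cexp_mult, superexp_decay_plus;
      [apply superexp_decay_Up_real|now apply superexp_decay_scal]. }
  assert (Dp : cdiff p).
  { intros x.
    destruct (cdiff_cexp_mult lam _ D2 x) as [l1 K1], (cdiff_cexp_mult lam _ Hd x) as [l2 K2].
    eexists. unfold p.
    apply cder_plus; (apply cder_mult; [apply cder_const|eassumption]). }
  rewrite (is_cint_unique p _ _ Dp I1 I2).
  unfold P, u. rewrite Cmult_0_r, cexp_0. ring.
Qed.

(* Green's identity on the ray from [z] in direction [d], between [F t = laplace (u a) (t / 2)],
   which satisfies [F'' - (t^2/4 - a) F = - U'(a,0) - (t/2) U(a,0)], and a recessive homogeneous solution [V]. *)
Lemma green_ray a z d (V V1 : C -> C) : (0 <= Re d)%R ->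
  line_solution (fun w => w * w / 4 - a) V V1 ->
  superexp_decay (fun s => V (z + RtoC s * d)) -> superexp_decay (fun s => V1 (z + RtoC s * d)) ->
  - / 2 * laplace (fun t => RtoC t * u a t) (z / 2) * V z - laplace (u a) (z / 2) * V1 z =
  - Up a 0 * cint_from_inf d (fun t => t ^ 0 * V t) z - / 2 * U a 0 * cint_from_inf d (fun t => t ^ 1 * V t) z.
Proof.
  intros Hd HV SV SV1.
  assert (Du := cdiff_U a). assert (Su := superexp_decay_U_real a).
  assert (D1 : cdiff (fun t => RtoC t * u a t)) by now apply cdiff_id_mult.
  assert (S1 : superexp_decay (fun t => RtoC t * u a t)) by now apply superexp_decay_id_mult.
  set (ray := fun s : R => z / 2 + RtoC s * (d / 2)).
  set (L0 := fun s => laplace (u a) (ray s)). set (L1 := fun s => laplace (fun t => RtoC t * u a t) (ray s)).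
  set (B := fun s => - / 2 * L1 s * V (z + RtoC s * d) - L0 s * V1 (z + RtoC s * d)).
  (* The place of [0 <= Re d]: the ray stays in a right half-plane, where the Laplace transforms are
     bounded. *)
  assert (Hray : forall s, (0 <= s)%R -> (- (- Re z / 2) <= Re (ray s))%R).
  { intros s Hs. unfold ray.
    replace (Re (z / 2 + RtoC s * (d / 2))) with (Re z / 2 + s * Re d / 2)%R.
    - assert (0 <= s * Re d)%R by (apply Rmult_le_pos; auto). lra.
    - destruct z, d; unfold Cdiv, Cinv; simpl; field. }
  assert (DV : cdiff (fun s => V (z + RtoC s * d))) by (intros s; eexists; exact (proj1 (HV z d s))).
  assert (I0 : is_cint (fun s => (z + RtoC s * d) ^ 0 * V (z + RtoC s * d) * d) (ray_int (fun t => t ^ 0 * V t) z d)).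
  { assert (X : cdiff (fun s => (z + RtoC s * d) ^ 0 * V (z + RtoC s * d) * d)).
    { intros s. eexists. apply cder_mult; [|apply cder_const]. apply cder_mult; [apply (cder_const 1)|exact (proj1 (HV z d s))]. }
    destruct (ex_is_cint_superexp_decay _ X) as [l Hl].
    - apply (superexp_decay_ext (fun s => d * V (z + RtoC s * d))); [intros; simpl; ring|now apply superexp_decay_scal].
    - eapply is_cint_eq; [exact Hl|]. symmetry. unfold ray_int. exact (is_cint_RInt_gen _ l X Hl). }
  assert (I1 : is_cint (fun s => (z + RtoC s * d) ^ 1 * V (z + RtoC s * d) * d) (ray_int (fun t => t ^ 1 * V t) z d)).
  { assert (X : cdiff (fun s => (z + RtoC s * d) ^ 1 * V (z + RtoC s * d) * d)).
    { intros s. eexists. apply cder_mult; [|apply cder_const]. apply cder_mult; [|exact (proj1 (HV z d s))].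
      apply cder_mult; [|apply cder_const]. apply cder_plus; [apply cder_const|]. apply cder_mult; [apply cder_id|apply cder_const]. }
    destruct (ex_is_cint_superexp_decay _ X) as [l Hl].
    - apply (superexp_decay_ext (fun s => d * z * V (z + RtoC s * d) + d * d * (RtoC s * V (z + RtoC s * d)))); [intros; simpl; ring|].
      apply superexp_decay_plus; apply superexp_decay_scal; auto. now apply superexp_decay_id_mult.
    - eapply is_cint_eq; [exact Hl|]. symmetry. unfold ray_int. exact (is_cint_RInt_gen _ l X Hl). }
  set (p := fun s => - Up a 0 * ((z + RtoC s * d) ^ 0 * V (z + RtoC s * d) * d) - / 2 * U a 0 * ((z + RtoC s * d) ^ 1 * V (z + RtoC s * d) * d)).
  assert (J1 := is_cint_minus _ _ _ _ (is_cint_scal (- Up a 0) _ _ I0) (is_cint_scal (/ 2 * U a 0) _ _ I1)).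
  cbv beta in J1.
  (* [B] is [F' V - F V'] along the ray. In its derivative the products [F' V'] cancel, and the
     equations for [F] and [V] leave the inhomogeneity times [V]. *)
  assert (DB : forall s, cder B s (p s)).
  { intros s. destruct (HV z d s) as [HV0 HV1]. unfold B. eapply cder_eq.
    - apply cder_minus; apply cder_mult; [| exact HV0 | | exact HV1].
      + apply cder_mult; [apply cder_const|]. apply (cder_laplace (fun t => RtoC t * u a t) (z / 2) (d / 2) s D1 S1).
      + apply (cder_laplace (u a) (z / 2) (d / 2) s Du Su).
    - cbv beta. unfold p. fold (ray s). fold (L0 s). fold (L1 s).
      assert (O := laplace_U_ode a (ray s)). fold (L0 s) in O.
      set (L2 := laplace (fun t => RtoC t * (RtoC t * u a t)) (ray s)) in *.
      set (w := z + RtoC s * d) in *.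
      replace (ray s) with (w / 2) in O by (unfold ray, w; field).
      assert (O' : L2 = 4 * (- Up a 0 - w / 2 * U a 0 - (a - w / 2 * (w / 2)) * L0 s)) by (rewrite <- O; field).
      rewrite O'. simpl. field. }
  (* Bounded transforms times recessive solutions: no boundary term at infinity. *)
  assert (LB : ctends B 0).
  { apply superexp_decay_ctends_0.
    destruct (laplace_bounded (u a) (- Re z / 2) Du Su) as [K0 HK0].
    destruct (laplace_bounded _ (- Re z / 2) D1 S1) as [K1 HK1].
    apply (superexp_decay_ext (fun s => - / 2 * (L1 s * V (z + RtoC s * d)) + (- (1)) * (L0 s * V1 (z + RtoC s * d)))).
    { intros; unfold B; ring. }
    apply superexp_decay_plus; apply superexp_decay_scal;
    [apply (superexp_decay_bounded_mult L1 _ K1)|apply (superexp_decay_bounded_mult L0 _ K0)]; auto;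
    intros s Hs; [apply HK1|apply HK0]; auto. }
  assert (J2 := is_cint_derive B p 0 DB LB).
  assert (Dp : cdiff p).
  { intros s. destruct (HV z d s) as [HV0 HV1]. eexists. unfold p.
    apply cder_minus; (apply cder_mult; [apply cder_const|]); (apply cder_mult; [|apply cder_const]);
    (apply cder_mult; [|exact HV0]).
    - apply (cder_const 1).
    - apply cder_mult; [|apply cder_const]. apply cder_plus; [apply cder_const|]. apply cder_mult; [apply cder_id|apply cder_const]. }
  assert (E := is_cint_unique p _ _ Dp J1 J2).
  unfold cint_from_inf.
  transitivity (B 0%R).
  - unfold B, L0, L1, ray. replace (z / 2 + RtoC 0 * (d / 2)) with (z / 2) by (field).
    replace (z + RtoC 0 * d) with z by ring. reflexivity.
  - transitivity (- (0 - B 0%R)); [ring|]. rewrite <- E. ring.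
Qed.

End PCF.

(** * Recessive solutions on rays *)

Section PCF.
Variables (U Up : C -> C -> C).
Hypothesis HU : is_PCF_U U Up.

(** Meant for [c] equal to 1, [Ci] or [- Ci] with argument [theta]: [c^2 = - sg] turns
    [exp (- z^2 / 4)] into [exp (sg x^2 / 4)], and the principal power splits off the constant
    [exp (p i theta)]. *)
Lemma U_asymptotics_ray a c (theta sg : R) :
  (forall x, (0 < x)%R -> cln (c * RtoC x) = RtoC (ln x) + RtoC theta * Ci) ->
  Cmod c = 1%R -> c * c = RtoC (- sg) -> (Rabs theta <= PI / 2)%R ->
  ctends (fun x => U a (c * RtoC x) / growth (- a - / 2) sg x) (cexp ((- a - / 2) * (RtoC theta * Ci))).
Proof.
  intros Hln Hc Hcc Hth.
  set (p := - a - / 2). set (E := cexp (p * (RtoC theta * Ci))).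
  assert (E0 : E <> 0) by apply cexp_neq_0.
  assert (L : ctends (fun x => U a (c * RtoC x) / (growth p sg x * E)) 1).
  { intros eps He. destruct HU as [_ HA].
    (* The sector for [delta = PI / 4] is the closed right half-plane, so it contains both imaginary
       half-axes. *)
    destruct (HA a (PI / 4)%R eps) as [M HM]; [generalize PI_RGT_0; lra|auto|].
    exists (Rmax M 0). intros x Hx.
    assert (M < x)%R by (generalize (Rmax_l M 0); lra). assert (0 < x)%R by (generalize (Rmax_r M 0); lra).
    specialize (Hln x H0).
    replace (growth p sg x * E) with (cpow (c * RtoC x) (- a - / 2) * cexp (- (c * RtoC x * (c * RtoC x)) / 4)).
    - apply HM.
      + rewrite Cmod_mult, Hc, Cmod_R, Rabs_pos_eq; lra.
      + replace (carg (c * RtoC x)) with theta; [generalize PI_RGT_0; lra|].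
        apply (f_equal Im) in Hln. unfold cln in Hln; simpl in Hln. rewrite Hln. ring.
    - unfold cpow, growth, E. rewrite Hln, <- !cexp_plus. f_equal. fold p.
      replace (c * RtoC x * (c * RtoC x)) with (c * c * (RtoC x * RtoC x)) by ring. rewrite Hcc.
      rewrite RtoC_div, !RtoC_mult, RtoC_opp by lra. field. }
  apply (flim_ext_ev _ (fun x => E * (U a (c * RtoC x) / (growth p sg x * E)))).
  - apply filter_forall. intros x. field. split; [apply growth_neq_0|exact E0].
  - eapply flim_eq; [apply (flim_mult _); [apply (flim_const _)|exact L]|ring].
Qed.

Lemma cln_pos x : (0 < x)%R -> cln (1 * RtoC x) = RtoC (ln x) + RtoC 0 * Ci.
Proof.
  intros Hx. rewrite Cmult_1_l. unfold cln, carg. simpl. rewrite Cmod_R, Rabs_pos_eq by lra.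
  destruct (Rlt_dec 0 x); [|contradiction].
  unfold Rdiv. rewrite Rmult_0_l, atan_0. unfold Cplus, Cmult, RtoC; simpl. f_equal; ring.
Qed.

Lemma cln_Ci x : (0 < x)%R -> cln (Ci * RtoC x) = RtoC (ln x) + RtoC (PI / 2) * Ci.
Proof.
  intros Hx. unfold cln. rewrite Cmod_mult, Cmod_Ci, Cmod_R, Rmult_1_l, Rabs_pos_eq by lra.
  replace (Ci * RtoC x) with (0%R, x) by (unfold Cmult, Ci, RtoC; simpl; f_equal; ring).
  unfold carg; simpl.
  destruct (Rlt_dec 0 0); [lra|]. destruct (Rlt_dec 0 x); [|contradiction].
  unfold Cplus, Cmult, RtoC; simpl. f_equal; ring.
Qed.

Lemma cln_mCi x : (0 < x)%R -> cln (- Ci * RtoC x) = RtoC (ln x) + RtoC (- (PI / 2)) * Ci.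
Proof.
  intros Hx. unfold cln. rewrite Cmod_mult, Cmod_opp, Cmod_Ci, Cmod_R, Rmult_1_l, Rabs_pos_eq by lra.
  replace (- Ci * RtoC x) with (0%R, (- x)%R) by (unfold Cmult, Copp, Ci, RtoC; simpl; f_equal; ring).
  unfold carg; simpl.
  destruct (Rlt_dec 0 0); [lra|]. destruct (Rlt_dec 0 (- x)); [lra|]. destruct (Rlt_dec (- x) 0); [|lra].
  unfold Cplus, Cmult, RtoC; simpl. f_equal; ring.
Qed.

Lemma U_asymptotics_pos a : ctends (fun x => U a (RtoC x) / growth (- a - / 2) (-1) x) 1.
Proof.
  apply (flim_ext _ (fun x => U a (1 * RtoC x) / growth (- a - / 2) (-1) x)).
  - intros; now rewrite Cmult_1_l.
  - eapply flim_eq.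
    + apply (U_asymptotics_ray a 1 0 (-1)).
      * exact cln_pos.
      * apply Cmod_1.
      * rewrite Cmult_1_l. f_equal. ring.
      * rewrite Rabs_R0. generalize PI_RGT_0; lra.
    + replace ((- a - / 2) * (RtoC 0 * Ci)) with (RtoC 0) by ring. apply cexp_0.
Qed.

(** [U(- a, x)] is recessive and [U(a, c x)], with [c] an imaginary unit, dominant for the same
    equation; their Wronskian is computed at infinity and read at 0. *)
Lemma wronskian_U_rotated a c (theta : R) :
  (forall x, (0 < x)%R -> cln (c * RtoC x) = RtoC (ln x) + RtoC theta * Ci) ->
  Cmod c = 1%R -> c * c = - (1) -> (Rabs theta <= PI / 2)%R ->
  U (- a) 0 * (c * Up a 0) - Up (- a) 0 * U a 0 = cexp ((- a - / 2) * (RtoC theta * Ci)).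
Proof.
  intros Hln Hc Hcc Hth.
  assert (S' := line_solution_U U Up HU a a c ltac:(rewrite !Hcc; ring) ltac:(rewrite Hcc; ring)).
  assert (W := wronskian_of_asymptotics (- a) (- - a - / 2) 1 (cexp ((- a - / 2) * (RtoC theta * Ci)))
    (fun t => U (- a) (RtoC t)) (fun t => Up (- a) (RtoC t))
    (fun t => U a (c * RtoC t)) (fun t => c * Up a (c * RtoC t))
    (cder_U_real U Up HU (- a)) (cder_Up_real U Up HU (- a))).
  rewrite Cmult_1_l in W. rewrite <- (W) with (x := 0%R); clear W.
  - replace (c * RtoC 0) with (RtoC 0) by ring. ring.
  - intros x. apply (cder_ext (fun t => U a (c * (0 + RtoC t * 1)))); [intros; do 2 f_equal; ring|].
    eapply cder_eq; [exact (proj1 (S' 0 1 x))|]. replace (0 + RtoC x * 1) with (RtoC x) by ring. ring.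
  - intros x. apply (cder_ext (fun t => c * Up a (c * (0 + RtoC t * 1)))); [intros; do 3 f_equal; ring|].
    eapply cder_eq; [exact (proj2 (S' 0 1 x))|]. cbv beta. replace (0 + RtoC x * 1) with (RtoC x) by ring. ring.
  - apply U_asymptotics_pos.
  - apply (flim_ext _ (fun x => U a (c * RtoC x) / growth (- a - / 2) 1 x)).
    + intros x. do 2 f_equal. field.
    + apply U_asymptotics_ray; auto. rewrite Hcc, <- RtoC_opp. reflexivity.
Qed.

(** Because [c d = 1], the argument runs over the horizontal half-line from [c z]. *)
Lemma superexp_decay_ray b c z d : c * d = 1 ->
  superexp_decay (fun s => U b (c * (z + RtoC s * d))) /\
  superexp_decay (fun s => c * Up b (c * (z + RtoC s * d))).
Proof.
  intros Hcd.
  assert (E : forall s : R, c * z + RtoC s = c * (z + RtoC s * d)).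
  { intros s. replace (c * (z + RtoC s * d)) with (c * z + RtoC s * (c * d)) by ring. rewrite Hcd; ring. }
  split; [|apply superexp_decay_scal].
  - apply (superexp_decay_ext (fun s => U b (c * z + RtoC s))); [intros; now rewrite E|].
    now apply (superexp_decay_U U Up).
  - apply (superexp_decay_ext (fun s => Up b (c * z + RtoC s))); [intros; now rewrite E|].
    now apply (superexp_decay_Up U Up).
Qed.

(* Eliminating the derivative of the Laplace transform between Green's identities on two rays. *)
Lemma laplace_of_two_rays a z k dV dW (V V1 W W1 : C -> C) :
  (0 <= Re dV)%R -> (0 <= Re dW)%R ->
  line_solution (fun w => w * w / 4 - a) V V1 -> line_solution (fun w => w * w / 4 - a) W W1 ->
  superexp_decay (fun s => V (z + RtoC s * dV)) /\ superexp_decay (fun s => V1 (z + RtoC s * dV)) ->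
  superexp_decay (fun s => W (z + RtoC s * dW)) /\ superexp_decay (fun s => W1 (z + RtoC s * dW)) ->
  k * (V 0 * W1 0 - V1 0 * W 0) = 1 ->
  laplace (fun t => U a (RtoC t)) (z / 2) =
    - Up a 0 * (k * (W z * cint_from_inf dV (fun t => t ^ 0 * V t) z - V z * cint_from_inf dW (fun t => t ^ 0 * W t) z))
    - / 2 * U a 0 * (k * (W z * cint_from_inf dV (fun t => t ^ 1 * V t) z - V z * cint_from_inf dW (fun t => t ^ 1 * W t) z)).
Proof.
  intros HdV HdW HV HW [SV SV1] [SW SW1] Hk.
  assert (GV := green_ray U Up HU a z dV V V1 HdV HV SV SV1).
  assert (GW := green_ray U Up HU a z dW W W1 HdW HW SW SW1).
  rewrite <- (wronskian_constant _ V V1 W W1 z HV HW) in Hk.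
  set (F := laplace (fun t => U a (RtoC t)) (z / 2)) in *.
  set (F1 := laplace (fun t => RtoC t * U a (RtoC t)) (z / 2)) in *.
  transitivity (F * (k * (V z * W1 z - V1 z * W z))); [rewrite Hk; ring|].
  transitivity (k * (W z * (- / 2 * F1 * V z - F * V1 z) - V z * (- / 2 * F1 * W z - F * W1 z))); [ring|].
  rewrite GV, GW. ring.
Qed.

Lemma line_solution_U_id a : line_solution (fun w => w * w / 4 - a) (U (- a)) (Up (- a)).
Proof.
  intros z d s. split; [apply (cder_U_line U Up HU)|].
  eapply cder_eq; [apply (cder_Up_line U Up HU)|]. cbv beta. ring.
Qed.

(** [c = - Ci] yields the pair (0,1) and [c = Ci] the pair (0,3). As [c^2 = -1], the function
    [U(a, c t)] is recessive in the direction [- c = 1 / c], whose real part is 0; [k] is the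
    inverse of the Wronskian. *)
Lemma laplace_U_axes_01_03 a z c (theta : R) :
  (forall x, (0 < x)%R -> cln (c * RtoC x) = RtoC (ln x) + RtoC theta * Ci) ->
  Cmod c = 1%R -> c * c = - (1) -> Re c = 0%R -> (Rabs theta <= PI / 2)%R ->
  let k := cexp ((a + / 2) * (RtoC theta * Ci)) in
  laplace (fun t => U a (RtoC t)) (z / 2) =
    - Up a 0 * (k * (U a (c * z) * cint_from_inf 1 (fun t => t ^ 0 * U (- a) t) z
                     - U (- a) z * cint_from_inf (- c) (fun t => t ^ 0 * U a (c * t)) z))
    - / 2 * U a 0 * (k * (U a (c * z) * cint_from_inf 1 (fun t => t ^ 1 * U (- a) t) z
                     - U (- a) z * cint_from_inf (- c) (fun t => t ^ 1 * U a (c * t)) z)).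
Proof.
  intros Hln Hc Hcc Rc Hth k.
  apply (laplace_of_two_rays a z k 1 (- c) (U (- a)) (Up (- a)) (fun t => U a (c * t)) (fun t => c * Up a (c * t))).
  - simpl; lra.
  - destruct c; simpl in *; lra.
  - apply line_solution_U_id.
  - apply (line_solution_U U Up HU); rewrite !Hcc; ring.
  - destruct (superexp_decay_ray (- a) 1 z 1 ltac:(ring)) as [H1 H2]. split.
    + eapply superexp_decay_ext; [|exact H1]. intros; cbv beta; f_equal; ring.
    + eapply superexp_decay_ext; [|exact H2]. intros; cbv beta. rewrite !Cmult_1_l. reflexivity.
  - apply (superexp_decay_ray a c z (- c)). replace (c * - c) with (- (c * c)) by ring. rewrite Hcc; ring.
  - rewrite !Cmult_0_r, (wronskian_U_rotated a c theta) by auto.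
    unfold k. rewrite <- cexp_plus.
    replace (_ + _) with (RtoC 0) by ring. apply cexp_0.
Qed.

(** The Wronskian of [U(b, x)] and [U(b, - x)], evaluated at [x = 0]. *)
Definition U_reflection_wronskian (b : C) : C := - (2 * U b 0 * Up b 0).

(** At 0 the Wronskian of [U(a, - i t)] and [U(a, i t)] is [2 i U(a,0) U'(a,0)], that is [- i] times
    the reflection Wronskian. *)
Lemma laplace_U_imaginary_axes a z k : k * (- Ci * U_reflection_wronskian a) = 1 ->
  laplace (fun t => U a (RtoC t)) (z / 2) =
    - Up a 0 * (k * (U a (Ci * z) * cint_from_inf Ci (fun t => t ^ 0 * U a (- Ci * t)) z
                     - U a (- Ci * z) * cint_from_inf (- Ci) (fun t => t ^ 0 * U a (Ci * t)) z))
    - / 2 * U a 0 * (k * (U a (Ci * z) * cint_from_inf Ci (fun t => t ^ 1 * U a (- Ci * t)) z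
                     - U a (- Ci * z) * cint_from_inf (- Ci) (fun t => t ^ 1 * U a (Ci * t)) z)).
Proof.
  intros Hk.
  assert (II : Ci * Ci = - (1)) by (unfold Cmult, Copp, RtoC, Ci; simpl; f_equal; ring).
  assert (NN : - Ci * - Ci = - (1)) by (rewrite <- II; ring).
  apply (laplace_of_two_rays a z k Ci (- Ci) (fun t => U a (- Ci * t)) (fun t => - Ci * Up a (- Ci * t))
     (fun t => U a (Ci * t)) (fun t => Ci * Up a (Ci * t))).
  - simpl; lra.
  - simpl; lra.
  - apply (line_solution_U U Up HU); rewrite !NN; ring.
  - apply (line_solution_U U Up HU); rewrite !II; ring.
  - apply superexp_decay_ray. replace (- Ci * Ci) with (- (Ci * Ci)) by ring. rewrite II; ring.
  - apply superexp_decay_ray. replace (Ci * - Ci) with (- (Ci * Ci)) by ring. rewrite II; ring.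
  - rewrite !Cmult_0_r, <- Hk. unfold U_reflection_wronskian. ring.
Qed.

(** Isolates the Gamma identity as a hypothesis: only the pair (1,3) calls on it, and its proof, by
    asymptotics in the parameter, is of another nature than the argument on rays. *)
Lemma laplace_U_of_gamma_identity :
  (forall a, (forall n : nat, / 2 + a <> - RtoC (INR n)) ->
     U_reflection_wronskian a * CGamma (/ 2 + a) = RtoC (sqrt (2 * PI))) ->
  forall (p : jk_pair) (a lam : C),
    (p = JK13 -> forall n : nat, / 2 + a <> - RtoC (INR n)) ->
    L_U U a lam =
      - Up a 0 * U_jk U p 0 (- a) (2 * lam)
      - / 2 * U a 0 * U_jk U p 1 (- a) (2 * lam).
Proof.
  intros HG p a lam Hp.
  assert (II : Ci * Ci = - (1)) by (unfold Cmult, Copp, RtoC, Ci; simpl; f_equal; ring).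
  change (L_U U a lam) with (laplace (fun t => U a (RtoC t)) lam).
  replace lam with (2 * lam / 2) at 1 by field.
  set (z := 2 * lam).
  assert (Ha : - - a = a) by ring.
  assert (HPI := PI_RGT_0).
  destruct p; unfold U_jk; rewrite ?Ha.
  - rewrite (laplace_U_axes_01_03 a z (- Ci) (- (PI / 2)) cln_mCi).
    + replace (- - Ci) with Ci by ring.
      replace ((a + / 2) * (RtoC (- (PI / 2)) * Ci)) with ((- a / 2 - / 4) * RtoC PI * Ci).
      reflexivity. rewrite RtoC_opp, RtoC_div by lra. field.
    + now rewrite Cmod_opp, Cmod_Ci.
    + rewrite <- II; ring.
    + simpl; ring.
    + rewrite Rabs_Ropp, Rabs_pos_eq; lra.
  - rewrite (laplace_U_axes_01_03 a z Ci (PI / 2) cln_Ci).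
    + replace ((a + / 2) * (RtoC (PI / 2) * Ci)) with ((- a / 2 - / 4) * RtoC PI * - Ci).
      reflexivity. rewrite RtoC_div by lra. field.
    + apply Cmod_Ci.
    + exact II.
    + reflexivity.
    + rewrite Rabs_pos_eq; lra.
  - specialize (HG a (Hp eq_refl)).
    apply laplace_U_imaginary_axes.
    replace (/ 2 - - a) with (/ 2 + a) by ring.
    assert (S0 : RtoC (sqrt (2 * PI)) <> 0).
    { intros Q; apply RtoC_inj in Q. apply sqrt_eq_0 in Q; lra. }
    transitivity (- (Ci * Ci) * (U_reflection_wronskian a * CGamma (/ 2 + a)) / RtoC (sqrt (2 * PI))).
    + field; auto.
    + rewrite HG, II. field; auto.
Qed.
End PCF.

(** * The Gaussian integral *)

Lemma exp_neg_le_inv y : (0 <= y)%R -> (exp (- y) <= / (1 + y))%R.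
Proof.
  intros Hy. rewrite exp_Ropp. apply Rinv_le_contravar; [lra|apply exp_ineq1_le].
Qed.

Section Gaussian.
Open Scope R_scope.

Definition gauss_primitive (x : R) : R := RInt (fun s => exp (- (s * s) / 2)) 0 x.

Lemma gauss_continuous x : continuous (fun s => exp (- (s * s) / 2)) x.
Proof.
  apply (ex_derive_continuous (K := R_AbsRing) (V := R_NormedModule)). auto_derive. auto.
Qed.

Lemma is_derive_gauss_primitive x : is_derive gauss_primitive x (exp (- (x * x) / 2)).
Proof.
  apply (is_derive_RInt (V := R_NormedModule) (fun s => exp (- (s * s) / 2)) gauss_primitive 0 x).
  - apply filter_forall. intros y. apply (RInt_correct (V := R_CompleteNormedModule)).
    apply (ex_RInt_continuous (V := R_CompleteNormedModule)). intros; apply gauss_continuous.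
  - apply gauss_continuous.
Qed.

Lemma gauss_primitive_0 : gauss_primitive 0 = 0.
Proof. apply (RInt_point (V := R_CompleteNormedModule)). Qed.

Lemma eq_of_is_derive_0 (f : R -> R) : (forall x, is_derive f x 0) -> forall a b, f a = f b.
Proof.
  intros H a b.
  destruct (MVT_gen f a b (fun _ => 0)) as [c [_ E]]; [auto| |lra].
  intros x _. apply derivable_continuous_pt. exists 0. now apply is_derive_Reals.
Qed.

Lemma gauss_primitive_opp x : gauss_primitive (- x) = - gauss_primitive x.
Proof.
  assert (E : gauss_primitive (- x) + gauss_primitive x = gauss_primitive (- 0) + gauss_primitive 0).
  { apply (eq_of_is_derive_0 (fun x => gauss_primitive (- x) + gauss_primitive x)). intros t.
    evar_last. apply @is_derive_plus; [|apply is_derive_gauss_primitive].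
    apply (is_derive_comp gauss_primitive Ropp); [apply is_derive_gauss_primitive|].
    apply @is_derive_opp, @is_derive_id.
    unfold plus, scal, opp, one; simpl; unfold mult; simpl.
    replace (- t * - t) with (t * t) by ring. ring. }
  rewrite Ropp_0, gauss_primitive_0 in E. lra.
Qed.

Lemma gauss_primitive_nonneg x : 0 <= x -> 0 <= gauss_primitive x.
Proof.
  intros Hx. rewrite <- gauss_primitive_0.
  apply (is_derive_nonneg_le gauss_primitive (fun x => exp (- (x * x) / 2))); auto.
  - intros; apply is_derive_gauss_primitive.
  - intros; left; apply exp_pos.
Qed.

(** The classical partner of the error integral: its derivative is opposite to that of
    [gauss_primitive^2], so the sum is constant, equal to [2 atan 1 = PI / 2] at 0. *)
Definition gauss_companion (x : R) : R := RInt (fun t => 2 * exp (- (x * x) * (1 + t * t) / 2) / (1 + t * t)) 0 1.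

Lemma gauss_companion_ex_RInt x a b : ex_RInt (fun t => 2 * exp (- (x * x) * (1 + t * t) / 2) / (1 + t * t)) a b.
Proof.
  apply (ex_RInt_continuous (V := R_CompleteNormedModule)). intros t _.
  apply (ex_derive_continuous (K := R_AbsRing) (V := R_NormedModule)). auto_derive. nra.
Qed.

Lemma is_derive_gauss_companion x : is_derive gauss_companion x (- 2 * exp (- (x * x) / 2) * gauss_primitive x).
Proof.
  set (f := fun x t => 2 * exp (- (x * x) * (1 + t * t) / 2) / (1 + t * t)).
  assert (D : forall u t, is_derive (fun u => f u t) u (- 2 * u * exp (- (u * u) * (1 + t * t) / 2))).
  { intros u t. unfold f. auto_derive; auto. unfold Rdiv. set (E := exp _). field. nra. }
  evar_last.
  - apply (is_derive_RInt_param f 0 1 x).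
    + apply filter_forall. intros u t _. eexists; apply D.
    + intros t _.
      apply (continuity_2d_pt_ext (fun u v => - 2 * u * exp (- (u * u) * (1 + v * v) / 2))).
      { intros u v. symmetry. apply is_derive_unique, D. }
      apply continuity_2d_pt_mult.
      * apply continuity_2d_pt_mult; [apply continuity_2d_pt_const|apply continuity_2d_pt_id1].
      * apply (continuity_1d_2d_pt_comp exp (fun u v => - (u * u) * (1 + v * v) / 2)).
        { apply derivable_continuous_pt, derivable_pt_exp. }
        unfold Rdiv.
        repeat first [apply continuity_2d_pt_mult | apply continuity_2d_pt_plus | apply continuity_2d_pt_opp
          | apply continuity_2d_pt_const | apply continuity_2d_pt_id1 | apply continuity_2d_pt_id2].
    + apply filter_forall. intros u. apply gauss_companion_ex_RInt.
  (* The substitution [s = x t]: [Q] is a primitive in [t] of the differentiated integrand. *)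
  - set (Q := fun t => - 2 * exp (- (x * x) / 2) * gauss_primitive (x * t)).
    replace (- 2 * exp (- (x * x) / 2) * gauss_primitive x) with (minus (Q 1) (Q 0)).
    + apply is_RInt_unique.
      apply (is_RInt_derive (V := R_CompleteNormedModule) Q).
      * intros t _. evar_last.
        { apply (is_derive_scal (fun t => gauss_primitive (x * t)) t).
          apply (is_derive_comp gauss_primitive (fun t => x * t)); [apply is_derive_gauss_primitive|].
          apply (is_derive_scal (fun t => t) t x 1). apply @is_derive_id. }
        symmetry. etransitivity; [apply is_derive_unique, D|].
        replace (- (x * x) * (1 + t * t) / 2) with (- (x * x) / 2 + - (x * t * (x * t)) / 2) by field.
        rewrite exp_plus. unfold scal; simpl; unfold mult; simpl. ring.
      * intros t _.
        apply (continuous_ext (fun t => - 2 * x * exp (- (x * x) * (1 + t * t) / 2))).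
        { intros s. symmetry. apply is_derive_unique, D. }
        apply (ex_derive_continuous (K := R_AbsRing) (V := R_NormedModule)). auto_derive. auto.
    + unfold Q, minus, plus, opp; simpl. rewrite Rmult_1_r, Rmult_0_r, gauss_primitive_0. ring.
Qed.

Lemma gauss_primitive_square x : gauss_primitive x ^ 2 + gauss_companion x = PI / 2.
Proof.
  transitivity (gauss_primitive 0 ^ 2 + gauss_companion 0).
  - apply (eq_of_is_derive_0 (fun x => gauss_primitive x ^ 2 + gauss_companion x)). intros t.
    evar_last. apply @is_derive_plus; [|apply is_derive_gauss_companion].
    apply (is_derive_pow gauss_primitive 2 t _ (is_derive_gauss_primitive t)).
    unfold plus; simpl. ring.
  - rewrite gauss_primitive_0. replace (PI / 2) with (2 * atan 1 - 2 * atan 0) by (rewrite atan_1, atan_0; field).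
    rewrite pow_ne_zero, Rplus_0_l by discriminate. unfold gauss_companion.
    apply is_RInt_unique.
    apply (is_RInt_ext (V := R_NormedModule) (fun t => 2 / (1 + t * t))).
    { intros t _. replace (- (0 * 0) * (1 + t * t) / 2) with 0 by field. rewrite exp_0, Rmult_1_r. reflexivity. }
    apply (is_RInt_derive (V := R_CompleteNormedModule) (fun t => 2 * atan t)).
    + intros t _. auto_derive; auto. field. nra.
    + intros t _. apply (ex_derive_continuous (K := R_AbsRing) (V := R_NormedModule)). auto_derive. nra.
Qed.

Lemma gauss_companion_bound x : 0 <= gauss_companion x <= 2 / (1 + x * x / 2).
Proof.
  assert (P : 0 < 1 + x * x / 2) by nra.
  split.
  - apply RInt_ge_0; [lra|apply gauss_companion_ex_RInt|].
    intros t _. apply Rmult_le_pos; [|left; apply Rinv_0_lt_compat; nra]. generalize (exp_pos (- (x * x) * (1 + t * t) / 2)); lra.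
  - apply Rle_trans with (RInt (fun _ => 2 / (1 + x * x / 2)) 0 1).
    + apply RInt_le; [lra|apply gauss_companion_ex_RInt|apply ex_RInt_const|].
      intros t _.
      assert (E : exp (- (x * x) * (1 + t * t) / 2) <= / (1 + x * x / 2)).
      { eapply Rle_trans; [|apply exp_neg_le_inv; nra]. apply exp_le_compat. nra. }
      assert (I : / (1 + t * t) <= 1) by (rewrite <- Rinv_1; apply Rinv_le_contravar; nra).
      assert (I0 : 0 < / (1 + t * t)) by (apply Rinv_0_lt_compat; nra).
      generalize (exp_pos (- (x * x) * (1 + t * t) / 2)); intros E0.
      set (e := exp (- (x * x) * (1 + t * t) / 2)) in *.
      set (i := / (1 + t * t)) in *. set (r := / (1 + x * x / 2)) in *.
      change (2 * e * i <= 2 * r).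
      assert (e * i <= e * 1) by (apply Rmult_le_compat_l; lra). lra.
    + rewrite RInt_const. unfold scal; simpl; unfold mult; simpl. lra.
Qed.

Lemma is_lim_gauss_primitive : is_lim gauss_primitive p_infty (sqrt (PI / 2)).
Proof.
  assert (HPI := PI_RGT_0).
  assert (S0 : 0 < sqrt (PI / 2)) by (apply sqrt_lt_R0; lra).
  assert (SS : sqrt (PI / 2) * sqrt (PI / 2) = PI / 2) by (apply sqrt_sqrt; lra).
  apply is_lim_spec. intros eps. set (e := pos eps). assert (e0 : 0 < e) by apply cond_pos.
  (* With [S = sqrt (PI / 2)] and a nonnegative primitive [G], [|G - S| S <= |G^2 - S^2|], which is
     the companion; making it smaller than [e S] is enough. *)
  set (d := e * sqrt (PI / 2)). assert (d0 : 0 < d) by now apply Rmult_lt_0_compat.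
  exists (1 + 4 / d). intros x Hx.
  assert (Q : 0 < 4 / d) by (apply Rdiv_lt_0_compat; lra).
  assert (x1 : 1 < x) by lra.
  assert (B := gauss_companion_bound x). assert (E := gauss_primitive_square x).
  assert (N := gauss_primitive_nonneg x ltac:(lra)).
  assert (C : 2 / (1 + x * x / 2) < d).
  { assert (4 < d * x).
    { assert (4 / d < x) by lra. apply Rmult_lt_compat_l with (r := d) in H; auto.
      replace (d * (4 / d)) with 4 in H by (field; lra). exact H. }
    apply Rmult_lt_reg_r with (1 + x * x / 2); [nra|]. unfold Rdiv at 1. rewrite Rmult_assoc, Rinv_l by nra. nra. }
  apply Rabs_def1; [|]; simpl; unfold d in C; fold e; nra.
Qed.
End Gaussian.

(** * The integral representation of U *)

Definition pcf_solution (a : C) (y y1 : R -> C) : Prop :=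
  (forall x, cder y x (y1 x)) /\ (forall x, cder y1 x ((RtoC x * RtoC x / 4 + a) * y x)).

Lemma pcf_wronskian_constant a u u1 v v1 x t : pcf_solution a u u1 -> pcf_solution a v v1 ->
  u x * v1 x - u1 x * v x = u t * v1 t - u1 t * v t.
Proof.
  intros [Hu Hu1] [Hv Hv1].
  apply (constant_of_cder_0 (fun x => u x * v1 x - u1 x * v x)). intros s.
  eapply cder_eq; [apply cder_minus; apply cder_mult; auto|]. cbv beta; ring.
Qed.

(** The Wronskian of the two decaying solutions [y] and [u] is constant and tends to 0, so it
    vanishes; their Wronskians with a third solution [v] then fix the factor. *)
Lemma recessive_proportional a u u1 v v1 y y1 k om :
  pcf_solution a u u1 -> pcf_solution a v v1 -> pcf_solution a y y1 ->
  superexp_decay u -> superexp_decay u1 -> superexp_decay y -> superexp_decay y1 ->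
  (forall x, u x * v1 x - u1 x * v x = om) -> (forall x, y x * v1 x - y1 x * v x = k * om) -> om <> 0 ->
  forall x, y x = k * u x /\ y1 x = k * u1 x.
Proof.
  intros Su Sv Sy Du Du1 Dy Dy1 Huv Hyv Hom x.
  assert (Z : y x * u1 x - y1 x * u x = 0).
  { apply (flim_unique (Rbar_locally p_infty) (fun t => y t * u1 t - y1 t * u t)).
    - apply (flim_ext _ (fun _ => y x * u1 x - y1 x * u x)); [|apply (flim_const _)].
      intros t. apply (pcf_wronskian_constant a); auto.
    - eapply flim_eq; [apply (flim_minus _); apply (flim_mult _); apply superexp_decay_ctends_0; assumption|ring]. }
  assert (A : forall w, (u x * v1 x - u1 x * v x) * w = om * w) by (intros; now rewrite Huv).
  split.
  - replace (y x) with ((u x * v1 x - u1 x * v x) * y x / om) by (rewrite Huv; field; auto).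
    (* The linear dependence of three vectors in the plane, here [(u, u1)], [(v, v1)] and [(y, y1)],
       with 2 by 2 determinants as coefficients. *)
    replace ((u x * v1 x - u1 x * v x) * y x) with (u x * (y x * v1 x - y1 x * v x) - v x * (y x * u1 x - y1 x * u x)) by ring.
    rewrite Z, Hyv. field; auto.
  - replace (y1 x) with ((u x * v1 x - u1 x * v x) * y1 x / om) by (rewrite Huv; field; auto).
    replace ((u x * v1 x - u1 x * v x) * y1 x) with (u1 x * (y x * v1 x - y1 x * v x) - v1 x * (y x * u1 x - y1 x * u x)) by ring.
    rewrite Z, Hyv. field; auto.
Qed.

(** The power [t^c], continued by 0 to [t <= 0]: for [1 < Re c] it is differentiable on the whole
    line, as [cdiff] demands. *)
Definition power_pos (c : C) (t : R) : C := if Rlt_dec 0 t then cexp (c * RtoC (ln t)) else 0.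

Lemma power_pos_pos c t : (0 < t)%R -> power_pos c t = cexp (c * RtoC (ln t)).
Proof. intros H. unfold power_pos. destruct (Rlt_dec 0 t); auto. contradiction. Qed.

Lemma power_pos_nonpos c t : (t <= 0)%R -> power_pos c t = 0.
Proof. intros H. unfold power_pos. destruct (Rlt_dec 0 t); auto. lra. Qed.

Lemma Cmod_power_pos c t : (0 < t)%R -> Cmod (power_pos c t) = exp (Re c * ln t).
Proof. intros H. rewrite power_pos_pos, Cmod_cexp by auto. f_equal. destruct c; simpl; ring. Qed.

Lemma power_pos_succ c t : RtoC t * power_pos c t = power_pos (c + 1) t.
Proof.
  destruct (Rlt_dec 0 t).
  - rewrite !power_pos_pos by auto. rewrite Cmult_plus_distr_r, cexp_plus, Cmult_1_l, cexp_RtoC, exp_ln by auto. ring.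
  - rewrite !power_pos_nonpos by lra. ring.
Qed.

Lemma power_pos_div c t x : (0 < x)%R -> power_pos c (t / x) = power_pos c t / power_pos c x.
Proof.
  intros Hx. rewrite (power_pos_pos c x) by auto. destruct (Rlt_dec 0 t).
  - assert (0 < t / x)%R by now apply Rdiv_lt_0_compat.
    rewrite !power_pos_pos, ln_div by auto.
    assert (N := cexp_neq_0 (c * RtoC (ln x))).
    replace (c * RtoC (ln t)) with (c * RtoC (ln t - ln x) + c * RtoC (ln x)) by (rewrite RtoC_minus; ring).
    rewrite cexp_plus. field. auto.
  - rewrite !power_pos_nonpos; [unfold Cdiv; ring|lra|].
    assert (0 < / x)%R by now apply Rinv_0_lt_compat. unfold Rdiv. nra.
Qed.

Lemma cder_power_pos c t : (1 < Re c)%R -> cder (power_pos c) t (c * power_pos (c - 1) t).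
Proof.
  intros Hc. destruct (total_order_T t 0) as [[Ht|Ht]|Ht].
  - rewrite power_pos_nonpos by lra. rewrite Cmult_0_r.
    apply cder_eps. intros eps He. exists (- t)%R. split; [lra|]. intros h Hh. apply Rabs_def2 in Hh.
    rewrite !power_pos_nonpos by lra. replace (0 - 0 - RtoC h * 0) with (RtoC 0) by ring.
    rewrite Cmod_0. apply Rmult_le_pos; [lra|apply Rabs_pos].
  - rewrite power_pos_nonpos by lra. rewrite Cmult_0_r.
    (* At 0 the difference quotient has modulus [h^(Re c - 1)]; the radius is
       [eps^(1 / (Re c - 1))]. *)
    apply cder_eps. intros eps He. exists (exp (ln eps / (Re c - 1)))%R. split; [apply exp_pos|]. intros h Hh.
    rewrite (power_pos_nonpos c t) by lra. replace (power_pos c (t + h) - 0 - RtoC h * 0) with (power_pos c (t + h)) by ring.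
    destruct (Rlt_dec 0 h) as [H0|H0].
    + rewrite Ht, Rplus_0_l, Cmod_power_pos by auto. rewrite Rabs_pos_eq in * by lra.
      rewrite <- (exp_ln h) at 2 by auto. rewrite <- (exp_ln eps) by auto. rewrite <- exp_plus. apply exp_le_compat.
      apply ln_increasing in Hh; auto. rewrite ln_exp in Hh.
      apply Rmult_lt_compat_l with (r := (Re c - 1)%R) in Hh; [|lra].
      replace ((Re c - 1) * (ln eps / (Re c - 1)))%R with (ln eps) in Hh by (field; lra). lra.
    + rewrite power_pos_nonpos by lra. rewrite Cmod_0. apply Rmult_le_pos; [lra|apply Rabs_pos].
  - assert (K : cder (fun t => cexp (c * RtoC (ln t))) t (c * power_pos (c - 1) t)).
    { eapply cder_eq.
      - apply cder_cexp, cder_mult; [apply cder_const|]. apply (cder_RtoC ln t (/ t)%R).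
        auto_derive; auto. field; lra.
      - cbv beta. rewrite power_pos_pos by auto.
        replace (c * RtoC (ln t)) with ((c - 1) * RtoC (ln t) + RtoC (ln t)) by ring.
        rewrite cexp_plus, (cexp_RtoC (ln t)), exp_ln, RtoC_inv by (auto; lra). field.
        intros Q; apply RtoC_inj in Q; lra. }
    destruct K as [K1 K2].
    assert (L : locally t (fun y => cexp (c * RtoC (ln y)) = power_pos c y)).
    { exists (mkposreal t Ht). intros y Hy. symmetry. apply power_pos_pos.
      unfold ball in Hy; simpl in Hy. unfold AbsRing_ball, abs, minus, plus, opp in Hy; simpl in Hy.
      apply Rabs_def2 in Hy. lra. }
    split; [eapply is_derive_ext_loc; [|exact K1]|eapply is_derive_ext_loc; [|exact K2]];
    (eapply filter_imp; [|exact L]); intros y Hy; simpl in *; now rewrite <- Hy.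
Qed.

Definition gauss_weight (c : C) (t : R) : C := power_pos c t * RtoC (exp (- (t * t) / 2)).

Lemma cder_gauss_weight c t : (1 < Re c)%R ->
  cder (gauss_weight c) t (c * gauss_weight (c - 1) t - gauss_weight (c + 1) t).
Proof.
  intros Hc. eapply cder_eq.
  - apply cder_mult; [now apply cder_power_pos|].
    apply (cder_RtoC (fun t => exp (- (t * t) / 2)) t (- t * exp (- (t * t) / 2))%R).
    auto_derive; auto. unfold Rdiv. set (E := exp _). field.
  - cbv beta. unfold gauss_weight. rewrite <- (power_pos_succ c t), RtoC_mult, RtoC_opp. ring.
Qed.

Lemma cdiff_gauss_weight c : (1 < Re c)%R -> cdiff (gauss_weight c).
Proof. intros Hc t. eexists. now apply cder_gauss_weight. Qed.

Lemma superexp_decay_gauss_weight c : (0 <= Re c)%R -> superexp_decay (gauss_weight c).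
Proof.
  (* With [t^(Re c) <= exp (t Re c)], the constant results from [m t - t^2 / 2 <= m^2 / 2]. *)
  intros Hc k. set (m := (Re c + k)%R). exists (exp (m * m / 2)). intros t Ht.
  unfold gauss_weight. rewrite Cmod_mult, Cmod_R, (Rabs_pos_eq (exp _)) by (left; apply exp_pos).
  rewrite <- exp_plus.
  destruct (Rlt_dec 0 t) as [H|H].
  - rewrite Cmod_power_pos, <- exp_plus by auto. apply exp_le_compat.
    assert (L : (ln t <= t)%R).
    { rewrite <- (ln_exp t) at 2. apply ln_le; auto. apply le_exp. }
    assert (Re c * ln t <= Re c * t)%R by now apply Rmult_le_compat_l.
    assert (0 <= (t - m) * (t - m))%R by apply Rle_0_sqr. unfold m in *. nra.
  - rewrite power_pos_nonpos, Cmod_0, Rmult_0_l by lra. left; apply exp_pos.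
Qed.

Lemma gauss_weight_succ c t : RtoC t * gauss_weight c t = gauss_weight (c + 1) t.
Proof. unfold gauss_weight. rewrite <- power_pos_succ. ring. Qed.

Lemma laplace_ext f g mu : (forall t, f t = g t) -> cdiff f -> superexp_decay f -> laplace f mu = laplace g mu.
Proof.
  intros E Hf Sf. assert (Hg : cdiff g).
  { intros x. destruct (Hf x) as [l Hl]. exists l. now apply (cder_ext f). }
  assert (Sg := superexp_decay_ext f g E Sf).
  apply (is_cint_unique (fun t => cexp (- mu * RtoC t) * g t)); [now apply cdiff_cexp_mult| |now apply laplace_correct].
  apply (is_cint_ext (fun t => cexp (- mu * RtoC t) * f t)); [intros; now rewrite E|now apply laplace_correct].
Qed.

(* The classical integral representation is
   [U(c+1/2,x) = e^(-x^2/4) / Gamma(c+1) * pcf_integral c x]. *)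
Definition pcf_integral (c : C) (x : R) : C := laplace (gauss_weight c) (RtoC x).

Lemma cder_pcf_integral c x : (1 < Re c)%R -> cder (pcf_integral c) x (- pcf_integral (c + 1) x).
Proof.
  intros Hc.
  assert (D := cdiff_gauss_weight c Hc). assert (S := superexp_decay_gauss_weight c ltac:(lra)).
  apply (cder_ext (fun s => laplace (gauss_weight c) (0 + RtoC s * 1))).
  { intros t. unfold pcf_integral. f_equal. ring. }
  eapply cder_eq; [now apply cder_laplace|].
  unfold pcf_integral. replace (0 + RtoC x * 1) with (RtoC x) by ring.
  rewrite (laplace_ext (fun t => RtoC t * gauss_weight c t) (gauss_weight (c + 1))).
  - ring.
  - intros; apply gauss_weight_succ.
  - now apply cdiff_id_mult.
  - now apply superexp_decay_id_mult.
Qed.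

(** Integration of the derivative of [exp (- x t) t^(c+1) exp (- t^2 / 2)], which vanishes at both
    ends. *)
Lemma pcf_integral_recurrence c x : (1 < Re c)%R ->
  pcf_integral (c + 1 + 1) x = (c + 1) * pcf_integral c x - RtoC x * pcf_integral (c + 1) x.
Proof.
  intros Hc.
  assert (R1 : (1 < Re (c + 1))%R) by (destruct c; simpl in *; lra).
  assert (R2 : (1 < Re (c + 1 + 1))%R) by (destruct c; simpl in *; lra).
  assert (L : forall b, (1 < Re b)%R -> is_cint (fun t => cexp (- RtoC x * RtoC t) * gauss_weight b t) (pcf_integral b x)).
  { intros b Hb. apply laplace_correct; [now apply cdiff_gauss_weight|apply superexp_decay_gauss_weight; lra]. }
  set (P := fun t => cexp (- RtoC x * RtoC t) * gauss_weight (c + 1) t).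
  set (p := fun t => (c + 1) * (cexp (- RtoC x * RtoC t) * gauss_weight c t) - RtoC x * (cexp (- RtoC x * RtoC t) * gauss_weight (c + 1) t)
       - cexp (- RtoC x * RtoC t) * gauss_weight (c + 1 + 1) t).
  assert (I1 : is_cint p ((c + 1) * pcf_integral c x - RtoC x * pcf_integral (c + 1) x - pcf_integral (c + 1 + 1) x)).
  { apply is_cint_minus; [apply is_cint_minus; apply is_cint_scal|]; apply L; auto. }
  assert (I2 : is_cint p (0 - P 0%R)).
  { apply is_cint_derive.
    - intros t. eapply cder_eq.
      + apply cder_mult; [apply cder_cexp, cder_mult; [apply cder_const|apply cder_id]|now apply cder_gauss_weight].
      + cbv beta. unfold p. replace (c + 1 - 1) with c by ring. ring.
    - apply superexp_decay_ctends_0, superexp_decay_cexp_mult, superexp_decay_gauss_weight. lra. }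
  assert (Dp : cdiff p).
  { intros t.
    destruct (cdiff_cexp_mult (RtoC x) _ (cdiff_gauss_weight c Hc) t) as [l0 K0].
    destruct (cdiff_cexp_mult (RtoC x) _ (cdiff_gauss_weight _ R1) t) as [l1 K1].
    destruct (cdiff_cexp_mult (RtoC x) _ (cdiff_gauss_weight _ R2) t) as [l2 K2].
    eexists. unfold p. apply cder_minus; [apply cder_minus; (apply cder_mult; [apply cder_const|eassumption])|exact K2]. }
  assert (E := is_cint_unique p _ _ Dp I1 I2).
  assert (P0 : P 0%R = 0) by (unfold P, gauss_weight; rewrite power_pos_nonpos by lra; ring).
  rewrite P0 in E.
  replace (pcf_integral (c + 1 + 1) x) with ((c + 1) * pcf_integral c x - RtoC x * pcf_integral (c + 1) x -
    ((c + 1) * pcf_integral c x - RtoC x * pcf_integral (c + 1) x - pcf_integral (c + 1 + 1) x)) by ring.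
  rewrite E. ring.
Qed.

Definition half_gauss (x : R) : C := RtoC (exp (- (x * x) / 4)).

Lemma cder_half_gauss x : cder half_gauss x (- (RtoC x / 2) * half_gauss x).
Proof.
  eapply cder_eq.
  - apply (cder_RtoC (fun x => exp (- (x * x) / 4)) x (- (x / 2) * exp (- (x * x) / 4))%R).
    auto_derive; auto. unfold Rdiv. set (E := exp _). field.
  - rewrite RtoC_mult, RtoC_opp, RtoC_div by lra. reflexivity.
Qed.

Lemma superexp_decay_half_gauss : superexp_decay half_gauss.
Proof.
  intros k. exists (exp (k * k)). intros t Ht. unfold half_gauss.
  rewrite Cmod_R, Rabs_pos_eq by (left; apply exp_pos). rewrite <- exp_plus. apply exp_le_compat.
  assert (0 <= (t / 2 - k) * (t / 2 - k))%R by apply Rle_0_sqr. nra.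
Qed.

Lemma pcf_integral_bounded c : (1 < Re c)%R -> exists K, forall x, (0 <= x)%R -> (Cmod (pcf_integral c x) <= K)%R.
Proof.
  intros Hc. destruct (laplace_bounded (gauss_weight c) 0 (cdiff_gauss_weight c Hc) (superexp_decay_gauss_weight c ltac:(lra))) as [K HK].
  exists K. intros x Hx. apply HK. simpl. lra.
Qed.

(** A multiple of [U(c + 1/2, x)]; the factor is eliminated later without being evaluated. *)
Definition pcf_rep (c : C) (x : R) : C := pcf_integral c x * half_gauss x.
Definition pcf_rep' (c : C) (x : R) : C :=
  - pcf_integral (c + 1) x * half_gauss x - / 2 * (RtoC x * (pcf_integral c x * half_gauss x)).

Lemma pcf_rep_solution c : (1 < Re c)%R -> pcf_solution (c + / 2) (pcf_rep c) (pcf_rep' c).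
Proof.
  intros Hc.
  assert (R1 : (1 < Re (c + 1))%R) by (destruct c; simpl in *; lra).
  split; intros x.
  - eapply cder_eq; [apply cder_mult; [now apply cder_pcf_integral|apply cder_half_gauss]|].
    unfold pcf_rep'. field.
  - eapply cder_eq.
    + apply cder_minus; [apply cder_mult; [apply cder_opp; now apply cder_pcf_integral|apply cder_half_gauss]|].
      apply cder_mult; [apply cder_const|]. apply cder_mult; [apply cder_id|].
      apply cder_mult; [now apply cder_pcf_integral|apply cder_half_gauss].
    + cbv beta. unfold pcf_rep. rewrite pcf_integral_recurrence by auto. field.
Qed.

Lemma superexp_decay_pcf_rep c : (1 < Re c)%R -> superexp_decay (pcf_rep c) /\ superexp_decay (pcf_rep' c).
Proof.
  intros Hc.
  assert (R1 : (1 < Re (c + 1))%R) by (destruct c; simpl in *; lra).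
  destruct (pcf_integral_bounded c Hc) as [K0 HK0]. destruct (pcf_integral_bounded _ R1) as [K1 HK1].
  assert (S0 := superexp_decay_bounded_mult _ _ K0 HK0 superexp_decay_half_gauss).
  assert (S1 := superexp_decay_bounded_mult _ _ K1 HK1 superexp_decay_half_gauss).
  split; [exact S0|].
  apply (superexp_decay_ext (fun x => - (1) * (pcf_integral (c + 1) x * half_gauss x) + - / 2 * (RtoC x * (pcf_integral c x * half_gauss x)))).
  { intros; unfold pcf_rep'; ring. }
  apply superexp_decay_plus; apply superexp_decay_scal; auto. now apply superexp_decay_id_mult.
Qed.

Lemma exp_pow_nat x k : (exp x ^ k = exp (INR k * x))%R.
Proof.
  induction k as [|k IH]; [simpl; rewrite Rmult_0_l, exp_0; reflexivity|].
  rewrite S_INR, Rmult_plus_distr_r, exp_plus, Rmult_1_l, <- IH. simpl. ring.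
Qed.

(** In the next lemma, [4 Cmod c] serves for [u > 1/2], and the extra 4 for [u <= 1/2], where
    [|u - 1| >= 1/2] and the left side is at most 2. *)
Definition power_bound (c : C) : R := (4 * Cmod c + 4)%R.

(** Away from 0 this is the bound on [exp w - 1] with [w = c ln u] and [|ln u| <= 2 |u - 1|]; near
    0, where the logarithm is unbounded, a trivial bound suffices. The integer [k] makes the
    majorant polynomial in [u]. *)
Lemma power_pos_sub_1_le c k u : (0 <= Re c <= INR k)%R -> (0 <= u)%R ->
  (Cmod (power_pos c u - 1) <= power_bound c * Rabs (u - 1) * (1 + u ^ k))%R.
Proof.
  intros Hc Hu. assert (c0 := Cmod_ge_0 c). assert (uk : (0 <= u ^ k)%R) by now apply pow_le.
  assert (a0 := Rabs_pos (u - 1)). unfold power_bound.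
  destruct (Rle_dec u (/ 2)) as [H|H].
  - assert (A : (/ 2 <= Rabs (u - 1))%R) by (rewrite Rabs_left by lra; lra).
    assert (B : (Cmod (power_pos c u) <= 1)%R).
    { destruct (Rlt_dec 0 u).
      - rewrite Cmod_power_pos by auto. rewrite <- exp_0. apply exp_le_compat.
        assert (ln u <= 0)%R by (rewrite <- ln_1; apply ln_le; lra). nra.
      - rewrite power_pos_nonpos, Cmod_0 by lra. lra. }
    generalize (Cmod_sub_triangle (power_pos c u) 1). rewrite Cmod_1. intros T.
    assert (2 <= (4 * Cmod c + 4) * Rabs (u - 1))%R by nra. nra.
  - rewrite power_pos_pos by lra. eapply Rle_trans; [apply Cmod_cexp_sub_1_le|].
    replace (Re (c * RtoC (ln u))) with (Re c * ln u)%R by (destruct c; simpl; ring).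
    rewrite Cmod_mult, Cmod_R.
    assert (L : (Rabs (ln u) <= 2 * Rabs (u - 1))%R).
    { destruct (Rle_dec 1 u).
      - assert (0 <= ln u)%R by (rewrite <- ln_1; apply ln_le; lra). rewrite !Rabs_pos_eq by lra.
        assert (ln u <= u - 1)%R by (rewrite <- (ln_exp (u - 1)); apply ln_le; [lra|generalize (exp_ineq1_le (u - 1)); lra]). lra.
      - assert (ln u < 0)%R by (rewrite <- ln_1; apply ln_increasing; lra). rewrite !Rabs_left by lra.
        rewrite <- ln_Rinv by lra.
        assert (I : (0 < / u)%R) by (apply Rinv_0_lt_compat; lra).
        assert (I2 : (/ u <= 2)%R) by (replace 2%R with (/ / 2)%R by field; apply Rinv_le_contravar; lra).
        assert (ln (/ u) <= / u - 1)%R by (rewrite <- (ln_exp (/ u - 1)); apply ln_le; [lra|generalize (exp_ineq1_le (/ u - 1)); lra]).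
        assert (/ u * u = 1)%R by (apply Rinv_l; lra). nra. }
    assert (E : (exp (Re c * ln u) <= 1 + u ^ k)%R).
    { destruct (Rle_dec 1 u).
      - assert (0 <= ln u)%R by (rewrite <- ln_1; apply ln_le; lra).
        rewrite <- (exp_ln u) at 2 by lra. rewrite exp_pow_nat.
        assert (exp (Re c * ln u) <= exp (INR k * ln u))%R by (apply exp_le_compat; nra).
        lra.
      - assert (exp (Re c * ln u) <= exp 0)%R; [|rewrite exp_0 in *; lra]. apply exp_le_compat.
        assert (ln u <= 0)%R by (rewrite <- ln_1; apply ln_le; lra). nra. }
    apply Rle_trans with (Cmod c * (2 * Rabs (u - 1)) * (2 * (1 + u ^ k)))%R.
    + apply Rmult_le_compat; [apply Rmult_le_pos; auto using Rabs_pos|generalize (exp_pos (Re c * ln u)); lra| |lra].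
      now apply Rmult_le_compat_l.
    + assert (0 <= Rabs (u - 1) * (1 + u ^ k))%R by (apply Rmult_le_pos; lra). nra.
Qed.

Lemma ex_nat_ge (r : R) : exists k : nat, (r <= INR k)%R.
Proof.
  destruct (Rle_dec 0 r) as [H|H].
  - destruct (nfloor_ex r H) as [n Hn]. exists (S n). rewrite S_INR. lra.
  - exists O. simpl. lra.
Qed.

(* Laplace's method at the maximum [t = x] of [t^c e^(- t^2/2 + x t)]. *)
Lemma pcf_integral_laplace_method c : (1 < Re c)%R ->
  ctends (fun x => RtoC (exp (- (x * x) / 2)) * pcf_integral c (- x) / power_pos c x) (RtoC (sqrt (2 * PI))).
Proof.
  intros Hc. destruct (ex_nat_ge (Re c)) as [k Hk].
  assert (HPI := PI_RGT_0).
  (* With [b = |t - x|], the polynomial factors cost [exp (m b)], and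
     [m b - b^2 / 2 <= m^2 - b^2 / 4] leaves the constant [exp (m^2)] in [K]. *)
  set (m := (INR k + 1)%R). set (K := (power_bound c * (2 * exp (m * m)))%R).
  assert (Kp : (0 <= K)%R).
  { unfold K, power_bound. apply Rmult_le_pos; [generalize (Cmod_ge_0 c); lra|]. generalize (exp_pos (m * m)); lra. }
  (* Replacing [(t / x)^c] by 1 costs a factor [1 / x]. The remaining Gaussian is weakened to a
     rational function, whose primitive is an arctangent. *)
  assert (Pt : forall x t, (1 <= x)%R -> (0 <= t)%R ->
    (Cmod ((power_pos c (t / x) - 1) * RtoC (exp (- ((t - x) * (t - x)) / 2))) <= K / x * / (1 + (t - x) * (t - x) / 4))%R).
  { intros x t Hx Ht.
    rewrite Cmod_mult, Cmod_R, (Rabs_pos_eq (exp _)) by (left; apply exp_pos).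
    set (s := (t - x)%R). set (b := Rabs s). assert (b0 : (0 <= b)%R) by apply Rabs_pos.
    assert (sb : (s * s = b * b)%R) by (unfold b; rewrite <- Rabs_mult, Rabs_pos_eq; nra).
    assert (x0 : (0 < / x)%R) by (apply Rinv_0_lt_compat; lra).
    assert (x1 : (/ x <= 1)%R) by (rewrite <- Rinv_1; apply Rinv_le_contravar; lra).
    assert (u0 : (0 <= t / x)%R) by (unfold Rdiv; nra).
    assert (Eu : (t / x - 1 = s * / x)%R) by (unfold s; field; lra).
    assert (u1 : (t / x <= exp b)%R).
    { apply Rle_trans with (1 + b)%R; [|apply exp_ineq1_le]. assert (s <= b)%R by apply Rle_abs.
      replace (t / x)%R with (1 + s * / x)%R by lra. nra. }
    assert (uk : ((t / x) ^ k <= exp (INR k * b))%R).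
    { eapply Rle_trans; [apply pow_incr; split; [exact u0|exact u1]|]. rewrite exp_pow_nat. right. reflexivity. }
    assert (B1 := power_pos_sub_1_le c k (t / x) ltac:(lra) u0).
    rewrite Eu, Rabs_mult, (Rabs_pos_eq (/ x)) in B1 by lra. fold b in B1.
    assert (B2 : (1 + (t / x) ^ k <= 2 * exp (INR k * b))%R).
    { assert (1 <= exp (INR k * b))%R; [|lra]. rewrite <- exp_0. apply exp_le_compat. apply Rmult_le_pos; auto using pos_INR. }
    assert (C0 : (0 <= power_bound c)%R) by (unfold power_bound; generalize (Cmod_ge_0 c); lra).
    assert (B3 : (Cmod (power_pos c (t / x) - 1) <= power_bound c * (exp b * / x) * (2 * exp (INR k * b)))%R).
    { eapply Rle_trans; [exact B1|]. apply Rmult_le_compat; auto.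
      - apply Rmult_le_pos; auto. nra.
      - assert (0 <= (t / x) ^ k)%R by now apply pow_le. lra.
      - apply Rmult_le_compat_l; auto. apply Rmult_le_compat_r; [lra|apply le_exp]. }
    assert (B4 : (exp b * exp (INR k * b) * exp (- (s * s) / 2) <= exp (m * m) * / (1 + s * s / 4))%R).
    { apply Rle_trans with (exp (m * m) * exp (- (s * s / 4)))%R.
      - rewrite <- !exp_plus. apply exp_le_compat. rewrite sb.
        assert (0 <= (b / 2 - m) * (b / 2 - m))%R by apply Rle_0_sqr. unfold m in *. nra.
      - apply Rmult_le_compat_l; [left; apply exp_pos|]. apply exp_neg_le_inv. rewrite sb. nra. }
    eapply Rle_trans; [apply Rmult_le_compat_r; [left; apply exp_pos|exact B3]|].
    replace (power_bound c * (exp b * / x) * (2 * exp (INR k * b)) * exp (- (s * s) / 2))%R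
      with (power_bound c * 2 * / x * (exp b * exp (INR k * b) * exp (- (s * s) / 2)))%R by ring.
    replace (K / x * / (1 + s * s / 4))%R with (power_bound c * 2 * / x * (exp (m * m) * / (1 + s * s / 4)))%R by (unfold K, Rdiv; ring).
    apply Rmult_le_compat_l; auto. apply Rmult_le_pos; lra. }
  assert (I : forall x, (1 <= x)%R ->
    (Cmod (RtoC (exp (- (x * x) / 2)) * pcf_integral c (- x) / power_pos c x - RtoC (sqrt (PI / 2) + gauss_primitive x)) <= K / x * (2 * PI))%R).
  { intros x Hx.
    assert (N : power_pos c x <> 0) by (rewrite power_pos_pos by lra; apply cexp_neq_0).
    assert (J1 : is_cint (fun t => RtoC (exp (- (x * x) / 2)) / power_pos c x * (cexp (- RtoC (- x) * RtoC t) * gauss_weight c t))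
       (RtoC (exp (- (x * x) / 2)) / power_pos c x * pcf_integral c (- x))).
    { apply is_cint_scal, laplace_correct; [now apply cdiff_gauss_weight|apply superexp_decay_gauss_weight; lra]. }
    (* The Gaussian centred at [x], cut off at 0: its mass tends to the full [sqrt (2 PI)] as [x]
       grows. *)
    assert (J2 : is_cint (fun t => RtoC (exp (- ((t - x) * (t - x)) / 2))) (RtoC (sqrt (PI / 2) + gauss_primitive x))).
    { eapply is_cint_eq.
      - apply (is_cint_derive (fun t => RtoC (gauss_primitive (t - x)))).
        + intros t. apply cder_RtoC. evar_last.
          * apply (is_derive_comp gauss_primitive (fun t => t - x)%R); [apply is_derive_gauss_primitive|].
            auto_derive; auto.
          * unfold scal; simpl; unfold mult; simpl. ring.
        + apply (flim_of_is_lim (fun t => gauss_primitive (t - x)) (sqrt (PI / 2))).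
          apply (is_lim_comp gauss_primitive (fun t => t - x)%R p_infty (sqrt (PI / 2)) p_infty is_lim_gauss_primitive).
          * apply (is_lim_plus (fun t => t) (fun _ => - x)%R p_infty p_infty (- x)%R p_infty);
            [apply is_lim_id|apply is_lim_const|reflexivity].
          * exists 0%R; intros; discriminate.
      - rewrite <- RtoC_minus. f_equal. rewrite Rminus_0_l, gauss_primitive_opp. ring. }
    assert (J := is_cint_minus _ _ _ _ J1 J2).
    replace (RtoC (exp (- (x * x) / 2)) * pcf_integral c (- x) / power_pos c x - RtoC (sqrt (PI / 2) + gauss_primitive x))
      with (RtoC (exp (- (x * x) / 2)) / power_pos c x * pcf_integral c (- x) - RtoC (sqrt (PI / 2) + gauss_primitive x)) by (field; auto).
    set (G := fun t => (K / x * (2 * atan ((t - x) / 2)))%R).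
    assert (Kx : (0 <= K / x)%R) by (apply Rmult_le_pos; [auto|left; apply Rinv_0_lt_compat; lra]).
    apply Rle_trans with (K / x * PI - G 0)%R.
    - apply (is_cint_Cmod_le _ _ G (fun t => K / x * / (1 + (t - x) * (t - x) / 4))%R _ J).
      + intros t _. unfold G. auto_derive; auto. field. split; [|lra]. assert (0 <= (t - x) * (t - x))%R by apply Rle_0_sqr. nra.
      + intros t Ht. cbv beta.
        replace (RtoC (exp (- (x * x) / 2)) / power_pos c x * (cexp (- RtoC (- x) * RtoC t) * gauss_weight c t) - RtoC (exp (- ((t - x) * (t - x)) / 2)))
          with ((power_pos c (t / x) - 1) * RtoC (exp (- ((t - x) * (t - x)) / 2))); [now apply Pt|].
        rewrite power_pos_div by lra. unfold gauss_weight.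
        replace (- RtoC (- x) * RtoC t) with (RtoC (x * t)) by (rewrite RtoC_mult, RtoC_opp; ring).
        replace (- ((t - x) * (t - x)) / 2)%R with (- (x * x) / 2 + x * t + - (t * t) / 2)%R by field.
        rewrite cexp_RtoC, !exp_plus, !RtoC_mult. field. auto.
      + intros t _. unfold G. apply Rmult_le_compat_l; auto. generalize (atan_bound ((t - x) / 2)). lra.
    - unfold G. generalize (atan_bound ((0 - x) / 2)). intros.
      assert (K / x * (PI + - (2 * atan ((0 - x) / 2))) <= K / x * (2 * PI))%R by (apply Rmult_le_compat_l; lra). lra. }
  assert (S2 : (sqrt (2 * PI) = sqrt (PI / 2) + sqrt (PI / 2))%R).
  { replace (2 * PI)%R with (2 * 2 * (PI / 2))%R by field. rewrite sqrt_mult by lra. rewrite sqrt_square by lra. ring. }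
  apply (flim_ext _ (fun x => (RtoC (exp (- (x * x) / 2)) * pcf_integral c (- x) / power_pos c x - RtoC (sqrt (PI / 2) + gauss_primitive x))
     + RtoC (sqrt (PI / 2) + gauss_primitive x))); [intros; ring|].
  eapply flim_eq.
  - apply (flim_plus _).
    + apply (flim_le _ _ 0 (fun x => K / x * (2 * PI))%R).
      * exists 1%R. intros x Hx. eapply Rle_trans; [|apply (I x); lra]. right. f_equal. cbv beta. ring.
      * apply (flim_of_is_lim _ 0).
        apply (is_lim_ext (fun x => K * (2 * PI) * / x)%R); [intros; unfold Rdiv; ring|].
        replace (Finite 0) with (Rbar_mult (K * (2 * PI))%R 0) by (simpl; f_equal; ring).
        apply is_lim_scal_l. apply (is_lim_inv (fun x => x) p_infty p_infty); [apply is_lim_id|discriminate].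
    + apply (flim_of_is_lim (fun x => sqrt (PI / 2) + gauss_primitive x)%R (sqrt (PI / 2) + sqrt (PI / 2))%R).
      apply (is_lim_plus (fun _ => sqrt (PI / 2)) gauss_primitive p_infty (sqrt (PI / 2)) (sqrt (PI / 2)));
      [apply is_lim_const|apply is_lim_gauss_primitive|reflexivity].
  - rewrite S2. ring.
Qed.

(** * Recurrence and reflection Wronskian of [U] *)

Section PCF.
Variables (U Up : C -> C -> C).
Hypothesis HU : is_PCF_U U Up.

Lemma pcf_solution_U a : pcf_solution a (fun t => U a (RtoC t)) (fun t => Up a (RtoC t)).
Proof. split; intros; [now apply (cder_U_real U Up)|now apply (cder_Up_real U Up)]. Qed.

(** [U(- a, - i x)] is the growing reference solution with which Wronskians normalise the recessive
    ones. *)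
Lemma ex_dominant_solution a : exists (v v1 : R -> C) (B : C), pcf_solution a v v1 /\ B <> 0 /\
  ctends (fun x => v x / growth (- (- a - / 2) - 1) 1 x) B.
Proof.
  set (c := - Ci).
  assert (cc : c * c = - (1)) by (unfold c, Cmult, Copp, RtoC, Ci; simpl; f_equal; ring).
  assert (S := line_solution_U U Up HU (- a) (- a) c ltac:(rewrite !cc; ring) ltac:(rewrite cc; ring)).
  exists (fun t => U (- a) (c * RtoC t)), (fun t => c * Up (- a) (c * RtoC t)), (cexp ((- - a - / 2) * (RtoC (- (PI / 2)) * Ci))).
  split; [split|split].
  - intros x. apply (cder_ext (fun t => U (- a) (c * (0 + RtoC t * 1)))); [intros; do 2 f_equal; ring|].
    eapply cder_eq; [exact (proj1 (S 0 1 x))|]. replace (0 + RtoC x * 1) with (RtoC x) by ring. ring.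
  - intros x. apply (cder_ext (fun t => c * Up (- a) (c * (0 + RtoC t * 1)))); [intros; do 3 f_equal; ring|].
    eapply cder_eq; [exact (proj2 (S 0 1 x))|]. cbv beta. replace (0 + RtoC x * 1) with (RtoC x) by ring. ring.
  - apply cexp_neq_0.
  - apply (flim_ext _ (fun x => U (- a) (c * RtoC x) / growth (- - a - / 2) 1 x)).
    + intros x. do 2 f_equal. field.
    + apply (U_asymptotics_ray U Up HU).
      * exact cln_mCi.
      * unfold c. now rewrite Cmod_opp, Cmod_Ci.
      * rewrite cc, <- RtoC_opp. reflexivity.
      * generalize PI_RGT_0; intros. rewrite Rabs_Ropp, Rabs_pos_eq; lra.
Qed.

Lemma pcf_wronskian_of_asymptotics a A B u u1 v v1 : pcf_solution a u u1 -> pcf_solution a v v1 ->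
  ctends (fun x => u x / growth (- a - / 2) (-1) x) A -> ctends (fun x => v x / growth (- (- a - / 2) - 1) 1 x) B ->
  forall x, u x * v1 x - u1 x * v x = A * B.
Proof. intros [? ?] [? ?] LA LB. now apply (wronskian_of_asymptotics a (- a - / 2)). Qed.

(* [U'(b+1,x) - (x/2) U(b+1,x)] is recessive with leading behaviour [- x^(-b-1/2) e^(-x^2/4)]. *)
Lemma U_recurrence_0 b : Up (b + 1) 0 = - U b 0 /\ Up b 0 = - (b + / 2) * U (b + 1) 0.
Proof.
  set (y := fun t : R => Up (b + 1) (RtoC t) - / 2 * (RtoC t * U (b + 1) (RtoC t))).
  set (y1 := fun t : R => / 4 * (RtoC t * (RtoC t * U (b + 1) (RtoC t))) + (b + / 2) * U (b + 1) (RtoC t) - / 2 * (RtoC t * Up (b + 1) (RtoC t))).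
  destruct (pcf_solution_U (b + 1)) as [H1 H2].
  assert (Sy : pcf_solution b y y1).
  { split; intros t.
    - eapply cder_eq; [apply cder_minus; [apply H2|]; apply cder_mult; [apply cder_const|]; apply cder_mult; [apply cder_id|apply H1]|].
      cbv beta. unfold y1. field.
    - eapply cder_eq.
      + apply cder_minus; [apply cder_plus|].
        * apply cder_mult; [apply cder_const|]. apply cder_mult; [apply cder_id|]. apply cder_mult; [apply cder_id|apply H1].
        * apply cder_mult; [apply cder_const|apply H1].
        * apply cder_mult; [apply cder_const|]. apply cder_mult; [apply cder_id|apply H2].
      + cbv beta. unfold y. field. }
  assert (D := superexp_decay_U_real U Up HU (b + 1)). assert (D1 := superexp_decay_Up_real U Up HU (b + 1)).
  assert (Dy : superexp_decay y).
  { apply (superexp_decay_ext (fun t => Up (b + 1) (RtoC t) + - / 2 * (RtoC t * U (b + 1) (RtoC t)))).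
    { intros; unfold y; ring. }
    apply superexp_decay_plus; auto. apply superexp_decay_scal. now apply superexp_decay_id_mult. }
  assert (Dy1 : superexp_decay y1).
  { apply (superexp_decay_ext (fun t => / 4 * (RtoC t * (RtoC t * U (b + 1) (RtoC t))) + (b + / 2) * U (b + 1) (RtoC t)
       + - / 2 * (RtoC t * Up (b + 1) (RtoC t)))).
    { intros; unfold y1; ring. }
    repeat apply superexp_decay_plus; apply superexp_decay_scal; auto; [do 2 apply superexp_decay_id_mult|apply superexp_decay_id_mult]; auto. }
  destruct (ex_dominant_solution b) as [v [v1 [B [Sv [B0 LB]]]]].
  assert (LU := U_asymptotics_pos U Up HU b).
  assert (Ly : ctends (fun x => y x / growth (- b - / 2) (-1) x) (- (1))).
  { assert (LU1 := U_asymptotics_pos U Up HU (b + 1)).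
    apply (flim_ext_ev _ (fun x => Up (b + 1) (RtoC x) / (RtoC x * growth (- (b + 1) - / 2) (-1) x)
       - / 2 * (U (b + 1) (RtoC x) / growth (- (b + 1) - / 2) (-1) x))).
    - exists 0%R. intros x Hx. unfold y.
      assert (N : RtoC x <> 0) by (intros Q; apply RtoC_inj in Q; lra).
      replace (growth (- b - / 2) (-1) x) with (RtoC x * growth (- (b + 1) - / 2) (-1) x).
      + field. split; [apply growth_neq_0|auto].
      + unfold growth. rewrite <- (exp_ln x) at 1 by auto. rewrite <- cexp_RtoC, <- cexp_plus. f_equal. ring.
    - eapply flim_eq.
      + apply (flim_minus _).
        * apply (derivative_asymptotics (b + 1) (- (b + 1) - / 2) 1 (-1) _ _ ltac:(rewrite Rabs_left; lra) H1 H2 LU1).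
        * apply (flim_mult _); [apply (flim_const _)|exact LU1].
      + replace (-1 / 2)%R with (- / 2)%R by field. rewrite RtoC_opp, RtoC_inv by lra. field. }
  assert (W1 := pcf_wronskian_of_asymptotics b 1 B _ _ v v1 (pcf_solution_U b) Sv LU LB).
  assert (W2 := pcf_wronskian_of_asymptotics b (- (1)) B y y1 v v1 Sy Sv Ly LB).
  destruct (recessive_proportional b _ _ v v1 y y1 (- (1)) (1 * B) (pcf_solution_U b) Sv Sy
     (superexp_decay_U_real U Up HU b) (superexp_decay_Up_real U Up HU b) Dy Dy1 W1) with (x := 0%R) as [E1 E2].
  - intros x. rewrite W2. ring.
  - now rewrite Cmult_1_l.
  - cbv beta in E1, E2. unfold y in E1. unfold y1 in E2. split.
    + replace (Up (b + 1) 0) with (Up (b + 1) 0 - / 2 * (0 * U (b + 1) 0)) by ring. rewrite E1. ring.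
    + replace (Up b 0) with (- (- (1) * Up b 0)) by ring. rewrite <- E2. ring.
Qed.

Lemma U_reflection_wronskian_succ b :
  U_reflection_wronskian U Up b = (b + / 2) * U_reflection_wronskian U Up (b + 1).
Proof.
  destruct (U_recurrence_0 b) as [E1 E2]. unfold U_reflection_wronskian. rewrite E1, E2. ring.
Qed.

(** Write [pcf_rep c = k U(b, x)]. At 0 the two integrals are [k U(b,0)] and [- k U'(b,0)].
    Laplace's method for [pcf_rep c (- x)] gives [- 2 k U(b,0) U'(b,0) = sqrt (2 PI)] as its
    Wronskian with [U]. The product sought is half the square of this number, so [k] disappears. *)
Lemma U_reflection_wronskian_integral c : (1 < Re c)%R ->
  U_reflection_wronskian U Up (c + / 2) * (pcf_integral c 0 * pcf_integral (c + 1) 0) = RtoC PI.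
Proof.
  intros Hc. set (b := c + / 2).
  assert (Sy := pcf_rep_solution c Hc). destruct (superexp_decay_pcf_rep c Hc) as [Dy Dy1].
  destruct (ex_dominant_solution b) as [v [v1 [B [Sv [B0 LB]]]]].
  assert (W1 := pcf_wronskian_of_asymptotics b 1 B _ _ v v1 (pcf_solution_U b) Sv (U_asymptotics_pos U Up HU b) LB).
  set (k := (pcf_rep c 0 * v1 0%R - pcf_rep' c 0 * v 0%R) / (1 * B)).
  assert (K : forall x : R, pcf_rep c x = k * U b (RtoC x) /\ pcf_rep' c x = k * Up b (RtoC x)).
  { apply (recessive_proportional b (fun t => U b (RtoC t)) (fun t => Up b (RtoC t)) v v1 _ _ k (1 * B)); auto.
    - apply pcf_solution_U.
    - apply (superexp_decay_U_real U Up HU).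
    - apply (superexp_decay_Up_real U Up HU).
    - intros x. rewrite (pcf_wronskian_constant b _ _ _ _ x 0 Sy Sv). unfold k. field; auto.
    - now rewrite Cmult_1_l. }
  assert (SR : pcf_solution b (fun x => pcf_rep c (- x)) (fun x => - pcf_rep' c (- x))).
  { destruct Sy as [Sy0 Sy1]. split; intros x.
    - assert (X : cder (fun t => pcf_rep c (- t)) x (RtoC (-1) * pcf_rep' c (- x))).
      { apply (cder_comp (pcf_rep c) Ropp x); [apply Sy0|auto_derive; auto]. }
      eapply cder_eq; [apply X|].
      replace (-1)%R with (- (1))%R by ring. rewrite RtoC_opp. ring.
    - assert (X : cder (fun t => pcf_rep' c (- t)) x (RtoC (-1) * ((RtoC (- x) * RtoC (- x) / 4 + (c + / 2)) * pcf_rep c (- x)))).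
      { apply (cder_comp (pcf_rep' c) Ropp x); [apply Sy1|auto_derive; auto]. }
      eapply cder_eq; [apply cder_opp, X|].
      cbv beta. replace (-1)%R with (- (1))%R by ring. rewrite !RtoC_opp. fold b. field. }
  assert (LR : ctends (fun x => pcf_rep c (- x) / growth (- (- b - / 2) - 1) 1 x) (RtoC (sqrt (2 * PI)))).
  { apply (flim_ext_ev _ (fun x => RtoC (exp (- (x * x) / 2)) * pcf_integral c (- x) / power_pos c x)).
    - exists 0%R. intros x Hx. unfold pcf_rep, half_gauss, growth. rewrite power_pos_pos by auto.
      replace (- (- b - / 2) - 1) with c by (unfold b; field).
      rewrite cexp_plus, cexp_RtoC.
      replace (- (- x * - x) / 4)%R with (- (x * x) / 2 + 1 * x * x / 4)%R by field.
      rewrite exp_plus, RtoC_mult. field. split; [|apply cexp_neq_0].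
      intros Q; apply RtoC_inj in Q. generalize (exp_pos (1 * x * x / 4)); lra.
    - now apply pcf_integral_laplace_method. }
  assert (W3 := pcf_wronskian_of_asymptotics b 1 _ _ _ _ _ (pcf_solution_U b) SR (U_asymptotics_pos U Up HU b) LR 0%R).
  cbv beta in W3. rewrite Ropp_0 in W3.
  destruct (K 0%R) as [K0 K1].
  assert (h0 : half_gauss 0 = 1).
  { unfold half_gauss. replace (- (0 * 0) / 4)%R with 0%R by field. now rewrite exp_0. }
  assert (E0 : pcf_integral c 0 = k * U b 0).
  { rewrite <- K0. unfold pcf_rep. rewrite h0. ring. }
  assert (E1 : pcf_integral (c + 1) 0 = - (k * Up b 0)).
  { rewrite <- K1. unfold pcf_rep'. rewrite h0. ring. }
  rewrite K0, K1 in W3. rewrite E0, E1. unfold U_reflection_wronskian.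
  set (p := U b 0 * Up b 0).
  assert (W4 : - (2 * k * p) = RtoC (sqrt (2 * PI))).
  { transitivity (1 * RtoC (sqrt (2 * PI))); [rewrite <- W3; unfold p; ring|ring]. }
  transitivity (- (2 * k * p) * - (2 * k * p) / 2); [unfold p; field|].
  rewrite W4, <- RtoC_mult, sqrt_sqrt by (generalize PI_RGT_0; lra).
  rewrite RtoC_mult. field.
Qed.
End PCF.

(** * Gauss' product *)

(** The moments of [exp (- t^2 / 2)] on the half-line, by their two-step recurrence. *)
Fixpoint gauss_moment (n : nat) : R :=
  match n with
  | O => sqrt (PI / 2)
  | S O => 1
  | S (S m as m') => (INR m' * gauss_moment m)%R
  end.

Lemma gauss_moment_SS n : gauss_moment (S (S n)) = (INR (S n) * gauss_moment n)%R.
Proof. reflexivity. Qed.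

Lemma gauss_moment_pos n : (0 < gauss_moment n)%R.
Proof.
  assert (H : (0 < gauss_moment n /\ 0 < gauss_moment (S n))%R).
  { induction n as [|n [IH1 IH2]].
    - split; [apply sqrt_lt_R0; generalize PI_RGT_0; lra|simpl; lra].
    - split; auto. rewrite gauss_moment_SS. apply Rmult_lt_0_compat; auto. apply lt_0_INR; lia. }
  apply H.
Qed.

(** Supplies the factorial of Gauss' product. *)
Lemma gauss_moment_mult n : (gauss_moment n * gauss_moment (S n) = INR (fact n) * sqrt (PI / 2))%R.
Proof.
  induction n as [|n IH]; [simpl; ring|].
  rewrite gauss_moment_SS. rewrite fact_simpl, mult_INR, Rmult_assoc, <- IH. ring.
Qed.

Definition gauss_monomial (n : nat) (t : R) : R := (t ^ n * exp (- (t * t) / 2))%R.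

Lemma superexp_decay_gauss_monomial n : superexp_decay (fun t => RtoC (gauss_monomial n t)).
Proof.
  induction n as [|n IH].
  - intros k. exists (exp (k * k)). intros t Ht. unfold gauss_monomial.
    rewrite Cmod_R, pow_O, Rmult_1_l, Rabs_pos_eq by (left; apply exp_pos). rewrite <- exp_plus. apply exp_le_compat.
    assert (0 <= (t / 2 - k) * (t / 2 - k))%R by apply Rle_0_sqr. assert (0 <= t * t)%R by apply Rle_0_sqr. nra.
  - apply (superexp_decay_ext (fun t => RtoC t * RtoC (gauss_monomial n t))).
    + intros t. rewrite <- RtoC_mult. f_equal. unfold gauss_monomial. simpl. ring.
    + now apply superexp_decay_id_mult.
Qed.

Lemma is_cint_gauss_monomial n : is_cint (fun t => RtoC (gauss_monomial n t)) (RtoC (gauss_moment n)).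
Proof.
  assert (H : is_cint (fun t => RtoC (gauss_monomial n t)) (RtoC (gauss_moment n)) /\
              is_cint (fun t => RtoC (gauss_monomial (S n) t)) (RtoC (gauss_moment (S n)))); [|apply H].
  induction n as [|n [IH1 IH2]].
  - split.
    + eapply is_cint_eq; [apply (is_cint_derive (fun t => RtoC (gauss_primitive t)))|].
      * intros t. apply cder_RtoC. unfold gauss_monomial. rewrite pow_O, Rmult_1_l. apply is_derive_gauss_primitive.
      * apply flim_of_is_lim, is_lim_gauss_primitive.
      * rewrite gauss_primitive_0. simpl. ring.
    + eapply is_cint_eq; [apply (is_cint_derive (fun t => - (1) * RtoC (gauss_monomial 0 t)))|].
      * intros t. eapply cder_eq; [apply cder_mult; [apply cder_const|]|].
        apply (cder_RtoC _ _ (- t * gauss_monomial 0 t)%R). unfold gauss_monomial. auto_derive; auto.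
        unfold Rdiv. set (E := exp _). field.
        cbv beta. unfold gauss_monomial. rewrite !RtoC_mult, RtoC_opp. simpl. rewrite Rmult_1_r. ring.
      * apply superexp_decay_ctends_0, superexp_decay_scal, superexp_decay_gauss_monomial.
      * unfold gauss_monomial. simpl. replace (- (0 * 0) / 2)%R with 0%R by field. rewrite exp_0, Rmult_1_r. ring.
  - split; auto. rewrite gauss_moment_SS.
    eapply is_cint_eq; [eapply is_cint_ext; [|apply is_cint_minus; [apply (is_cint_scal (RtoC (INR (S n)))), IH1|
      apply (is_cint_derive (fun t => RtoC (gauss_monomial (S n) t)) (fun t => RtoC (INR (S n) * gauss_monomial n t - gauss_monomial (S (S n)) t)))]]|].
    + intros t. cbv beta. rewrite RtoC_minus, RtoC_mult. ring.
    + intros t. apply cder_RtoC. unfold gauss_monomial. auto_derive; auto.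
      change (match n with O => 1%R | S _ => (INR n + 1)%R end) with (INR (S n)).
      unfold Rdiv. set (E := exp _). set (N := INR (S n)). simpl. field.
    + apply superexp_decay_ctends_0, superexp_decay_gauss_monomial.
    + unfold gauss_monomial. rewrite pow_i, Rmult_0_l by lia. rewrite RtoC_mult. ring.
Qed.

Lemma is_cint_pcf_integral_0 c : (1 < Re c)%R -> is_cint (gauss_weight c) (pcf_integral c 0).
Proof.
  intros Hc. apply (is_cint_ext (fun t => cexp (- RtoC 0 * RtoC t) * gauss_weight c t)).
  - intros t. replace (- RtoC 0 * RtoC t) with (RtoC 0) by ring. rewrite cexp_0. ring.
  - apply laplace_correct; [now apply cdiff_gauss_weight|apply superexp_decay_gauss_weight; lra].
Qed.

(** The mean of [(t^2 / n)^j] under the weight [t^n exp (- t^2 / 2)]. *)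
Definition moment_ratio (j n : nat) : R := (gauss_moment (n + 2 * j) / (INR n ^ j * gauss_moment n))%R.

Lemma is_lim_seq_inv_INR : is_lim_seq (fun n => / INR n)%R 0.
Proof.
  apply (is_lim_seq_inv INR p_infty); [apply is_lim_seq_INR|discriminate].
Qed.

Lemma is_lim_seq_moment_ratio j : is_lim_seq (moment_ratio j) 1.
Proof.
  induction j as [|j IH].
  - apply (is_lim_seq_ext (fun _ => 1%R)); [|apply is_lim_seq_const].
    intros n. unfold moment_ratio. rewrite Nat.mul_0_r, Nat.add_0_r, pow_O. field.
    generalize (gauss_moment_pos n); lra.
  - apply (is_lim_seq_ext_loc (fun n => moment_ratio j n * (1 + INR (S (2 * j)) * / INR n))%R).
    + exists 1%nat. intros n Hn. unfold moment_ratio.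
      replace (n + 2 * S j)%nat with (S (S (n + 2 * j))) by lia. rewrite gauss_moment_SS.
      replace (S (n + 2 * j)) with (n + S (2 * j))%nat by lia. rewrite plus_INR.
      assert (0 < INR n)%R by (apply lt_0_INR; lia). generalize (gauss_moment_pos n); intros.
      simpl (_ ^ S j)%R. field. repeat split; try lra. apply pow_nonzero; lra.
    + replace (Finite 1) with (Finite (1 * (1 + INR (S (2 * j)) * 0))) by (f_equal; ring).
      apply is_lim_seq_mult'; [exact IH|]. apply is_lim_seq_plus'; [apply is_lim_seq_const|].
      apply is_lim_seq_mult'; [apply is_lim_seq_const|apply is_lim_seq_inv_INR].
Qed.

(** [t^(n+z) = n^(z/2) t^n (t^2/n)^(z/2)] displays the expected size [n^(z/2)]; for [t = 0] both
    sides vanish because [n >= 1]. *)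
Lemma gauss_weight_rescale n z t : (1 <= n)%nat -> (0 <= t)%R ->
  gauss_weight (RtoC (INR n) + z) t = cexp (z / 2 * RtoC (ln (INR n))) *
    (RtoC (gauss_monomial n t) * power_pos (z / 2) (t * t / INR n)).
Proof.
  intros Hn Ht. assert (Pn : (0 < INR n)%R) by (apply lt_0_INR; lia).
  unfold gauss_weight, gauss_monomial. destruct (Rlt_dec 0 t) as [H|H].
  - assert (0 < t * t)%R by nra. assert (0 < t * t / INR n)%R by now apply Rdiv_lt_0_compat.
    rewrite !power_pos_pos, ln_div, ln_mult by auto.
    rewrite RtoC_mult.
    assert (E : RtoC (t ^ n) = cexp (RtoC (INR n) * RtoC (ln t))).
    { rewrite <- RtoC_mult, cexp_RtoC, <- exp_pow_nat, exp_ln by auto. reflexivity. }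
    rewrite E.
    replace ((RtoC (INR n) + z) * RtoC (ln t)) with
      (z / 2 * RtoC (ln (INR n)) + (RtoC (INR n) * RtoC (ln t) + z / 2 * RtoC (ln t + ln t - ln (INR n)))).
    + rewrite !cexp_plus. ring.
    + rewrite RtoC_minus, RtoC_plus. field.
  - rewrite (power_pos_nonpos _ t) by lra. replace t with 0%R by lra. rewrite pow_i by lia. rewrite !RtoC_mult. ring.
Qed.

Definition integral_ratio (z : C) (n : nat) : C :=
  pcf_integral (RtoC (INR n) + z) 0 / (cexp (z / 2 * RtoC (ln (INR n))) * RtoC (gauss_moment n)).

(* Under the weight [t^n e^(- t^2/2)] the variable [r = t^2/n] concentrates at 1, by a second moment
   computation; [2|r - 1| <= eps + (r - 1)^2 / eps] keeps all moments even. *)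
Lemma flim_integral_ratio z : (1 < Re z)%R -> flim eventually (integral_ratio z) 1.
Proof.
  intros Hz eta Heta.
  destruct (ex_nat_ge (Re z)) as [k Hk].
  assert (Rz : Re (z / 2) = (Re z / 2)%R) by (destruct z; unfold Cdiv, Cmult, Cinv, Re; simpl; field).
  set (B := power_bound (z / 2)).
  assert (B4 : (4 <= B)%R) by (unfold B, power_bound; generalize (Cmod_ge_0 (z / 2)); lra).
  (* Makes the limit [2 B eps] of [bound] equal to [eta / 2]. *)
  set (eps := (eta / (4 * B))%R). assert (eps0 : (0 < eps)%R) by (apply Rdiv_lt_0_compat; lra).
  (* The mean of the dominating function [g] below: the combinations with coefficients 1, -2, 1 are
     the means of [(r - 1)^2] and of [(r - 1)^2 r^k], which tend to 0. *)
  set (bound := fun n => (B * (eps * (moment_ratio 0 n + moment_ratio k n) + / eps *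
      (moment_ratio 2 n - 2 * moment_ratio 1 n + moment_ratio 0 n +
       (moment_ratio (k + 2) n - 2 * moment_ratio (k + 1) n + moment_ratio k n))))%R).
  assert (Lb : is_lim_seq bound (B * (eps * 2))%R).
  { replace (B * (eps * 2))%R with (B * (eps * (1 + 1) + / eps * (1 - 2 * 1 + 1 + (1 - 2 * 1 + 1))))%R by ring.
    unfold bound.
    assert (R3 : forall i j l, is_lim_seq (fun n => moment_ratio i n - 2 * moment_ratio j n + moment_ratio l n)%R (1 - 2 * 1 + 1)%R).
    { intros i j l. apply is_lim_seq_plus'; [|apply is_lim_seq_moment_ratio].
      apply is_lim_seq_minus'; [apply is_lim_seq_moment_ratio|].
      apply (is_lim_seq_scal_l _ 2 1), is_lim_seq_moment_ratio. }
    apply is_lim_seq_mult'; [apply is_lim_seq_const|]. apply is_lim_seq_plus'.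
    - apply is_lim_seq_mult'; [apply is_lim_seq_const|]. apply is_lim_seq_plus'; apply is_lim_seq_moment_ratio.
    - apply is_lim_seq_mult'; [apply is_lim_seq_const|]. apply is_lim_seq_plus'; apply R3. }
  apply is_lim_seq_spec in Lb.
  assert (He2 : (0 < eta / 4)%R) by lra.
  destruct (Lb (mkposreal _ He2)) as [N HN]. simpl in HN.
  exists (S N). intros n Hn. specialize (HN n ltac:(lia)).
  assert (n1 : (1 <= n)%nat) by lia. assert (Pn : (0 < INR n)%R) by (apply lt_0_INR; lia).
  assert (Mn := gauss_moment_pos n).
  assert (Bn : (bound n < eta)%R).
  { apply Rabs_def2 in HN. replace (B * (eps * 2))%R with (eta / 2)%R in HN by (unfold eps; field; lra). lra. }
  assert (Rc : (1 < Re (RtoC (INR n) + z))%R) by (destruct z; simpl in *; lra).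
  set (D := cexp (z / 2 * RtoC (ln (INR n)))). assert (D0 : D <> 0) by apply cexp_neq_0.
  assert (M0 : RtoC (gauss_moment n) <> 0) by (intros Q; apply RtoC_inj in Q; lra).
  assert (J := is_cint_minus _ _ _ _ (is_cint_scal (/ D) _ _ (is_cint_pcf_integral_0 _ Rc)) (is_cint_gauss_monomial n)).
  cbv beta in J.
  set (T := fun j t => (/ INR n ^ j * gauss_monomial (n + 2 * j) t)%R).
  assert (IT : forall j, is_cint (fun t => RtoC (T j t)) (RtoC (gauss_moment n * moment_ratio j n))).
  { intros j. eapply is_cint_eq; [eapply is_cint_ext; [|apply (is_cint_scal (RtoC (/ INR n ^ j))), (is_cint_gauss_monomial (n + 2 * j))]|].
    - intros t. cbv beta. unfold T. now rewrite RtoC_mult.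
    - rewrite <- RtoC_mult. f_equal. unfold moment_ratio. field. split; [lra|apply pow_nonzero; lra]. }
  set (g := fun t => (B * (eps * (T 0%nat t + T k t) + / eps *
      (T 2%nat t - 2 * T 1%nat t + T 0%nat t + (T (k + 2)%nat t - 2 * T (k + 1)%nat t + T k t))))%R).
  assert (Ig : is_cint (fun t => RtoC (g t)) (RtoC (gauss_moment n * bound n))).
  { eapply is_cint_eq; [eapply is_cint_ext; [|
      apply (is_cint_scal (RtoC B)), is_cint_plus; [apply (is_cint_scal (RtoC eps)), is_cint_plus; apply IT|];
      apply (is_cint_scal (RtoC (/ eps))), is_cint_plus; (apply is_cint_plus; [apply is_cint_minus; [apply IT|apply (is_cint_scal (RtoC 2)), IT]|apply IT])]|].
    - intros t. cbv beta. unfold g. rewrite !RtoC_mult, !RtoC_plus, !RtoC_mult, !RtoC_plus, !RtoC_minus, !RtoC_mult. reflexivity.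
    - unfold bound. rewrite <- !RtoC_mult, <- !RtoC_minus, <- !RtoC_plus, <- !RtoC_mult, <- !RtoC_plus, <- !RtoC_mult. f_equal. ring. }
  assert (Q : (Cmod (/ D * pcf_integral (RtoC (INR n) + z) 0 - RtoC (gauss_moment n)) <= gauss_moment n * bound n)%R).
  { apply (is_cint_Cmod_le_cint _ _ g _ J Ig). intros t Ht. cbv beta.
    rewrite gauss_weight_rescale by auto. fold D. set (r := (t * t / INR n)%R).
    assert (r0 : (0 <= r)%R) by (apply Rmult_le_pos; [nra|left; now apply Rinv_0_lt_compat]).
    assert (G0 : (0 <= gauss_monomial n t)%R) by (apply Rmult_le_pos; [now apply pow_le|left; apply exp_pos]).
    replace (/ D * (D * (RtoC (gauss_monomial n t) * power_pos (z / 2) r)) - RtoC (gauss_monomial n t))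
      with (RtoC (gauss_monomial n t) * (power_pos (z / 2) r - 1)) by (field; auto).
    rewrite Cmod_mult, Cmod_R, Rabs_pos_eq by auto.
    assert (Tr : forall j, T j t = (r ^ j * gauss_monomial n t)%R).
    { intros j. unfold T, r, gauss_monomial. unfold Rdiv at 2. rewrite Rpow_mult_distr, pow_inv, pow_add, pow_mult.
      replace (t ^ 2)%R with (t * t)%R by ring. ring. }
    assert (Eg : g t = (gauss_monomial n t * (B * ((eps + / eps * ((r - 1) * (r - 1))) * (1 + r ^ k))))%R).
    { unfold g. rewrite !Tr, !pow_add. simpl. ring. }
    rewrite Eg. apply Rmult_le_compat_l; auto.
    eapply Rle_trans; [apply (power_pos_sub_1_le (z / 2) k r); [rewrite Rz; lra|auto]|].
    fold B. rewrite Rmult_assoc. apply Rmult_le_compat_l; [lra|].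
    assert (rk : (0 <= r ^ k)%R) by now apply pow_le.
    apply Rmult_le_compat_r; [lra|].
    set (x := Rabs (r - 1)). assert (x0 : (0 <= x)%R) by apply Rabs_pos.
    replace ((r - 1) * (r - 1))%R with (x * x)%R by (unfold x; rewrite <- Rabs_mult, Rabs_pos_eq; [ring|apply Rle_0_sqr]).
    apply Rmult_le_reg_l with eps; auto.
    replace (eps * (eps + / eps * (x * x)))%R with (eps * eps + x * x)%R by (field; lra). nra. }
  unfold integral_ratio. fold D.
  replace (pcf_integral (RtoC (INR n) + z) 0 / (D * RtoC (gauss_moment n)) - 1)
    with ((/ D * pcf_integral (RtoC (INR n) + z) 0 - RtoC (gauss_moment n)) / RtoC (gauss_moment n)) by (field; auto).
  rewrite Cmod_div, Cmod_R, (Rabs_pos_eq (gauss_moment n)) by (auto; lra).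
  apply Rle_lt_trans with (bound n); auto.
  apply Rmult_le_reg_r with (gauss_moment n); auto. unfold Rdiv. rewrite Rmult_assoc, Rinv_l by lra. lra.
Qed.

Lemma flim_cexp_0 {T} (F : (T -> Prop) -> Prop) {FF : ProperFilter F} (f : T -> C) :
  flim F f 0 -> flim F (fun x => cexp (f x)) 1.
Proof.
  intros H. set (K := (1 + exp 1)%R). assert (K0 : (0 < K)%R) by (unfold K; generalize (exp_pos 1); lra).
  intros eps He.
  assert (E : (0 < Rmin 1 (eps / K))%R) by (apply Rmin_pos; [lra|now apply Rdiv_lt_0_compat]).
  eapply filter_imp; [|exact (H _ E)]. intros x Hx. cbv beta in *.
  replace (f x - 0) with (f x) in Hx by ring.
  eapply Rle_lt_trans; [apply Cmod_cexp_sub_1_le|].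
  assert (Re (f x) <= 1)%R.
  { generalize (Rle_abs (Re (f x))) (re_le_Cmod (f x)) (Rmin_l 1 (eps / K)). lra. }
  apply exp_le_compat in H0.
  apply Rle_lt_trans with (Cmod (f x) * K)%R; [apply Rmult_le_compat_l; [apply Cmod_ge_0|unfold K; lra]|].
  replace eps with (eps / K * K)%R by (field; lra). apply Rmult_lt_compat_r; auto.
  generalize (Rmin_r 1 (eps / K)); lra.
Qed.

Lemma flim_inv_INR : flim eventually (fun n => RtoC (/ INR n)) 0.
Proof. apply (flim_of_is_lim_seq (fun n => / INR n)%R 0), is_lim_seq_inv_INR. Qed.

Lemma flim_shift (f : nat -> C) l : flim eventually f l -> flim eventually (fun n => f (S n)) l.
Proof. intros H eps He. destruct (H eps He) as [N HN]. exists N. intros n Hn. apply HN. lia. Qed.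

(** Corrects the mismatch between [n^(z/2)] and [(n+1)^(z/2)] when two consecutive integrals are
    multiplied. *)
Lemma flim_power_ratio z : flim eventually (fun n => cexp (z * RtoC (ln (INR n) - ln (INR (S n))))) 1.
Proof.
  apply (flim_cexp_0 _).
  apply (flim_eq _ _ (z * 0)); [|ring]. apply (flim_mult _); [apply (flim_const _)|].
  apply (flim_le _ _ _ (fun n => / INR n)%R); [|apply flim_inv_INR].
  exists 1%nat. intros n Hn. assert (P : (0 < INR n)%R) by (apply lt_0_INR; lia).
  replace (RtoC (ln (INR n) - ln (INR (S n))) - 0) with (RtoC (ln (INR n) - ln (INR (S n)))) by ring.
  rewrite Cmod_R, <- Rabs_Ropp. rewrite S_INR.
  replace (- (ln (INR n) - ln (INR n + 1)))%R with (ln ((INR n + 1) / INR n)) by (rewrite ln_div by lra; ring).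
  replace ((INR n + 1) / INR n)%R with (1 + / INR n)%R by (field; lra).
  assert (0 < / INR n)%R by now apply Rinv_0_lt_compat.
  rewrite Rabs_pos_eq by (rewrite <- ln_1; apply ln_le; lra).
  rewrite <- (ln_exp (/ INR n)) at 2. apply ln_le; [lra|apply exp_ineq1_le].
Qed.

Lemma poch_prod_S z n : poch_prod z (S n) = poch_prod z n * (z + RtoC (INR (S n))).
Proof. reflexivity. Qed.

Lemma poch_prod_neq_0 z n : (forall m : nat, z <> - RtoC (INR m)) -> poch_prod z n <> 0.
Proof.
  intros H. induction n as [|n IH]; [|rewrite poch_prod_S].
  - intros Q. apply (H 0%nat). change (z = 0) in Q. rewrite Q. simpl INR. ring.
  - apply Cmult_neq_0; auto. intros Q. apply (H (S n)).
    replace z with (z + RtoC (INR (S n)) - RtoC (INR (S n))) by ring. rewrite Q. ring.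
Qed.

Lemma poch_prod_shift z n : z * poch_prod (z + 1) n = poch_prod z n * (z + RtoC (INR (S n))).
Proof.
  induction n as [|n IH].
  - simpl. ring.
  - rewrite !poch_prod_S. rewrite Cmult_assoc, IH. rewrite (S_INR (S n)), (S_INR n), !RtoC_plus. ring.
Qed.

(** [lim] is specified on Cauchy filters; convergence makes the filter Cauchy, and uniqueness of
    limits identifies the value. *)
Lemma CGamma_of_flim z l : flim eventually (gauss_seq z) l -> CGamma z = l.
Proof.
  intros H. apply (flim_unique eventually (gauss_seq z)); auto.
  apply (flim_of_filterlim _). intros P [eps HP]. unfold filtermap.
  apply (filter_imp (fun n => ball (M := C_UniformSpace) (CGamma z) eps (gauss_seq z n))); [intros; now apply HP|].
  apply (complete_cauchy (T := C_CompleteNormedModule) (filtermap (gauss_seq z) eventually)).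
  - apply filtermap_proper_filter, eventually_filter.
  - intros e. exists l. apply (flim_to_filterlim _) in H. apply H. exists e. auto.
Qed.

(** * The Gamma identity for the reflection Wronskian *)

Section PCF.
Variables (U Up : C -> C -> C).
Hypothesis HU : is_PCF_U U Up.
Let w := U_reflection_wronskian U Up.

(** [poch_prod z n] has [n + 1] factors, hence the shift by [S n]; it is exactly the denominator in
    Gauss' sequence. *)
Lemma U_reflection_wronskian_poch a n : w a = poch_prod (a + / 2) n * w (a + RtoC (INR (S n))).
Proof.
  induction n as [|n IH].
  - simpl. apply (U_reflection_wronskian_succ U Up HU).
  - rewrite IH. unfold w. rewrite (U_reflection_wronskian_succ U Up HU (a + RtoC (INR (S n)))).
    rewrite !poch_prod_S. rewrite (S_INR (S n)), RtoC_plus, (Cplus_assoc a). ring.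
Qed.

Lemma flim_gauss_seq_wronskian_right a : (1 < Re (/ 2 + a))%R ->
  flim eventually (fun n => gauss_seq (/ 2 + a) n * w a) (RtoC (sqrt (2 * PI))).
Proof.
  intros Ha. set (z := / 2 + a) in *. assert (HPI := PI_RGT_0).
  assert (Hz : forall m : nat, z <> - RtoC (INR m)).
  { intros m Q. rewrite Q in Ha. simpl in Ha. generalize (pos_INR m). lra. }
  assert (S0 : (0 < sqrt (PI / 2))%R) by (apply sqrt_lt_R0; lra).
  (* With [c = n + z], where [c + 1/2 = a + n + 1], the shifted Wronskian is [PI] over two
     consecutive integrals. Each integral is its ratio times a power and a moment; the moments
     absorb [n!], and [sqrt (2 PI) sqrt (PI / 2) = PI]. *)
  apply (flim_ext_ev _ (fun n => RtoC (sqrt (2 * PI)) * cexp (z / 2 * RtoC (ln (INR n) - ln (INR (S n)))) *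
     / (integral_ratio z n * integral_ratio z (S n)))).
  - exists 1%nat. intros n Hn.
    assert (Rn : (1 < Re (RtoC (INR n) + z))%R) by (generalize (pos_INR n); destruct z; simpl in *; lra).
    assert (E := U_reflection_wronskian_integral U Up HU _ Rn). fold w in E.
    unfold gauss_seq. rewrite (U_reflection_wronskian_poch a n).
    replace (a + / 2) with z by (unfold z; ring).
    assert (P0 := poch_prod_neq_0 z n Hz).
    replace (RtoC (INR n) + z + / 2) with (a + RtoC (INR (S n))) in E by (unfold z; rewrite S_INR, RtoC_plus; field).
    replace (RtoC (INR n) + z + 1) with (RtoC (INR (S n)) + z) in E by (rewrite S_INR, RtoC_plus; ring).
    unfold integral_ratio.
    set (J0 := pcf_integral (RtoC (INR n) + z) 0) in *. set (J1 := pcf_integral (RtoC (INR (S n)) + z) 0) in *.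
    set (W := w (a + RtoC (INR (S n)))) in *.
    assert (EN : RtoC PI <> 0) by (intros Q; apply RtoC_inj in Q; lra).
    assert (J00 : J0 <> 0) by (intros Q; apply EN; rewrite <- E, Q; ring).
    assert (J10 : J1 <> 0) by (intros Q; apply EN; rewrite <- E, Q; ring).
    assert (EW : W = RtoC PI / (J0 * J1)) by (rewrite <- E; field; auto).
    rewrite EW.
    replace (z * RtoC (ln (INR n))) with (z / 2 * RtoC (ln (INR n)) + z / 2 * RtoC (ln (INR n))) by field.
    replace (z / 2 * RtoC (ln (INR n) - ln (INR (S n)))) with (z / 2 * RtoC (ln (INR n)) + - (z / 2 * RtoC (ln (INR (S n))))) by (rewrite RtoC_minus; ring).
    rewrite !cexp_plus.
    assert (EO := cexp_opp (z / 2 * RtoC (ln (INR (S n))))).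
    set (e1 := cexp (z / 2 * RtoC (ln (INR (S n))))) in *. set (e1' := cexp (- _)) in *.
    set (e0 := cexp (z / 2 * RtoC (ln (INR n)))).
    assert (e00 : e0 <> 0) by apply cexp_neq_0. assert (e10 : e1 <> 0) by apply cexp_neq_0.
    replace e1' with (/ e1) by (replace e1' with (e1' * e1 / e1) by (field; auto); rewrite EO; field; auto).
    assert (MM := gauss_moment_mult n). apply (f_equal RtoC) in MM. rewrite !RtoC_mult in MM.
    assert (M0 : RtoC (gauss_moment n) <> 0) by (intros Q; apply RtoC_inj in Q; generalize (gauss_moment_pos n); lra).
    assert (M1 : RtoC (gauss_moment (S n)) <> 0) by (intros Q; apply RtoC_inj in Q; generalize (gauss_moment_pos (S n)); lra).
    assert (SC : RtoC (sqrt (2 * PI)) * RtoC (sqrt (PI / 2)) = RtoC PI).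
    { rewrite <- RtoC_mult, <- sqrt_mult by lra. f_equal.
      replace (2 * PI * (PI / 2))%R with (PI * PI)%R by field. apply sqrt_square; lra. }
    transitivity (RtoC (sqrt (2 * PI)) * (e0 * e0) * (RtoC (gauss_moment n) * RtoC (gauss_moment (S n))) / (J0 * J1)).
    + field. repeat split; auto.
    + rewrite MM, <- SC. field. repeat split; auto.
  - assert (L0 := flim_integral_ratio z Ha). assert (L1 := flim_shift _ _ L0).
    eapply flim_eq.
    + apply (flim_mult _); [apply (flim_mult _); [apply (flim_const _)|apply flim_power_ratio]|].
      apply (flim_inv _); [|apply (flim_mult _); [exact L0|exact L1]].
      rewrite Cmult_1_l. intros Q; apply RtoC_inj in Q; lra.
    + field.
Qed.

(** Extension to the left by unit steps: passing from [a + 1] to [a] multiplies the sequence by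
    [1 + (z + 1) / n], which tends to 1. *)
Lemma flim_gauss_seq_wronskian N : forall a, (forall m : nat, / 2 + a <> - RtoC (INR m)) ->
  (1 < Re (/ 2 + a) + INR N)%R ->
  flim eventually (fun n => gauss_seq (/ 2 + a) n * w a) (RtoC (sqrt (2 * PI))).
Proof.
  induction N as [|N IH]; intros a Ha HN.
  - apply flim_gauss_seq_wronskian_right. simpl INR in HN. lra.
  - assert (Ha1 : forall m : nat, / 2 + (a + 1) <> - RtoC (INR m)).
    { intros m Q. apply (Ha (S m)). rewrite S_INR, RtoC_plus.
      replace (/ 2 + a) with (/ 2 + (a + 1) - 1) by ring. rewrite Q. ring. }
    assert (HN1 : (1 < Re (/ 2 + (a + 1)) + INR N)%R).
    { rewrite S_INR in HN. destruct a; simpl in *. lra. }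
    specialize (IH (a + 1) Ha1 HN1).
    set (z := / 2 + a) in *.
    assert (z0 : z <> 0) by (intros Q; apply (Ha O); rewrite Q; simpl; ring).
    replace (/ 2 + (a + 1)) with (z + 1) in * by (unfold z; ring).
    apply (flim_ext_ev _ (fun n => gauss_seq (z + 1) n * w (a + 1) * (1 + (z + 1) * RtoC (/ INR n)))).
    + exists 1%nat. intros n Hn. assert (P : (0 < INR n)%R) by (apply lt_0_INR; lia).
      unfold w. rewrite (U_reflection_wronskian_succ U Up HU a).
      replace (a + / 2) with z by (unfold z; ring).
      unfold gauss_seq.
      assert (P0 := poch_prod_neq_0 z n Ha). assert (P1 := poch_prod_neq_0 (z + 1) n Ha1).
      assert (PS := poch_prod_shift z n).
      rewrite Cmult_plus_distr_r, Cmult_1_l, cexp_plus, (cexp_RtoC (ln (INR n))), exp_ln by auto.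
      assert (NC : RtoC (INR n) <> 0) by (intros Q; apply RtoC_inj in Q; lra).
      rewrite RtoC_inv by lra. rewrite S_INR, RtoC_plus in PS.
      set (W := U_reflection_wronskian U Up (a + 1)). set (e := cexp (z * RtoC (ln (INR n)))).
      set (Q0 := poch_prod z n) in *. set (Q1 := poch_prod (z + 1) n) in *.
      transitivity (RtoC (INR (fact n)) * e * W * (Q0 * (z + (RtoC (INR n) + 1))) / (Q0 * Q1)); [field; auto|].
      rewrite <- PS. field. auto.
    + eapply flim_eq.
      * apply (flim_mult _); [exact IH|]. apply (flim_plus _); [apply (flim_const _)|].
        apply (flim_mult _); [apply (flim_const _)|apply flim_inv_INR].
      * ring.
Qed.

Lemma U_reflection_wronskian_gamma a : (forall n : nat, / 2 + a <> - RtoC (INR n)) ->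
  w a * CGamma (/ 2 + a) = RtoC (sqrt (2 * PI)).
Proof.
  intros Ha. destruct (ex_nat_ge (2 - Re (/ 2 + a))) as [N HN].
  assert (L := flim_gauss_seq_wronskian N a Ha ltac:(lra)).
  assert (S0 : RtoC (sqrt (2 * PI)) <> 0).
  { intros Q; apply RtoC_inj in Q. apply sqrt_eq_0 in Q; generalize PI_RGT_0; lra. }
  (* Were it 0, a null sequence would have the limit [sqrt (2 PI)]. Dividing by [w a] then gives the
     limit of Gauss' sequence itself. *)
  assert (w0 : w a <> 0).
  { intros Q. apply S0. apply (flim_unique eventually _ _ _ L).
    apply (flim_ext _ (fun _ => 0)); [|apply (flim_const _)]. intros n. rewrite Q. ring. }
  rewrite (CGamma_of_flim _ (RtoC (sqrt (2 * PI)) / w a)); [field; auto|].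
  apply (flim_ext _ (fun n => gauss_seq (/ 2 + a) n * w a * / w a)); [intros; field; auto|].
  apply (flim_mult _); [exact L|apply (flim_const _)].
Qed.
End PCF.

Theorem theorem5p2 :
  forall (U Up : C -> C -> C), is_PCF_U U Up ->
  forall (p : jk_pair) (a lam : C),
    (* for (j,k) = (1,3) the factor Gamma(1/2 + a) must be finite *)
    (p = JK13 -> forall n : nat, / 2 + a <> - RtoC (INR n)) ->
    L_U U a lam =
      - Up a 0 * U_jk U p 0 (- a) (2 * lam)
      - / 2 * U a 0 * U_jk U p 1 (- a) (2 * lam).
Proof.
  intros U Up HU. apply (laplace_U_of_gamma_identity U Up HU).
  intros a Ha. now apply U_reflection_wronskian_gamma.
Qed.
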